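(* Let $n\ge 1$ and let $f=\sum_{i=0}^n x^{n-i}y^iA_i$ be a binary form of degree $n$ (an $n$-form) with $A_i\in H_{I\setminus\{0,1\}}$. Then one has the decomposition $$f=C\prod_{i=1}^n (xY_i-yX_i-hyY_i)$$ into commuting, invariant linear forms, where $X_i,Y_i$ are elements of the central skew field extension $Q^\Sigma_{I\setminus\{0\}}=Q_{I\setminus\{0\}}[\sigma_1,\dots,\sigma_n]$ (the elements $\sigma_i$ commuting with $Q_I$ and with each other, invariant, and lying in a commutative splitting field of the typical representation of $f$; the $X_i,Y_i$ are given by $X_i=\gamma-\sigma_ix_1$, $Y_i=\delta-\sigma_iy_1$), and $C=f_1^{1-n}\in Q^{Inv}_{I\setminus\{0\}}$.
   Context: Fix $h\in\mathbb C$, $h\neq0$. $U_h(sl(2))$ is the complex unital Hopf algebra with generators $E,F,H$, relations $[H,E]=E\cosh(hF)+\cosh(hF)E$, $[H,F]=-\frac2h\sinh(hF)$, $[E,F]=H$, and coproduct $\Delta(E)=E\otimes e^{-hF}+e^{hF}\otimes E$, $\Delta(F)=F\otimes1+1\otimes F$, $\Delta(H)=H\otimes e^{-hF}+e^{hF}\otimes H$. For a totally ordered index set $I$, $H_I$ is the unital complex algebra with generators $x_i,y_i$ ($i\in I$) and relations $x_iy_i=y_ix_i+hy_i^2$ and, for $i<j$, $x_jy_i=y_ix_j+hy_iy_j$, $y_jx_i=x_iy_j-hy_iy_j$, $y_jy_i=y_iy_j$, $x_jx_i=x_ix_j-hx_iy_j+hy_ix_j+h^2y_iy_j$. It is a $U_h(sl(2))$-module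 algebra via $Hx_i=x_i$, $Hy_i=-y_i$, $Ex_i=0$, $Ey_i=x_i$, $Fx_i=y_i$, $Fy_i=0$, $E1=F1=H1=0$, and $E(ab)=E(a)e^{-hF}(b)+e^{hF}(a)E(b)$, $F(ab)=F(a)b+aF(b)$, $H(ab)=H(a)e^{-hF}(b)+e^{hF}(a)H(b)$. $H_I$ is a domain with right quotient division ring $Q_I$; the action is extended to $Q_I$ by the same Leibniz rules ($e^{\pm hF}$ extending as algebra automorphisms). An element $v$ is invariant if $Ev=Fv=Hv=0$; the superscript $Inv$ denotes the set of invariant elements. Put $(ij)=x_iy_j-y_ix_j-hy_iy_j\in H_I^{Inv}$. Assume $0,1\in I$ and write $x=x_0$, $y=y_0$. For $J\subseteq I$, $H_J\subseteq H_I$ is the subalgebra generated by the $x_i,y_i$, $i\in J$. An $n$-form is a nonzero element $f\in H_I^{Inv}$ of the form $\sum_i x^{n-i}y^iA_i$ with $A_i\in H_{I\setminus\{0\}}$ (the $A_i$ are unique). A linear form is a $1$-form; any linear form $xA+yB$ is written $xY-yX-hyY$ with $Y=A$, $X=-B-hA$; the same terminology is used with $X,Y$ in an extension of $Q_{I\setminus\{0\}}$. Polarization: $\Delta_{kl}:H_I\to H_I$ is the linear derivation with $\Delta_{kl}(x_k)=x_l$, $\Delta_{kl}(y_k)=y_l$, $\Delta_{kl}(x_i)=\Delta_{kl}(y_i)=0$ for $i\ne k$, and $P_{kl}a=\frac1m\Delta_{kl}(a)$ if $a$ is homogeneous of degree $m$ in the index $k$. Put $f_1:=P_{01}^nf=x_1^nA_0+x_1^{n-1}y_1A_1+\dots+y_1^nA_n$,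 $\xi:=P_{10}f_1=P_{01}^{n-1}f$, $\eta:=(01)$, and define $\gamma,\delta\in H_{I\setminus\{0\}}$ by $\xi=x\delta-y\gamma-hy\delta$. The typical representation of $f$ is $f=f_1^{-n}(\xi^nu_0+\xi^{n-1}\eta u_1+\dots+\eta^nu_n)$ with $u_i$ invariant elements of $H_{I\setminus\{0\}}$, $u_0=f_1$. Regarding it as a commutative binary form in $\xi,\eta$ with coefficients in $Q^{Inv}_{I\setminus\{0\}}$, one has a commutative splitting field $\Sigma\supset Q^{Inv}_{I\setminus\{0\}}$ and $\sigma_1,\dots,\sigma_n\in\Sigma$ with $f=C(\xi-\sigma_1\eta)\cdots(\xi-\sigma_n\eta)$, $C=u_0f_1^{-n}$. The $\sigma_i$ are taken to be invariant for an extended $U_h(sl(2))$-action and to commute with the skew field $Q_I$; $Q_I^\Sigma=Q_I[\sigma_1,\dots,\sigma_n]$ and $Q_{I\setminus\{0\}}^\Sigma=Q_{I\setminus\{0\}}[\sigma_1,\dots,\sigma_n]$ are the corresponding central skew field extensions. *)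

(* Defs.v *)
From HB Require Import structures.
From mathcomp Require Import all_boot all_order all_algebra.
From mathcomp Require Import ring_quotient boolp classical_sets reals.
From mathcomp Require Import complex monalg.
From mathcomp Require finmap.

Set Implicit Arguments.
Unset Strict Implicit.
Unset Printing Implicit Defensive.

Import Order.TTheory GRing.Theory.

Local Open Scope ring_scope.
Local Open Scope quotient_scope.

Section PresentedAlgebra.

Context {d : Order.disp_t} {K : fieldType}.

(* The pairs (lhs, rhs) of the defining relations of H_I. *)
Inductive HI_rel (h : K) (I : orderType d) (B : lalgType K) (x y : I -> B) :
    B -> B -> Prop :=
| HI_rel_diag i :
    HI_rel h x y (x i * y i) (y i * x i + h *: (y i ^+ 2))
| HI_rel_xy i j : (i < j)%O ->
    HI_rel h x y (x j * y i) (y i * x j + h *: (y i * y j))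
| HI_rel_yx i j : (i < j)%O ->
    HI_rel h x y (y j * x i) (x i * y j - h *: (y i * y j))
| HI_rel_yy i j : (i < j)%O ->
    HI_rel h x y (y j * y i) (y i * y j)
| HI_rel_xx i j : (i < j)%O ->
    HI_rel h x y (x j * x i)
      (x i * x j - h *: (x i * y j) + h *: (y i * x j)
       + h ^+ 2 *: (y i * y j)).

Lemma HI_rel_morph (h : K) (I : orderType d) (B B' : lalgType K)
    (g : {rmorphism B -> B'}) (x y : I -> B) u v :
  scalable g ->
  HI_rel h x y u v -> HI_rel h (g \o x) (g \o y) (g u) (g v).
Proof.
move=> gZ.
have gD w w' : g (w + w') = g w + g w' by rewrite rmorphD.
have gB w w' : g (w - w') = g w - g w' by rewrite rmorphB.
have gM w w' : g (w * w') = g w * g w' by rewrite rmorphM.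
have gX w k : g (w ^+ k) = g w ^+ k by rewrite rmorphXn.
case=> [i|i j ij|i j ij|i j ij|i j ij].
- rewrite gD gZ gX !gM.
  exact: (HI_rel_diag h (g \o x) (g \o y) i).
- rewrite gD gZ !gM.
  exact: (HI_rel_xy h (g \o x) (g \o y) ij).
- rewrite gB gZ !gM.
  exact: (HI_rel_yx h (g \o x) (g \o y) ij).
- rewrite !gM.
  exact: (HI_rel_yy h (g \o x) (g \o y) ij).
- rewrite 2!gD gB !gZ !gM.
  exact: (HI_rel_xx h (g \o x) (g \o y) ij).
Qed.

Context (h : K) (I : orderType d).

(* Free algebra on the letters [inl i] (for x_i) and [inr i] (for y_i). *)
Definition free_alg := {malg K[{fmonom (I + I)%type}]}.
HB.instance Definition _ := GRing.Lalgebra.on free_alg.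

Definition free_x (i : I) : free_alg := << fmu (inl i) >>.
Definition free_y (i : I) : free_alg := << fmu (inr i) >>.

Inductive HI_ideal : free_alg -> Prop :=
| HI_ideal_rel u v : HI_rel h free_x free_y u v -> HI_ideal (u - v)
| HI_ideal0 : HI_ideal 0
| HI_idealD u v : HI_ideal u -> HI_ideal v -> HI_ideal (u + v)
| HI_idealM a u b : HI_ideal u -> HI_ideal (a * u * b).

Definition HI_ideal_pred : {pred free_alg} := [pred u | `[< HI_ideal u >]].

Fact HI_ideal_zmod : zmod_closed HI_ideal_pred.
Proof.
split=> [|u v]; rewrite !inE; first exact: HI_ideal0.
move=> Iu Iv; apply: HI_idealD => //.
by rewrite -mulN1r -[_ * v]mulr1; apply: HI_idealM.
Qed.
HB.instance Definition _ := GRing.isZmodClosed.Build free_alg HI_ideal_pred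
  HI_ideal_zmod.

Definition HI := {ideal_quot HI_ideal_pred}.
HB.instance Definition _ := GRing.Zmodule.on HI.

Local Notation pi := (\pi_HI : free_alg -> HI).

Fact piP (u v : free_alg) : pi u = pi v <-> HI_ideal (u - v).
Proof.
split=> [/eqP|Iuv]; first by rewrite piE /Quotient.equiv inE.
by apply/eqP; rewrite piE /Quotient.equiv inE.
Qed.

Fact free_scalerAr (c : K) (u v : free_alg) : c *: (u * v) = u * (c *: v).
Proof.
rewrite (malgMEw (finmap.fsubset_refl _) (msuppZ_le c v)) malgME scaler_sumr.
apply: eq_bigr => k1 _; rewrite scaler_sumr; apply: eq_bigr => k2 _.
by apply/malgP => k; rewrite !(mcoeffZ, mcoeffU) mulrnAr mulrCA.
Qed.

Definition HI_mul (a b : HI) : HI := pi (repr a * repr b).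
Definition HI_scale (c : K) (a : HI) : HI := pi (c *: repr a).

Fact HI_pi_surj (a : HI) : exists u, a = pi u.
Proof. by exists (repr a); rewrite reprK. Qed.

Fact HI_piM u v : HI_mul (pi u) (pi v) = pi (u * v).
Proof.
apply/piP; set u' := repr _; set v' := repr _.
have Iu : HI_ideal (u' - u) by apply/piP; rewrite /u' reprK.
have Iv : HI_ideal (v' - v) by apply/piP; rewrite /v' reprK.
have -> : u' * v' - u * v = 1 * (u' - u) * v' + u * (v' - v) * 1.
  by rewrite mul1r mulr1 mulrBl mulrBr addrA subrK.
by apply: HI_idealD; apply: HI_idealM.
Qed.

Fact HI_piZ c u : HI_scale c (pi u) = pi (c *: u).
Proof.
apply/piP; set u' := repr _.
have Iu : HI_ideal (u' - u) by apply/piP; rewrite /u' reprK.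
rewrite -scalerBr -[u' - u]mul1r scalerAl -[_ * _]mulr1.
exact: HI_idealM.
Qed.

Fact HI_piD u v : pi (u + v) = pi u + pi v.
Proof. by rewrite !piE. Qed.

Local Lemma HI_mulA : associative (HI_mul : HI -> HI -> HI).
Proof.
move=> a b c; have [u ->] := HI_pi_surj a; have [v ->] := HI_pi_surj b.
by have [w ->] := HI_pi_surj c; rewrite !HI_piM mulrA.
Qed.

Local Lemma HI_mul1l : left_id (pi 1) HI_mul.
Proof. by move=> a; have [u ->] := HI_pi_surj a; rewrite HI_piM mul1r. Qed.

Local Lemma HI_mul1r : right_id (pi 1) HI_mul.
Proof. by move=> a; have [u ->] := HI_pi_surj a; rewrite HI_piM mulr1. Qed.

Local Lemma HI_mulDl : left_distributive HI_mul +%R.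
Proof.
move=> a b c; have [u ->] := HI_pi_surj a; have [v ->] := HI_pi_surj b.
by have [w ->] := HI_pi_surj c; rewrite -HI_piD !HI_piM mulrDl HI_piD.
Qed.

Local Lemma HI_mulDr : right_distributive HI_mul +%R.
Proof.
move=> a b c; have [u ->] := HI_pi_surj a; have [v ->] := HI_pi_surj b.
by have [w ->] := HI_pi_surj c; rewrite -HI_piD !HI_piM mulrDr HI_piD.
Qed.

(* The constant coefficient vanishes on the ideal, so [HI] is nontrivial. *)
Local Lemma HI_1neq0 : pi 1 != 0.
Proof.
apply/eqP; have -> : (0 : HI) = pi 0 by rewrite piE.
move/piP; rewrite subr0 => I1.
pose ev : {rmorphism free_alg -> K^o} :=
  (mcoeff (mone : {fmonom (I + I)%type}) : {rmorphism {malg K[_]} -> K}).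
have evZ : scalable ev by move=> c u; apply: mcoeffZ.
have ev_gen s : ev << fmu s >> = 0.
  rewrite /ev /= mcoeffU; case: eqP => // /(congr1 (@fmonom_val _)).
  by rewrite fmuE /mone /one /= fmoneE.
suff ev0 w : HI_ideal w -> ev w = 0.
  by move/eqP: (ev0 _ I1); rewrite rmorph1 oner_eq0.
elim=> [u v uv|||a u b _ IHu].
- apply/eqP; rewrite rmorphB subr_eq0; apply/eqP.
  have {uv} := HI_rel_morph evZ uv.
  have: ev \o free_y =1 fun=> 0 by move=> i; apply: ev_gen.
  have: ev \o free_x =1 fun=> 0 by move=> i; apply: ev_gen.
  move: (ev \o free_x) (ev \o free_y) (ev u) (ev v) => x y u' v' x0 y0.
  by case=> [i|i j _|i j _|i j _|i j _];
    rewrite ?expr2 ?x0 ?y0 ?(mul0r, mulr0, scaler0, addr0, subr0).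
- exact: rmorph0.
- by move=> u v _ IHu _ IHv; rewrite rmorphD IHu IHv addr0.
- by rewrite !rmorphM IHu mulr0 mul0r.
Qed.

HB.instance Definition _ := GRing.Zmodule_isNzRing.Build HI
  HI_mulA HI_mul1l HI_mul1r HI_mulDl HI_mulDr HI_1neq0.

Local Lemma HI_scaleA a b v :
  HI_scale a (HI_scale b v) = HI_scale (a * b) v.
Proof. by have [u ->] := HI_pi_surj v; rewrite !HI_piZ scalerA. Qed.

Local Lemma HI_scale1 : left_id 1 HI_scale.
Proof. by move=> a; have [u ->] := HI_pi_surj a; rewrite HI_piZ scale1r. Qed.

Local Lemma HI_scaleDr : right_distributive HI_scale +%R.
Proof.
move=> c a b; have [u ->] := HI_pi_surj a; have [v ->] := HI_pi_surj b.
by rewrite -HI_piD !HI_piZ scalerDr HI_piD.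
Qed.

Local Lemma HI_scaleDl v : {morph HI_scale^~ v : a b / a + b}.
Proof.
by move=> a b; have [u ->] := HI_pi_surj v; rewrite !HI_piZ scalerDl HI_piD.
Qed.

HB.instance Definition _ := GRing.Zmodule_isLmodule.Build K HI
  HI_scaleA HI_scale1 HI_scaleDr HI_scaleDl.

Lemma HI_pi_mul u v : pi (u * v) = pi u * pi v.
Proof. by rewrite -HI_piM. Qed.

Lemma HI_pi_scale (c : K) u : pi (c *: u) = c *: pi u.
Proof. by rewrite -HI_piZ. Qed.

Local Lemma HI_scaleAl (c : K) (a b : HI) : c *: (a * b) = c *: a * b.
Proof.
have [u ->] := HI_pi_surj a; have [v ->] := HI_pi_surj b.
by rewrite -HI_pi_mul -!HI_pi_scale scalerAl HI_pi_mul.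
Qed.

HB.instance Definition _ := GRing.Lmodule_isLalgebra.Build K HI HI_scaleAl.

Local Lemma HI_scaleAr (c : K) (a b : HI) : c *: (a * b) = a * (c *: b).
Proof.
have [u ->] := HI_pi_surj a; have [v ->] := HI_pi_surj b.
by rewrite -HI_pi_mul -!HI_pi_scale free_scalerAr HI_pi_mul.
Qed.

HB.instance Definition _ := GRing.Lalgebra_isAlgebra.Build K HI HI_scaleAr.

Definition HI_x (i : I) : HI := pi (free_x i).
Definition HI_y (i : I) : HI := pi (free_y i).

End PresentedAlgebra.

Arguments HI_x {d K} h {I} i.
Arguments HI_y {d K} h {I} i.

(* The unital subalgebra generated by a set. *)
Inductive alg_span (K : fieldType) (A : algType K) (S : set A) : A -> Prop :=
| alg_span_gen a : S a -> alg_span S a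
| alg_span1 : alg_span S 1
| alg_spanZ (c : K) a : alg_span S a -> alg_span S (c *: a)
| alg_spanD a b : alg_span S a -> alg_span S b -> alg_span S (a + b)
| alg_spanM a b : alg_span S a -> alg_span S b -> alg_span S (a * b).

Section Action.

Context {K : fieldType} (h : K).

(* A U_h(sl(2))-module algebra structure on [A].  The power series e^{hF} and
   e^{-hF} occurring in U_h(sl(2)) are kept as operators [aG] and [aG'] of
   their own, since F is not locally nilpotent on quotient rings. *)
Record uh_action (A : algType K) := UhAction {
  aE : {linear A -> A};
  aF : {linear A -> A};
  aH : {linear A -> A};
  aG : {lrmorphism A -> A};
  aG' : {lrmorphism A -> A};
  aGK : cancel aG aG';
  aG'K : cancel aG' aG;
  aE1 : aE 1 = 0;
  aF1 : aF 1 = 0;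
  aH1 : aH 1 = 0;
  aEM : forall a b, aE (a * b) = aE a * aG' b + aG a * aE b;
  aFM : forall a b, aF (a * b) = aF a * b + a * aF b;
  aHM : forall a b, aH (a * b) = aH a * aG' b + aG a * aH b;
  aGF : forall a, aG (aF a) = aF (aG a);
  (* [H,E] = E cosh(hF) + cosh(hF) E *)
  aHE : forall a, aH (aE a) - aE (aH a) =
          aE (2^-1 *: (aG a + aG' a)) + 2^-1 *: (aG (aE a) + aG' (aE a));
  (* [H,F] = -(2/h) sinh(hF) *)
  aHF : forall a, aH (aF a) - aF (aH a) =
          - ((2 / h) *: (2^-1 *: (aG a - aG' a)));
  aEF : forall a, aE (aF a) - aF (aE a) = aH a
}.

Definition uh_invariant (A : algType K) (s : uh_action A) (a : A) : Prop :=
  [/\ aE s a = 0, aF s a = 0 & aH s a = 0].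

Definition extends_action (A B : algType K) (g : A -> B)
    (s : uh_action A) (t : uh_action B) : Prop :=
  forall a, [/\ aE t (g a) = g (aE s a), aF t (g a) = g (aF s a),
    aH t (g a) = g (aH s a), aG t (g a) = g (aG s a)
    & aG' t (g a) = g (aG' s a)].

Definition linear_form_expr (A : algType K) (x y X Y : A) : A :=
  x * Y - y * X - h *: (y * Y).

End Action.

Section ModuleAlgebra.

Context {d : Order.disp_t} {K : fieldType} (h : K) (I : orderType d).

Local Notation H := (HI h I).
Local Notation x := (HI_x h).
Local Notation y := (HI_y h).

(* F^2 kills the generators, so the exponential series of e^{hF} and e^{-hF}
   stop after the linear term. *)
Definition HI_action (s : uh_action h H) : Prop :=
  forall i : I,
    [/\ aE s (x i) = 0, aF s (x i) = y i & aH s (x i) = x i] /\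
    [/\ aE s (y i) = x i, aF s (y i) = 0 & aH s (y i) = - y i] /\
    [/\ aG s (x i) = x i + h *: y i, aG s (y i) = y i,
        aG' s (x i) = x i - h *: y i & aG' s (y i) = y i].

Definition HJ (J : set I) : set H :=
  alg_span [set a | exists2 i, J i & a = x i \/ a = y i].

Definition bracket (i j : I) : H := linear_form_expr h (x i) (y i) (x j) (y j).

(* [homog k m a]: [a] is homogeneous of degree [m] in the index [k], i.e. a
   linear combination of words with [m] letters among x_k, y_k. *)
Inductive homog (k : I) : nat -> H -> Prop :=
| homog_x i : homog k (i == k) (x i)
| homog_y i : homog k (i == k) (y i)
| homog1 : homog k 0 1
| homog0 m : homog k m 0
| homogZ m c a : homog k m a -> homog k m (c *: a)
| homogD m a b : homog k m a -> homog k m b -> homog k m (a + b)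
| homogM m n a b : homog k m a -> homog k n b -> homog k (m + n) (a * b).

Definition is_polarization (k l : I) (D : H -> H) : Prop :=
  [/\ forall a b, D (a * b) = D a * b + a * D b,
      D (x k) = x l, D (y k) = y l
    & forall i, i != k -> D (x i) = 0 /\ D (y i) = 0].

(* P_{kl} for D = Delta_{kl}.  The degree is unique for a <> 0; on elements
   that are not homogeneous in the index k the value is the junk 0. *)
Definition polarize (k : I) (D : H -> H) (a : H) : H :=
  (xget 0%N [set m | homog k m a])%:R^-1 *: D a.

Definition is_nform (s : uh_action h H) (i0 : I) (n : nat)
    (A : 'I_n.+1 -> H) (f : H) : Prop :=
  [/\ f != 0, uh_invariant s f, forall i, HJ [set~ i0] (A i)
    & f = \sum_(i < n.+1) x i0 ^+ (n - i) * y i0 ^+ i * A i].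

End ModuleAlgebra.

Arguments HJ {d K h I} J.

Section Quotient.

Context {d : Order.disp_t} {K : fieldType} {h : K} {I : orderType d}.

Local Notation H := (HI h I).

Definition division_ring (A : unitRingType) : Prop :=
  forall a : A, a != 0 -> a \is a GRing.unit.

(* [iota] exhibits [Q] as the right quotient division ring of H_I. *)
Definition is_right_quotient (Q : unitAlgType K) (iota : H -> Q) : Prop :=
  [/\ division_ring Q, injective iota
    & forall q, exists a b, b != 0 /\ q = iota a / iota b].

Definition QJ (Q : unitAlgType K) (iota : H -> Q) (J : set I) : set Q :=
  [set q | exists a b, [/\ HJ J a, HJ J b, b != 0 & q = iota a / iota b]].

Definition QJinv (Q : unitAlgType K) (iota : H -> Q) (s : uh_action h Q)
    (J : set I) : set Q :=
  [set q | QJ iota J q /\ uh_invariant s q].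

(* f = f1^{-n} (xi^n u_0 + xi^{n-1} eta u_1 + ... + eta^n u_n) *)
Definition is_typical_repr (Q : unitAlgType K) (iota : H -> Q)
    (s : uh_action h H) (i0 : I) (n : nat) (f f1 xi eta : H)
    (u : 'I_n.+1 -> H) : Prop :=
  [/\ forall i, HJ [set~ i0] (u i) /\ uh_invariant s (u i),
      u ord0 = f1
    & iota f = iota f1 ^- n
               * iota (\sum_(i < n.+1) xi ^+ (n - i) * eta ^+ i * u i)].

(* A splitting field [spS] of the binary form with coefficients [spc],
   together with the central extension [spD] = Q_I[sigma_1, ..., sigma_n] and
   its extended action. *)
Record splitting (Q : unitAlgType K) (iota : H -> Q) (s : uh_action h Q)
    (i0 : I) (n : nat) (f1 : H) (u : 'I_n.+1 -> H) := Splitting {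
  spD : unitAlgType K;
  spj : {lrmorphism Q -> spD};
  sp_act : uh_action h spD;
  spS : fieldType;
  sp_emb : {rmorphism spS -> spD};
  spc : 'I_n.+1 -> spS;
  sp_sig : 'I_n -> spS;
  sp_division : division_ring spD;
  sp_ext : extends_action spj s sp_act;
  sp_inv : forall i, uh_invariant sp_act (sp_emb (sp_sig i));
  (* e^{hF} v = v whenever F v = 0 *)
  sp_invG : forall i, aG sp_act (sp_emb (sp_sig i)) = sp_emb (sp_sig i);
  sp_comm : forall i q,
    sp_emb (sp_sig i) * spj q = spj q * sp_emb (sp_sig i);
  sp_base : forall q, QJinv iota s [set~ i0] q -> exists c, sp_emb c = spj q;
  sp_coef : forall i, sp_emb (spc i) = spj (iota f1 ^- n * iota (u i));
  (* In two commuting variables xi = 'X and eta = 'X%:P. *)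
  sp_split :
    \sum_(i < n.+1) 'X ^+ (n - i) * 'X%:P ^+ i * (spc i)%:P%:P
    = (spc ord0)%:P%:P
      * \prod_(i < n) ('X - (sp_sig i)%:P%:P * 'X%:P) :> {poly {poly spS}};
  sp_genS : forall c, alg_span
    [set z | (exists2 q, QJinv iota s [set~ i0] q & z = spj q)
             \/ exists i, z = sp_emb (sp_sig i)] (sp_emb c);
  sp_genD : forall z, alg_span
    [set z | (exists q, z = spj q) \/ exists i, z = sp_emb (sp_sig i)] z
}.

(* Q_J[sigma_1, ..., sigma_n] *)
Definition QJ_sigma (Q : unitAlgType K) (iota : H -> Q) (s : uh_action h Q)
    (i0 : I) (n : nat) (f1 : H) (u : 'I_n.+1 -> H)
    (T : splitting iota s i0 f1 u) (J : set I) : set (spD T) :=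
  alg_span [set z | (exists2 q, QJ iota J q & z = spj T q)
                    \/ exists i, z = sp_emb T (sp_sig T i)].

End Quotient.

Arguments QJ_sigma {d K h I Q iota s i0 n f1 u} T J.

(* Main.v *)
(* Write G = e^{hF}.  The generators (x_i, y_i) are doublets of U_h(sl(2)), and
   the R-matrix commutes a doublet past any element: y a = G^-1(a) y and
   x a = G(a) x + S(a) y.  Consequently an element killed by H and fixed by G
   is central.  An invariant v of Q_I satisfies G v = G^-1 v, so w = v - G v
   satisfies G w = -w, and w = 0 because G is unipotent on numerators and
   denominators; hence the invariants of Q_I are central.

   f1 is the image of f under an equivariant substitution, xi is a linear form
   x delta - y gamma - h y delta, where (gamma, delta) is a doublet, and
   f1 = x_1 delta - y_1 gamma - h y_1 delta.  From f1 x = xi x_1 - eta gamma and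
   f1 y = xi y_1 - eta delta one reads off the typical representation.

   Dehomogenized, it is a monic invariant polynomial p over Q_I.  An irreducible
   factor of p over the field of G-fixed elements is killed by the derivations
   H, E and F, hence is invariant, and it stays irreducible over Q_I: after
   clearing denominators, top differences under G - 1 of a factorization are
   factorizations over the fixed field.  The commutant of its companion matrix
   in a matrix ring over Q_I is therefore a division ring, obtained from Q_I by
   adjoining a central invariant root of p, on which U_h(sl(2)) acts
   entrywise.  Iterating splits p, and evaluating the splitting at the central
   elements xi, eta gives the factors xi - sigma_i eta, which are the linear
   forms with X_i = gamma - sigma_i x_1, Y_i = delta - sigma_i y_1. *)

From HB Require Import structures.
Require Import Defs.
From mathcomp Require Import all_boot all_order all_algebra.
From mathcomp Require Import ring_quotient boolp classical_sets reals complex.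
From mathcomp Require Import monalg.

Set Implicit Arguments.
Unset Strict Implicit.
Unset Printing Implicit Defensive.

Import Order.TTheory GRing.Theory Num.Theory.

(** The obstacle is that an abstract splitting field cannot simply be tensored with [Q]: a
    polynomial irreducible over the invariants might factor over [Q], and the tensor product would
    then have zero divisors. The extension is therefore built directly as a division ring, one root
    at a time, and the commutative field Sigma is recovered afterwards inside it, as the span of the
    invariant fractions and the roots. The record [good] collects what one adjunction uses and
    reproduces.

    Facts usually read off from a basis of H_I come from maps out of it: uniqueness of the
    coefficients of a linear form from a substitution of indices, nonvanishing of y_0 and (01) from
    a small representation. The supply of equivariant substitutions rests on one observation: the
    relations of H_I say exactly that the doublets (x_i, y_i) braid with each other, so any doublets
    may replace them.

    Characteristic 0 enters through 2, through factorials and binomial coefficients in iterated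
    differences, and through derivatives of polynomials. *)

Local Open Scope ring_scope.

(* Equality in the free noncommutative algebra over Z[h], by reflection: an
   expression is normalized to a pair (positive, negative) of multisets of
   monomials, a monomial being a power of h and a word in the atoms. *)
Inductive nc_expr :=
  | NCVar of nat | NC0 | NC1 | NCAdd of nc_expr & nc_expr | NCOpp of nc_expr
  | NCMul of nc_expr & nc_expr | NCScale of nc_expr.

Definition nc_mono : Type := (nat * seq nat)%type.
Definition nc_nf : Type := (seq nc_mono * seq nc_mono)%type.

Definition nc_mulm (u v : nc_mono) : nc_mono := ((u.1 + v.1)%N, u.2 ++ v.2).
Definition nc_muls (s t : seq nc_mono) := [seq nc_mulm u v | u <- s, v <- t].
Definition nc_incr (s : seq nc_mono) : seq nc_mono := [seq (u.1.+1, u.2) | u <- s].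

Fixpoint nc_norm (e : nc_expr) : nc_nf :=
  match e with
  | NCVar i => ([:: (0%N, [:: i])], [::])
  | NC0 => ([::], [::])
  | NC1 => ([:: (0%N, [::])], [::])
  | NCAdd a b => let p := nc_norm a in let q := nc_norm b in
                 (p.1 ++ q.1, p.2 ++ q.2)
  | NCOpp a => let p := nc_norm a in (p.2, p.1)
  | NCMul a b => let p := nc_norm a in let q := nc_norm b in
                 (nc_muls p.1 q.1 ++ nc_muls p.2 q.2,
                  nc_muls p.1 q.2 ++ nc_muls p.2 q.1)
  | NCScale a => let p := nc_norm a in (nc_incr p.1, nc_incr p.2)
  end.

Section NCEval.
Variables (K : fieldType) (A : algType K) (h : K) (env : seq A).

Fixpoint nc_eval (e : nc_expr) : A :=
  match e with
  | NCVar i => env`_i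
  | NC0 => 0
  | NC1 => 1
  | NCAdd a b => nc_eval a + nc_eval b
  | NCOpp a => - nc_eval a
  | NCMul a b => nc_eval a * nc_eval b
  | NCScale a => h *: nc_eval a
  end.

Let evm (u : nc_mono) : A := h ^+ u.1 *: \prod_(i <- u.2) env`_i.
Let evs (s : seq nc_mono) : A := \sum_(u <- s) evm u.

Let evs_cat s t : evs (s ++ t) = evs s + evs t.
Proof. by rewrite /evs big_cat. Qed.

Let evs_mul s t : evs (nc_muls s t) = evs s * evs t.
Proof.
rewrite /evs /nc_muls big_allpairs_dep mulr_suml; apply: eq_bigr => u _.
rewrite mulr_sumr; apply: eq_bigr => v _.
by rewrite /evm /= big_cat exprD -scalerAl -scalerAr scalerA.
Qed.

Let evs_incr s : evs (nc_incr s) = h *: evs s.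
Proof.
rewrite /evs big_map scaler_sumr; apply: eq_bigr => u _.
by rewrite /evm /= exprS scalerA.
Qed.

Let nc_normP e : nc_eval e = evs (nc_norm e).1 - evs (nc_norm e).2.
Proof.
elim: e => [i|||a IHa b IHb|a IHa|a IHa b IHb|a IHa] /=; rewrite ?IHa ?IHb.
- by rewrite /evs big_nil big_seq1 subr0 /evm /= big_seq1 scale1r.
- by rewrite /evs big_nil subr0.
- by rewrite /evs big_nil big_seq1 subr0 /evm /= big_nil scale1r.
- by rewrite !evs_cat opprD addrACA.
- by rewrite opprB.
- by rewrite !evs_cat !evs_mul mulrBl !mulrBr opprB addrACA -opprD.
- by rewrite !evs_incr scalerBr.
Qed.

(** Two differences p1 - p2 and q1 - q2 are compared crosswise, p1 + q2 against q1 + p2; terms that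
    cancel inside one expression then occur on both sides. *)
Lemma nc_correct a b :
  perm_eq ((nc_norm a).1 ++ (nc_norm b).2) ((nc_norm b).1 ++ (nc_norm a).2) ->
  nc_eval a = nc_eval b.
Proof.
move=> ab; rewrite !nc_normP; apply/eqP.
rewrite subr_eq addrAC eq_sym subr_eq eq_sym -!evs_cat; apply/eqP.
exact: perm_big.
Qed.
End NCEval.

Ltac nc_same a b :=
  match goal with
  | _ => let _ := match goal with _ => constr_eq_nounivs a b end in constr:(true)
  | _ => let _ := match goal with _ => unify a b end in constr:(true)
  | _ => constr:(false)
  end.
Ltac nc_index a env :=
  lazymatch env with
  | ?b :: ?t =>
    let c := nc_same a b in
    lazymatch c with
    | true => constr:(0%N)
    | false => let n := nc_index a t in constr:(S n)
    end
  end.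
Ltac nc_mem a env :=
  lazymatch env with
  | nil => constr:(false)
  | ?b :: ?t =>
    let c := nc_same a b in
    lazymatch c with true => constr:(true) | false => nc_mem a t end
  end.
Ltac nc_add a env :=
  let b := nc_mem a env in
  lazymatch b with true => env | false => constr:(a :: env) end.

Ltac nc_env h env t :=
  lazymatch t with
  | 0%R => env
  | 1%R => env
  | (?a + ?b)%R => let e := nc_env h env a in nc_env h e b
  | (- ?a)%R => nc_env h env a
  | (?a * ?b)%R => let e := nc_env h env a in nc_env h e b
  | h *: ?a => nc_env h env a
  | _ => nc_add t env
  end.
Ltac nc_quote h env t :=
  lazymatch t with
  | 0%R => constr:(NC0)
  | 1%R => constr:(NC1)
  | (?a + ?b)%R =>
      let x := nc_quote h env a in let y := nc_quote h env b in
      constr:(NCAdd x y)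
  | (- ?a)%R => let x := nc_quote h env a in constr:(NCOpp x)
  | (?a * ?b)%R =>
      let x := nc_quote h env a in let y := nc_quote h env b in
      constr:(NCMul x y)
  | h *: ?a => let x := nc_quote h env a in constr:(NCScale x)
  | _ => let n := nc_index t env in constr:(NCVar n)
  end.
Ltac nc h :=
  rewrite ?expr2 -?scalerA;
  lazymatch goal with
  | |- @eq ?T ?a ?b =>
    let e0 := nc_env h (@nil T) a in
    let env := nc_env h e0 b in
    let x := nc_quote h env a in
    let y := nc_quote h env b in
    refine (@nc_correct _ _ h env x y _); vm_compute; reflexivity
  end.

(** * The presented algebra H_I *)

(** Stated for an unbundled map, to be applied to the projection [pi], whose compatibilities with
    the operations are separate facts. *)
Lemma HI_rel_image {d : Order.disp_t} (K : fieldType) (h : K) (I : orderType d)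
    (B B' : lalgType K) (p : B -> B') (X Y : I -> B) :
    (forall u v, p (u + v) = p u + p v) ->
    (forall c u, p (c *: u) = c *: p u) ->
    (forall u v, p (u * v) = p u * p v) ->
    (forall u v, HI_rel h X Y u v -> p u = p v) ->
  forall u v, HI_rel h (p \o X) (p \o Y) u v -> u = v.
Proof.
move=> pD pZ pM P u v.
have pB a b : p (a - b) = p a - p b by rewrite -[- b]scaleN1r pD pZ scaleN1r.
case=> [i|i j ij|i j ij|i j ij|i j ij] /=.
- have := P _ _ (HI_rel_diag h X Y i).
  by rewrite !expr2 pD pZ !pM.
- have := P _ _ (HI_rel_xy h X Y ij).
  by rewrite pD pZ !pM.
- have := P _ _ (HI_rel_yx h X Y ij).
  by rewrite pB pZ !pM.
- have := P _ _ (HI_rel_yy h X Y ij).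
  by rewrite !pM.
- have := P _ _ (HI_rel_xx h X Y ij).
  by rewrite 2!pD pB 3!pZ !pM.
Qed.

Lemma xx_relations (K : fieldType) (A : algType K) (h : K) (x y x' y' : A) :
  y' * x = x * y' - h *: (y * y') ->
  x' * x = x * x' - h *: (x * y') + h *: (y * x') + h ^+ 2 *: (y * y') ->
  x * x' = x' * x + h *: (y' * x) - h *: (y * x') /\
  x' * x = x * x' + h *: (y * x') - h *: (y' * x).
Proof. by move=> -> ->; split; nc h. Qed.

Section Presentation.
Local Open Scope quotient_scope.
Context {d : Order.disp_t} {K : fieldType} (h : K) (I : orderType d).
Local Notation H := (HI h I).
Local Notation free_alg := (@free_alg d K I).
Local Notation free_x := (@free_x d K I).
Local Notation free_y := (@free_y d K I).
Local Notation x := (HI_x h).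
Local Notation y := (HI_y h).
Local Notation pi := (\pi_H : free_alg -> H).

Lemma HI_pi_lin : (pi 1 = 1) * (forall u v, pi (u + v) = pi u + pi v) * (pi 0 = 0).
Proof. by split; first split; [|exact: HI_piD|rewrite piE]. Qed.

Lemma HI_generated (a : H) : HJ setT a.
Proof.
have [u ->] := HI_pi_surj a.
rewrite [u]monalgE; elim/big_rec: _ => [|m v _ IH].
  by rewrite HI_pi_lin -(scale0r (1 : H)); apply: alg_spanZ; apply: alg_span1.
rewrite HI_piD; apply: alg_spanD => //.
have -> : << u@_m *g m >> = u@_m *: << m >> :> free_alg.
  apply/malgP => k; rewrite mcoeffZ !mcoeffU.
  by case: eqP; rewrite ?mulr1n ?mulr0n ?mulr1 ?mulr0.
rewrite HI_pi_scale; apply: alg_spanZ.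
have {IH} [s ->] : exists s, m = FMonom s by case: m => s; exists s.
elim: s => [|i s IH].
  suff -> : << FMonom [::] >> = 1 :> free_alg by rewrite HI_pi_lin; apply: alg_span1.
  by rewrite -fmoneE.
have -> : << FMonom (i :: s) >> = << fmu i >> * << FMonom s >> :> free_alg.
  by rewrite malgM_def fgmulUU mulr1; congr << _ >>; apply/eqP; rewrite fmP fmM fmU.
rewrite HI_pi_mul; apply: alg_spanM => //; apply: alg_span_gen.
by case: i => i; exists i => //; [left|right].
Qed.

Lemma HI_relE (u v : H) : HI_rel h x y u v -> u = v.
Proof.
by apply: (HI_rel_image (HI_piD h (I:=I)) (HI_pi_scale h (I:=I))
  (HI_pi_mul h (I:=I))) => a b ab; apply/Defs.piP/HI_ideal_rel.
Qed.

Opaque HI_x HI_y.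

(** This and the next two relations hold for all [i] and [j]: solving the relation given for i < j
    for the opposite product yields the same formula, so the order of [I] disappears from later
    computations. *)
Lemma HI_yy (i j : I) : y i * y j = y j * y i.
Proof.
by case: (ltgtP i j) => [ij|ij|-> //]; rewrite (HI_relE (@HI_rel_yy d K h I H x y _ _ ij)).
Qed.

Lemma HI_xy (i j : I) : x i * y j = y j * x i + h *: (y i * y j).
Proof.
case: (ltgtP i j) => [ij|ij|->].
- by rewrite (HI_relE (@HI_rel_yx d K h I H x y _ _ ij)) subrK.
- by rewrite (HI_relE (@HI_rel_xy d K h I H x y _ _ ij)) (HI_yy j).
- by rewrite (HI_relE (@HI_rel_diag d K h I H x y j)) expr2.
Qed.

Lemma HI_xx (i j : I) :
  x i * x j = x j * x i + h *: (y j * x i) - h *: (y i * x j).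
Proof.
have rel k l (kl : (k < l)%O) := xx_relations (HI_relE (@HI_rel_yx d K h I H x y k l kl))
  (HI_relE (@HI_rel_xx d K h I H x y k l kl)).
case: (ltgtP i j) => [ij|ij|->]; last by rewrite addrK.
- exact: (proj1 (rel _ _ ij)).
- exact: (proj2 (rel _ _ ij)).
Qed.

Section Lift.
Context (B : algType K) (X Y : I -> B).
Hypothesis rels : forall u v, HI_rel h X Y u v -> u = v.

Definition HI_lift_mono (m : {fmonom (I + I)%type}) : B :=
  \prod_(s <- m) match s with inl i => X i | inr i => Y i end.

Fact HI_lift_mono_mmorphism : mmorphism HI_lift_mono.
Proof.
split=> [m n|]; rewrite /HI_lift_mono ?fm1 ?big_nil //.
by rewrite fmM big_cat.
Qed.
HB.instance Definition _ :=
  isMultiplicative.Build _ B HI_lift_mono HI_lift_mono_mmorphism.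

Definition HI_lift_free : free_alg -> B :=
  mmap (GRing.in_alg B) HI_lift_mono.

Fact HI_lift_free_zmod : zmod_morphism HI_lift_free.
Proof. exact: mmap_is_additive. Qed.
HB.instance Definition _ :=
  GRing.isZmodMorphism.Build (free_alg) B HI_lift_free HI_lift_free_zmod.

Fact HI_lift_free_monoid : monoid_morphism HI_lift_free.
Proof.
have := @commr_mmap_is_multiplicative _ _ B (GRing.in_alg B) HI_lift_mono.
case=> [g m m'|gM g1].
  by rewrite /GRing.comm /= -scalerAl mul1r -scalerAr mulr1.
by split.
Qed.
HB.instance Definition _ :=
  GRing.isMonoidMorphism.Build (free_alg) B HI_lift_free HI_lift_free_monoid.

Fact HI_lift_free_scal : scalable HI_lift_free.
Proof.
move=> c u; rewrite /HI_lift_free (@mmapZ _ _ B (GRing.in_alg B) HI_lift_mono) /=.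
by rewrite -scalerAl mul1r.
Qed.

Fact HI_lift_freeE :
  HI_lift_free \o free_x =1 X /\ HI_lift_free \o free_y =1 Y.
Proof.
by split=> i /=; rewrite /HI_lift_free mmapU /= scale1r mul1r /HI_lift_mono
  fmuE /= big_seq1.
Qed.

Fact HI_lift_free_ideal u : HI_ideal h u -> HI_lift_free u = 0.
Proof.
elim=> {u} [u v uv||u v _ IHu _ IHv|a u b _ IHu].
- apply/eqP; rewrite raddfB subr_eq0; apply/eqP/rels.
  have := HI_rel_morph HI_lift_free_scal uv.
  by have [/funext -> /funext ->] := HI_lift_freeE.
- exact: raddf0.
- by rewrite raddfD /= IHu IHv addr0.
- by rewrite !rmorphM /= IHu mulr0 mul0r.
Qed.

Definition HI_lift (a : H) : B := HI_lift_free (repr a).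

Fact HI_lift_pi u : HI_lift (pi u) = HI_lift_free u.
Proof.
apply/eqP; rewrite -subr_eq0 -raddfB; apply/eqP/HI_lift_free_ideal/Defs.piP.
by rewrite reprK.
Qed.

Fact HI_lift_zmod : zmod_morphism HI_lift.
Proof.
move=> a b; have [u ->] := HI_pi_surj a; have [v ->] := HI_pi_surj b.
by rewrite -[pi u - _]raddfB /= !HI_lift_pi raddfB.
Qed.
HB.instance Definition _ := GRing.isZmodMorphism.Build H B HI_lift HI_lift_zmod.

Fact HI_lift_monoid : monoid_morphism HI_lift.
Proof.
split=> [|a b]; first by rewrite -[1]/(pi 1) HI_lift_pi rmorph1.
have [u ->] := HI_pi_surj a; have [v ->] := HI_pi_surj b.
by rewrite -HI_pi_mul !HI_lift_pi rmorphM.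
Qed.
HB.instance Definition _ := GRing.isMonoidMorphism.Build H B HI_lift HI_lift_monoid.

Fact HI_lift_scal : scalable HI_lift.
Proof.
move=> c a; have [u ->] := HI_pi_surj a.
by rewrite -HI_pi_scale !HI_lift_pi HI_lift_free_scal.
Qed.
HB.instance Definition _ := GRing.isScalable.Build K H B *:%R HI_lift HI_lift_scal.

Lemma HI_universal : exists phi : {lrmorphism H -> B},
  forall i : I, phi (x i) = X i /\ phi (y i) = Y i.
Proof.
have [fx fy] := HI_lift_freeE.
exists (HI_lift : {lrmorphism H -> B}) => i.
by rewrite /= !HI_lift_pi -fx -fy.
Qed.
End Lift.
End Presentation.

(** * Doublets and braiding *)

Section Difference.
Context {A : nzRingType} (G : {rmorphism A -> A}).

(** With [G] = e^{hF} this is the nilpotent part of a unipotent automorphism. It behaves like a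
    finite difference: its Leibniz rule [gdiffM] has an extra product of differences. *)
Definition gdiff (a : A) : A := G a - a.

Lemma gdiffB a b : gdiff (a - b) = gdiff a - gdiff b.
Proof. by rewrite /gdiff rmorphB opprD addrACA -opprD. Qed.
HB.instance Definition _ := GRing.isZmodMorphism.Build A A gdiff gdiffB.

Lemma iter_gdiffD n : {morph iter n gdiff : a b / a + b}.
Proof. elim: n => [|n IH] a b //=. by rewrite IH raddfD. Qed.

Lemma iter_gdiff0 n : iter n gdiff 0 = 0.
Proof. by elim: n => //= n ->; rewrite raddf0. Qed.

Lemma iter_gdiff_ge m n a : (m <= n)%N -> iter m gdiff a = 0 -> iter n gdiff a = 0.
Proof. by move=> /subnK <- a0; rewrite iterD a0 iter_gdiff0. Qed.

Lemma gdiffM a b : gdiff (a * b) = gdiff a * b + gdiff a * gdiff b + a * gdiff b.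
Proof.
rewrite /gdiff rmorphM -mulrDr [b + _]addrCA subrr addr0 mulrBr.
by rewrite mulrBl addrA subrK.
Qed.

(** The condition [iter m.+1 gdiff a = 0] says that [a] has degree at most [m], as for finite
    differences of polynomials; degrees add under products. *)
Lemma iter_gdiffM0 m n a b :
  iter m.+1 gdiff a = 0 -> iter n.+1 gdiff b = 0 ->
  iter (m + n).+1 gdiff (a * b) = 0.
Proof.
have: (m + n = m + n)%N by [].
move: {2 3}(m + n)%N => k; elim: k m n a b => [|k IH] m n a b mn.
  move/eqP: mn; rewrite addn_eq0 => /andP[/eqP-> /eqP->] /= a0 b0.
  by rewrite gdiffM a0 b0 !mul0r mulr0 !addr0.
rewrite !iterSr => a0 b0; rewrite -iterSr gdiffM !iter_gdiffD.
have first c : iter n.+1 gdiff c = 0 -> iter k.+1 gdiff (gdiff a * c) = 0.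
  move=> c0; case: m mn a0 => [|m] mn a0; last by apply: (IH m n) => //; case: mn.
  by rewrite (a0 : gdiff a = 0) mul0r iter_gdiff0.
have -> : iter k.+1 gdiff (a * gdiff b) = 0.
  case: n mn b0 {first} => [|n] mn b0; first by rewrite (b0 : gdiff b = 0) mulr0 iter_gdiff0.
  by apply: (IH m n) => //; rewrite ?iterSr //; move: mn; rewrite addnS => -[].
rewrite !first ?addr0 ?iterSr //.
by rewrite -iterSr -[LHS]/(gdiff (iter n gdiff (gdiff b))) b0 raddf0.
Qed.

(** Top differences play the role of leading coefficients: they are multiplicative up to a binomial
    coefficient, which counts the ways to distribute the differences over the two factors. *)
Lemma iter_gdiffM m n a b :
  iter m.+1 gdiff a = 0 -> iter n.+1 gdiff b = 0 ->
  iter (m + n) gdiff (a * b) =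
    iter m gdiff a * iter n gdiff b *+ 'C(m + n, m).
Proof.
have: (m + n = m + n)%N by [].
move: {2 3 4}(m + n)%N => k; elim: k m n a b => [|k IH] m n a b mn.
  by move/eqP: mn; rewrite addn_eq0 => /andP[/eqP-> /eqP->] /= _ _; rewrite mulr1n.
rewrite !iterSr => a0 b0; rewrite gdiffM !iter_gdiffD.
(* Both factors have lost one degree, so the cross term has degree below [k]. *)
have -> : iter k gdiff (gdiff a * gdiff b) = 0.
  case: m mn a0 => [|m] mn a0; first by rewrite (a0 : gdiff a = 0) mul0r iter_gdiff0.
  case: n mn b0 => [|n] mn b0; first by rewrite (b0 : gdiff b = 0) mulr0 iter_gdiff0.
  have -> : k = (m + n).+1 by move: mn; rewrite addnS => -[].
  exact: iter_gdiffM0.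
rewrite addr0; case: m mn a0 => [|m] mn a0.
  have {}a0 : gdiff a = 0 := a0; rewrite a0 mul0r iter_gdiff0 add0r.
  rewrite add0n in mn; subst n.
  by rewrite (IH 0%N k a (gdiff b) (add0n k) a0 b0) !bin0 iterSr.
have a1 : iter m.+2 gdiff a = 0 by rewrite iterSr.
case: n mn b0 => [|n] mn b0.
  have {}b0 : gdiff b = 0 := b0; rewrite b0 mulr0 iter_gdiff0 addr0.
  move: mn; rewrite addn0 => -[mn]; subst k.
  by rewrite (IH m 0%N (gdiff a) b (addn0 m) a0 b0) !binn iterSr.
have b1 : iter n.+2 gdiff b = 0 by rewrite iterSr.
have k1 : (m + n.+1)%N = k by move: mn; rewrite addSn => -[].
have k2 : (m.+1 + n)%N = k by rewrite addSn -addnS.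
rewrite (IH m n.+1 (gdiff a) b k1 a0 b1) (IH m.+1 n a (gdiff b) k2 a1 b0).
by rewrite -!iterSr -mulrnDr binS addnC.
Qed.

Definition gnil (a : A) : Prop := exists n, iter n gdiff a = 0.

Lemma gnil_fix a : G a = a -> gnil a.
Proof. by move=> Ga; exists 1%N; rewrite /= /gdiff Ga subrr. Qed.

Lemma gnilD a b : gnil a -> gnil b -> gnil (a + b).
Proof.
move=> [m a0] [n b0]; exists (maxn m n).
by rewrite iter_gdiffD (iter_gdiff_ge _ a0) ?(iter_gdiff_ge _ b0) ?addr0
  ?leq_maxl ?leq_maxr.
Qed.

Lemma gnilM a b : gnil a -> gnil b -> gnil (a * b).
Proof.
move=> [m a0] [n b0]; exists (m + n).+1.
by apply: iter_gdiffM0; [apply: iter_gdiff_ge a0|apply: iter_gdiff_ge b0].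
Qed.

Lemma gnil_iter n a : gnil a -> gnil (iter n gdiff a).
Proof.
move=> [m a0]; exists m; rewrite -iterD addnC.
by apply: iter_gdiff_ge a0; rewrite leq_addl.
Qed.

Lemma gnil_top a : gnil a -> a != 0 ->
  exists n, iter n gdiff a != 0 /\ iter n.+1 gdiff a = 0.
Proof.
move=> [n]; elim: n => [/= -> /eqP //|n IH] a0 an0.
have [an|an] := eqVneq (iter n gdiff a) 0; first exact: IH.
by exists n.
Qed.

Lemma gdiff_fix a : gdiff a = 0 -> G a = a.
Proof. by move/eqP; rewrite subr_eq0 => /eqP. Qed.

End Difference.

Section AlgSpan.
Context {K : fieldType}.

Lemma alg_span0 (A : algType K) (S : set A) : alg_span S 0.
Proof. by rewrite -(scale0r (1 : A)); apply/alg_spanZ/alg_span1. Qed.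

Lemma alg_spanN (A : algType K) (S : set A) a : alg_span S a -> alg_span S (- a).
Proof. by rewrite -scaleN1r; apply: alg_spanZ. Qed.

Lemma alg_spanB (A : algType K) (S : set A) a b :
  alg_span S a -> alg_span S b -> alg_span S (a - b).
Proof. by move=> Sa Sb; apply/alg_spanD/alg_spanN. Qed.

Lemma alg_spanX (A : algType K) (S : set A) a n : alg_span S a -> alg_span S (a ^+ n).
Proof.
move=> Sa; elim: n => [|n IH]; first exact: alg_span1.
by rewrite exprS; apply: alg_spanM.
Qed.

Lemma alg_span_sum (A : algType K) (S : set A) (J : Type) (r : seq J) (P : pred J) (F : J -> A) :
  (forall i, P i -> alg_span S (F i)) -> alg_span S (\sum_(i <- r | P i) F i).
Proof. by move=> SF; elim/big_ind: _ => //; [exact: alg_span0|exact: alg_spanD]. Qed.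

Lemma alg_span_trans (A : algType K) (S T : set A) a :
  alg_span S a -> (forall b, S b -> alg_span T b) -> alg_span T a.
Proof.
move=> Sa ST; elim: Sa => {a} [a /ST//||c a _ IH|a b _ IHa _ IHb|a b _ IHa _ IHb].
- exact: alg_span1.
- exact: alg_spanZ.
- exact: alg_spanD.
- exact: alg_spanM.
Qed.

Lemma alg_span_comm (A : algType K) (S : set A) b :
  (forall a, S a -> a * b = b * a) -> forall a, alg_span S a -> a * b = b * a.
Proof.
move=> Sb a; elim=> {a} [a /Sb//||c a _ IH|a c _ IHa _ IHc|a c _ IHa _ IHc].
- by rewrite mul1r mulr1.
- by rewrite -scalerAl IH scalerAr.
- by rewrite mulrDl mulrDr IHa IHc.
- by rewrite -mulrA IHc mulrA IHa mulrA.
Qed.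

Lemma alg_span_comm2 (A : algType K) (S : set A) :
  (forall a b, S a -> S b -> a * b = b * a) ->
  forall a b, alg_span S a -> alg_span S b -> a * b = b * a.
Proof.
move=> SS a b Sa Sb; apply: alg_span_comm Sa => {}a Sa; symmetry.
by apply: alg_span_comm Sb => {}b Sb; apply: SS.
Qed.

Lemma alg_span_image (A B : algType K) (g : {lrmorphism A -> B})
    (S : set A) (T : set B) a :
  (forall b, S b -> alg_span T (g b)) -> alg_span S a -> alg_span T (g a).
Proof.
move=> ST; elim=> {a} [a /ST//||c a _ IH|a b _ IHa _ IHb|a b _ IHa _ IHb].
- by rewrite rmorph1; apply: alg_span1.
- by rewrite linearZ; apply: alg_spanZ.
- by rewrite raddfD; apply: alg_spanD.
- by rewrite rmorphM; apply: alg_spanM.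
Qed.
End AlgSpan.

Lemma morph_linear_form (K : fieldType) (h : K) (A B : algType K) (g : {lrmorphism A -> B})
    (p q p' q' : A) :
  g (linear_form_expr h p q p' q') = linear_form_expr h (g p) (g q) (g p') (g q').
Proof. by rewrite /linear_form_expr !raddfB /= linearZ /= !rmorphM. Qed.

Section Braiding.
Context {K : numFieldType} {h : K} {A : algType K} (s : uh_action h A).
Local Notation E := (aE s).
Local Notation F := (aF s).
Local Notation H := (aH s).
Local Notation G := (aG s).
Local Notation G' := (aG' s).

(** The two-dimensional representation inside [A]. [G] and [G'] have their own clause because an
    action keeps e^{hF} and e^{-hF} as separate operators. *)
Definition doublet (p q : A) : Prop :=
  [/\ E p = 0, F p = q & H p = p] /\
  [/\ E q = p, F q = 0 & H q = - q] /\
  [/\ G p = p + h *: q, G q = q, G' p = p - h *: q & G' q = q].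

(* The component along q of the braiding of a doublet (p, q) with a: the
   R-matrix gives q a = G'(a) q and p a = G(a) p + S(a) q. *)
Definition uhS : A -> A := ((h / 2) \*: (G \- G')) \- (h \*: H).
HB.instance Definition _ := GRing.Linear.copy uhS
  (((h / 2) \*: (G \- G')) \- (h \*: H)).

Lemma uhSE a : uhS a = (h / 2) *: (G a - G' a) - h *: H a.
Proof. by []. Qed.

Definition braided (p q a : A) : Prop :=
  q * a = G' a * q /\ p * a = G a * p + uhS a * q.

(** By telescoping, [G - G'] is a twisted derivation of the same type as [H], hence so is their
    combination [uhS]. This is what carries the braiding from two factors to their product. *)
Lemma uhS_M a b : uhS (a * b) = uhS a * G' b + G a * uhS b.
Proof.
rewrite !uhSE !rmorphM aHM /= [h *: (_ + _)]scalerDr opprD.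
rewrite mulrBl mulrBr -!scalerAl -!scalerAr addrACA; congr (_ + _).
by rewrite -scalerDr mulrBl mulrBr [X in _ = _ *: X]addrC addrA subrK.
Qed.

Lemma uhS_1 : uhS 1 = 0.
Proof. by rewrite uhSE !rmorph1 aH1 subrr !scaler0 subrr. Qed.

Lemma braided1 p q : braided p q 1.
Proof. by rewrite /braided uhS_1 !rmorph1 !mulr1 !mul1r mul0r addr0. Qed.

Lemma braidedZ p q c a : braided p q a -> braided p q (c *: a).
Proof.
case=> qa pa; split; rewrite ?linearZ -scalerAr ?qa ?pa /= -?scalerAl //.
by rewrite scalerDr.
Qed.

Lemma braidedD p q a b : braided p q a -> braided p q b -> braided p q (a + b).
Proof.
case=> qa pa [qb pb]; split; rewrite ?linearD mulrDr ?qa ?qb ?pa ?pb !mulrDl //.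
by rewrite addrACA.
Qed.

Lemma braidedM p q a b : braided p q a -> braided p q b -> braided p q (a * b).
Proof.
case=> qa pa [qb pb]; split; rewrite mulrA ?qa ?pa ?uhS_M !rmorphM.
  by rewrite -!mulrA qb.
by rewrite !mulrDl -!mulrA qb pb mulrDr -addrA [_ * (_ * q) + _]addrC.
Qed.

Lemma braided_span p q (S : set A) : (forall a, S a -> braided p q a) ->
  forall a, alg_span S a -> braided p q a.
Proof.
move=> Sb a; elim=> {a} [a /Sb//||c a _|a b _ Ha _ Hb|a b _ Ha _ Hb].
- exact: braided1.
- exact: braidedZ.
- exact: braidedD.
- exact: braidedM.
Qed.

Lemma braided_comm p q v : braided p q v -> G v = v -> H v = 0 ->
  p * v = v * p /\ q * v = v * q.
Proof.
move=> [qv pv] Gv Hv; have G'v : G' v = v by rewrite -{1}Gv aGK.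
by rewrite qv pv uhSE Gv G'v Hv subrr !scaler0 subrr mul0r addr0.
Qed.

Lemma uhS_doublet p q : doublet p q -> uhS p = h ^+ 2 *: q - h *: p /\ uhS q = h *: q.
Proof.
case=> [[_ _ Hp] [[_ _ Hq] [Gp Gq G'p G'q]]]; rewrite !uhSE Gp Gq G'p G'q Hp Hq.
split; last by rewrite subrr scaler0 sub0r scalerN opprK.
rewrite opprB [X in _ *: X - _]addrC addrA subrK -mulr2n -scaler_nat !scalerA.
by rewrite divfK ?pnatr_eq0 // expr2.
Qed.

(** Spelled out on a second doublet, braiding becomes the relations of H_I. This equivalence links
    the presentation with the action. *)
Lemma braided_doublets p q p' q' : doublet p' q' ->
  braided p q p' /\ braided p q q' <->
  [/\ q * q' = q' * q, p * q' = q' * p + h *: (q' * q),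
      q * p' = p' * q - h *: (q' * q)
    & p * p' = p' * p + h *: (q' * p) - h *: (p' * q) + h ^+ 2 *: (q' * q)].
Proof.
move=> dp'; have [Sp Sq] := uhS_doublet dp'.
case: dp' => [[_ _ Hp] [[_ _ Hq] [Gp Gq G'p G'q]]].
rewrite /braided Gp Gq G'p G'q Sp Sq; split.
  move=> [[-> ->] [-> ->]]; split=> //; first by nc h.
  - by nc h.
  - by nc h.
move=> [-> -> -> ->]; split; split=> //; first by nc h.
- by nc h.
- by nc h.
Qed.

(** The four relations keep their shape when solved for the opposite products: the Jordanian
    R-matrix is triangular. *)
Lemma braided_sym p q p' q' : doublet p q -> doublet p' q' ->
  braided p q p' /\ braided p q q' -> braided p' q' p /\ braided p' q' q.
Proof.
move=> dp dp' /(braided_doublets p q dp')[qq pq qp pp].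
apply/(braided_doublets p' q' dp); split=> //.
- by rewrite qp qq; nc h.
- by rewrite pq qq; nc h.
- by rewrite pp qp pq qq; nc h.
Qed.
End Braiding.

Lemma braided_rels {K : numFieldType} {d : Order.disp_t} {h : K} {A : algType K}
    (s : uh_action h A) (I : orderType d) (X Y : I -> A) :
  (forall i, doublet s (X i) (Y i)) ->
  (forall i j, braided s (X i) (Y i) (X j) /\ braided s (X i) (Y i) (Y j)) ->
  forall u v, HI_rel h X Y u v -> u = v.
Proof.
move=> dX bX u v.
have rel i j := (proj1 (braided_doublets (X i) (Y i) (dX j))) (bX i j).
case=> [i|i j _|i j _|i j _|i j _].
- by have [_ -> _ _] := rel i i; rewrite expr2.
- by have [_ -> _ _] := rel j i.
- by have [_ _ -> _] := rel j i.
- by have [-> _ _ _] := rel j i.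
- have [_ _ _ ->] := rel j i.
  by nc h.
Qed.

Section Extends.
Context {K : fieldType} {h : K} {A B : algType K} (s : uh_action h A) (t : uh_action h B).

Lemma extends_span (g : {lrmorphism A -> B}) (S : set A) :
  (forall a, S a -> [/\ aE t (g a) = g (aE s a), aF t (g a) = g (aF s a),
    aH t (g a) = g (aH s a), aG t (g a) = g (aG s a)
    & aG' t (g a) = g (aG' s a)]) ->
  forall a, alg_span S a -> [/\ aE t (g a) = g (aE s a), aF t (g a) = g (aF s a),
    aH t (g a) = g (aH s a), aG t (g a) = g (aG s a)
    & aG' t (g a) = g (aG' s a)].
Proof.
move=> Sg a; elim=> {a} [a /Sg//||c a _ [e1 e2 e3 e4 e5]
  |a b _ [e1 e2 e3 e4 e5] _ [f1 f2 f3 f4 f5]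
  |a b _ [e1 e2 e3 e4 e5] _ [f1 f2 f3 f4 f5]].
- by rewrite !rmorph1 !aE1 !aF1 !aH1 !rmorph0.
- by rewrite !linearZ /= ?linearZ e1 e2 e3 e4 e5 /= ?linearZ.
- by rewrite !raddfD /= ?raddfD e1 e2 e3 e4 e5 f1 f2 f3 f4 f5 /= ?raddfD.
- rewrite !rmorphM !aEM !aFM !aHM /= !rmorphD !rmorphM /=.
  by rewrite e1 e2 e3 e4 e5 f1 f2 f3 f4 f5.
Qed.
End Extends.

Section Invariants.
Context {K : fieldType} {h : K} {A : algType K} {s : uh_action h A}.
Implicit Types v w : A.

Lemma invariant1 : uh_invariant s 1.
Proof. by split; rewrite ?aE1 ?aF1 ?aH1. Qed.

Lemma invariant0 : uh_invariant s 0.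
Proof. by split; rewrite raddf0. Qed.

Lemma invariantB v w : uh_invariant s v -> uh_invariant s w -> uh_invariant s (v - w).
Proof. by case=> e1 e2 e3 [f1 f2 f3]; split; rewrite raddfB /= ?e1 ?e2 ?e3 ?f1 ?f2 ?f3 subrr. Qed.

Lemma invariantD v w : uh_invariant s v -> uh_invariant s w -> uh_invariant s (v + w).
Proof. by case=> e1 e2 e3 [f1 f2 f3]; split; rewrite raddfD /= ?e1 ?e2 ?e3 ?f1 ?f2 ?f3 addr0. Qed.

Lemma invariantZ c v : uh_invariant s v -> uh_invariant s (c *: v).
Proof. by case=> e1 e2 e3; split; rewrite linearZ /= ?e1 ?e2 ?e3 scaler0. Qed.

Lemma invariantM v w : uh_invariant s v -> uh_invariant s w -> uh_invariant s (v * w).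
Proof.
case=> e1 e2 e3 [f1 f2 f3]; split; rewrite ?aEM ?aFM ?aHM ?e1 ?e2 ?e3 ?f1 ?f2 ?f3;
by rewrite mul0r mulr0 addr0.
Qed.
End Invariants.

(** * Invariant factors over a division ring *)

Section CommutativeSubfield.
Context {Q : unitRingType}.

(** A field sitting inside a noncommutative ring, given by a predicate; [csf] turns it into a
    [fieldType], so that divisibility and irreducibility of polynomials become available over it. *)
Record comm_subfield := CommSubfield {
  csf_set : Q -> Prop;
  csf1 : csf_set 1;
  csfB : forall a b, csf_set a -> csf_set b -> csf_set (a - b);
  csfM : forall a b, csf_set a -> csf_set b -> csf_set (a * b);
  csfV : forall a, csf_set a -> csf_set a^-1;
  csfC : forall a b, csf_set a -> csf_set b -> a * b = b * a;
  csf_div : forall a, csf_set a -> a != 0 -> a \is a GRing.unit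
}.

Variable S : comm_subfield.

Definition csf_pred : {pred Q} := [pred q | `[< csf_set S q >]].

Record csf := Csf { csf_val : Q; _ : csf_val \in csf_pred }.

HB.instance Definition _ := [isSub for csf_val].
HB.instance Definition _ := [Choice of csf by <:].

Fact csf_pred_subring : subring_closed csf_pred.
Proof.
split=> [|a b|a b]; rewrite !inE; first exact: csf1.
- exact: csfB.
- exact: csfM.
Qed.
HB.instance Definition _ := GRing.isSubringClosed.Build Q csf_pred csf_pred_subring.
HB.instance Definition _ := [SubChoice_isSubNzRing of csf by <:].

Lemma csfP (a : csf) : csf_set S (val a).
Proof. by case: a => a /= /asboolP. Qed.

Fact csf_mulC : commutative (@GRing.mul csf).
Proof. by move=> a b; apply/val_inj; apply: csfC (csfP a) (csfP b). Qed.
HB.instance Definition _ := GRing.PzRing_hasCommutativeMul.Build csf csf_mulC.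

Definition csf_inv (a : csf) : csf := @Csf (val a)^-1 (introT (asboolP _) (csfV (csfP a))).

Fact csf_mulVf (a : csf) : a != 0 -> csf_inv a * a = 1.
Proof.
move=> a0; apply/val_inj => /=; apply/mulVr/(csf_div (csfP a)).
by apply: contraNneq a0 => a0; apply/eqP/val_inj.
Qed.

Fact csf_inv0 : csf_inv 0 = 0.
Proof. by apply/val_inj; rewrite /= invr0. Qed.
HB.instance Definition _ := GRing.ComNzRing_isField.Build csf csf_mulVf csf_inv0.

Lemma csf_lift q : csf_set S q -> exists a : csf, val a = q.
Proof. by move=> Sq; exists (@Csf q (introT (asboolP _) Sq)). Qed.

Lemma csf_lift_poly (p : {poly Q}) : (forall i, csf_set S p`_i) ->
  exists2 f : {poly csf}, size f = size p & map_poly (val : csf -> Q) f = p.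
Proof.
move=> Sp; have [F FE] := choice (fun i => csf_lift (Sp i)).
exists (\poly_(i < size p) F i); last first.
  apply/polyP => i; rewrite coef_map_id0 // coef_poly; case: ltnP => [_|ip].
    exact: FE.
  by rewrite nth_default.
have [->|p0] := eqVneq p 0; first by rewrite size_poly0 poly_def big_ord0 size_poly0.
rewrite size_poly_eq //; apply: contra_neq p0 => F0; apply/eqP.
by rewrite -lead_coef_eq0 lead_coefE -FE F0.
Qed.
End CommutativeSubfield.
Arguments csf {Q} S.

Section IrreducibleFactor.
Context {F : fieldType}.

Lemma irreducible_monic_factor (p : {poly F}) : (1 < size p)%N ->
  exists g : {poly F}, [/\ irreducible_poly g, g \is monic & g %| p].
Proof.
elim: {p}(size p) {-2}p (leqnn (size p)) => [|n IH] p pn p1.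
  by move: (leq_trans p1 pn).
have [[q [q1 qp pq]]|irr] := pselect (exists q : {poly F}, [/\ size q != 1%N, q %| p & ~~ (q %= p)]).
  have p0 : p != 0 by rewrite -size_poly_gt0 ltnW.
  have q0 : q != 0 by apply: contraNneq p0 => q0; rewrite q0 dvd0p in qp *.
  have qs : (size q < size p)%N.
    by rewrite ltn_neqAle (dvdp_leq p0 qp) andbT (dvdp_size_eqp qp).
  have [] := IH q; first by rewrite -ltnS (leq_trans qs).
    by rewrite ltn_neqAle eq_sym q1 size_poly_gt0.
  by move=> g [gi gm gq]; exists g; split=> //; apply: dvdp_trans qp.
have p0 : p != 0 by rewrite -size_poly_gt0 ltnW.
have l0 : (lead_coef p)^-1 != 0 by rewrite invr_eq0 lead_coef_eq0.
exists ((lead_coef p)^-1 *: p); split.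
- split=> [|q q1]; first by rewrite size_scale.
  rewrite dvdpZr // => qp; rewrite eqp_sym (eqp_ltrans (eqp_scale _ l0)) eqp_sym.
  by apply: contraPT irr => pq irr; apply: irr; exists q.
- by rewrite monicE lead_coefZ mulVf // lead_coef_eq0.
- by rewrite dvdpZl.
Qed.
End IrreducibleFactor.

(* Applying a derivation T to a factorization c g with constant product gives
   g | c T(g), hence T(g) = 0 for degree reasons. *)
Lemma irreducible_factor_der (F : fieldType) (Q : nzRingType)
    (phi : {rmorphism F -> Q}) (T : {additive Q -> Q}) (g c : {poly F}) :
  irreducible_poly g -> g \is monic -> ~~ (g %| c) -> T 1 = 0 ->
  (forall i, exists a, phi a = T (phi g`_i)) ->
  (forall i, exists a, phi a = T (phi c`_i)) ->
  (forall i j, T (phi c`_i * phi g`_j) =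
     T (phi c`_i) * phi g`_j + phi c`_i * T (phi g`_j)) ->
  (forall k, T (phi (c * g)`_k) = 0) ->
  (forall i, T (phi g`_i) = 0) /\ (forall i, T (phi c`_i) = 0).
Proof.
move=> gi gm gc T1 /choice[dg dgE] /choice[dc dcE] TM Tcg.
pose Dg := \poly_(i < size g) dg i; pose Dc := \poly_(i < size c) dc i.
have DgE i : phi Dg`_i = T (phi g`_i).
  rewrite coef_poly; case: ltnP => // gi0.
  by rewrite nth_default // !rmorph0 raddf0.
have DcE i : phi Dc`_i = T (phi c`_i).
  rewrite coef_poly; case: ltnP => // gi0.
  by rewrite nth_default // !rmorph0 raddf0.
have eq0 : Dc * g + c * Dg = 0.
  apply/polyP => k; rewrite coef0; apply/eqP; rewrite -(fmorph_eq0 phi); apply/eqP.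
  rewrite coefD !coefM rmorphD !rmorph_sum -big_split /=.
  rewrite -[RHS](Tcg k) coefM !raddf_sum /=; apply: eq_bigr => j _.
  by rewrite !rmorphM /= TM DgE DcE.
have g_Dg : g %| Dg.
  rewrite -(Gauss_dvdpr _ (_ : coprimep g c)) ?irreducible_poly_coprime //.
  move/eqP: eq0; rewrite addrC addr_eq0 => /eqP ->.
  by rewrite dvdpNr dvdp_mull.
(* As [g] is monic, [T 1 = 0] kills its leading coefficient. *)
have sDg : (size Dg < size g)%N.
  have g0 : (0 < size g)%N by rewrite size_poly_gt0 irredp_neq0.
  rewrite -(prednK g0) ltnS; apply/leq_sizeP => j gj.
  have [ej|nj] := eqVneq j (size g).-1; last first.
    by rewrite coef_poly ltnNge -(prednK g0) ltn_neqAle eq_sym nj gj.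
  apply/eqP; rewrite -(fmorph_eq0 phi) DgE ej -lead_coefE (monicP gm).
  by rewrite rmorph1 T1.
have Dg0 : Dg = 0.
  by apply/eqP; apply: contraTT g_Dg => Dg0; apply/negP => /(dvdp_leq Dg0); rewrite leqNgt sDg.
have Dc0 : Dc = 0.
  move/eqP: eq0; rewrite Dg0 mulr0 addr0 mulf_eq0 => /orP[/eqP //|].
  by rewrite (negPf (irredp_neq0 gi)).
by split=> i; rewrite -(DgE, DcE) ?Dg0 ?Dc0 coef0 rmorph0.
Qed.

Section DivisionRing.
Context {Q : unitRingType} (Qdiv : division_ring Q).

Lemma dr_mulf_neq0 (a b : Q) : a != 0 -> b != 0 -> a * b != 0.
Proof.
move=> a0 b0; apply: contra_neq b0 => ab.
by apply: (mulrI (Qdiv a0)); rewrite ab mulr0.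
Qed.

Lemma dr_rmorph_neq0 (R : nzRingType) (f : {rmorphism Q -> R}) a :
  a != 0 -> f a != 0.
Proof.
move=> a0; apply: contra_neq (oner_neq0 R) => fa.
by rewrite -(rmorph1 f) -(divrr (Qdiv a0)) rmorphM fa mul0r.
Qed.

Lemma dr_size_mul (p q : {poly Q}) : p != 0 -> q != 0 ->
  size (p * q) = (size p + size q).-1.
Proof.
by move=> p0 q0; rewrite size_proper_mul // dr_mulf_neq0 // lead_coef_eq0.
Qed.

Lemma dr_poly_mulf_neq0 (p q : {poly Q}) : p != 0 -> q != 0 -> p * q != 0.
Proof.
move=> p0 q0; rewrite -size_poly_gt0 dr_size_mul //.
by move: p0 q0; rewrite -!size_poly_gt0; case: size => // m; case: size => // n; rewrite addnS.
Qed.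
End DivisionRing.

Section Good.
Context {K : numFieldType} {h : K}.

(* The properties of (Q_I, U_h-action) that survive the adjunction of central
   invariant elements. *)
Record good (Q : unitAlgType K) (s : uh_action h Q) : Prop := Good {
  good_div : division_ring Q;
  good_y : exists y, [/\ y != 0, forall q, y * q = aG' s q * y & aH s y = - y];
  good_central : forall v, aG s v = v -> aH s v = 0 -> forall q, v * q = q * v;
  good_frac : forall q, exists a b,
    [/\ gnil (aG s) a, gnil (aG s) b, b != 0 & q = a / b];
  good_comm : forall v w, aG s v = v -> aG s w = w -> v * w = w * v
}.

Context {Q : unitAlgType K} {s : uh_action h Q}.
Local Notation E := (aE s).
Local Notation F := (aF s).
Local Notation H := (aH s).
Local Notation G := (aG s).
Local Notation G' := (aG' s).
Implicit Types (a b q v w : Q) (p : {poly Q}).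

Lemma fixG' v : G v = v -> G' v = v.
Proof. by move=> Gv; rewrite -{1}Gv aGK. Qed.

Lemma fixGV v : v \is a GRing.unit -> G v = v -> G v^-1 = v^-1.
Proof. by move=> uv Gv; rewrite -[in RHS]Gv; apply: rmorphV. Qed.

(* If w = a/b with a, b in the unipotent part, then w multiplies the top
   difference c of b, which is G-fixed, into the unipotent part. *)
Lemma frac_top (U : Q -> Prop) w b :
  (forall a b, U a -> U b -> U (a - b)) -> (forall a, U a -> U (G a)) ->
  (forall a, U a -> U (- a)) ->
  G w = w \/ G w = - w -> U (w * b) -> forall n, U (w * iter n (gdiff G) b).
Proof.
move=> UB UG UN Gw Ub; elim=> [//|n]; rewrite iterS.
move: (iter n _ b) => c Uc; rewrite /gdiff mulrBr; apply: (UB _ _ _ Uc).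
have := UG _ Uc; rewrite rmorphM /=; case: Gw => -> //.
by rewrite mulNr => /UN; rewrite opprK.
Qed.

Lemma gnilG a : gnil G a -> gnil G (G a).
Proof.
by move=> na; rewrite -(subrK a (G a)); apply: gnilD => //; apply: (gnil_iter 1).
Qed.

Lemma gnilN a : gnil G a -> gnil G (- a).
Proof.
by move=> na; rewrite -mulN1r; apply: gnilM => //; apply: gnil_fix; rewrite rmorphN1.
Qed.

Lemma gnilB a b : gnil G a -> gnil G b -> gnil G (a - b).
Proof. by move=> na nb; apply/gnilD/gnilN. Qed.

(** The top difference [c] of the denominator puts [w * c] in the unipotent part, while [G] acts on
    it by -1. So [G - 1] acts by -2, which is nilpotent only on 0. *)
Lemma anti_fix0 : division_ring Q -> forall w a b,
  gnil G a -> gnil G b -> b != 0 -> w = a / b -> G w = - w -> w = 0.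
Proof.
move=> Qdiv w a b na nb b0 wE Gw.
have [n [c0 c1]] := gnil_top nb b0; set c := iter n _ b in c0.
have Gc : G c = c by apply: gdiff_fix.
have [] : gnil G (w * c).
  apply: (@frac_top (gnil G) w b gnilB gnilG gnilN); first by right.
  by rewrite wE divrK // Qdiv.
move=> k; have Gu : G (w * c) = - (w * c) by rewrite rmorphM /= Gw Gc mulNr.
have -> : iter k (gdiff G) (w * c) = (- 2) ^+ k *: (w * c).
  elim: k => [|k IH]; first by rewrite scale1r.
  have GZ x v : G (x *: v) = x *: G v by exact: linearZ.
  rewrite iterS IH /gdiff [X in X - _]GZ Gu.
  by rewrite scalerN -opprD -mulr2n -scaler_nat scalerA -scaleNr -mulNr exprS.
move/eqP; rewrite scaler_eq0 expf_eq0 oppr_eq0 pnatr_eq0 andbF /= => /eqP wc.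
by apply/eqP; apply: contraTT isT => w0; have /eqP := dr_mulf_neq0 Qdiv w0 c0.
Qed.

Hypothesis h_neq0 : h != 0.
Hypothesis Qg : good s.
Let Qdiv := good_div Qg.

Lemma inv_fixG v : uh_invariant s v -> G v = v.
Proof.
case=> Ev Fv Hv; have : G v = G' v.
  (* On [v] the relation for [H,F] reads sinh(hF) v = 0. *)
  have := aHF s v; rewrite Fv Hv !raddf0 addr0 => /esym/eqP.
  rewrite oppr_eq0 !scaler_eq0 mulf_eq0 invr_eq0 pnatr_eq0 invr_eq0 (negPf h_neq0) /=.
  by rewrite pnatr_eq0 subr_eq0 => /eqP.
move=> GG'; have GGv : G (G v) = v by rewrite GG' aG'K.
have [a [b [na nb b0 wE]]] := good_frac Qg (v - G v).
have := anti_fix0 Qdiv na nb b0 wE; rewrite raddfB /= GGv opprB => /(_ erefl)/eqP.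
by rewrite subr_eq0 eq_sym => /eqP.
Qed.

Lemma inv_central v : uh_invariant s v -> forall q, v * q = q * v.
Proof. by move=> iv; apply: (good_central Qg) (inv_fixG iv) _; case: iv. Qed.

Lemma invariantV v : uh_invariant s v -> uh_invariant s v^-1.
Proof.
have [->|v0] := eqVneq v 0; first by rewrite invr0.
move=> iv; have Gv := inv_fixG iv; have uv := Qdiv v0; case: iv => Ev Fv Hv.
split; apply: (mulrI uv); rewrite mulr0.
- by have := aEM s v v^-1; rewrite divrr // aE1 Ev mul0r add0r Gv.
- by have := aFM s v v^-1; rewrite divrr // aF1 Fv mul0r add0r.
- by have := aHM s v v^-1; rewrite divrr // aH1 Hv mul0r add0r Gv.
Qed.

Definition fix_subfield : comm_subfield (Q := Q).
Proof.
exists (fun v => G v = v) => [|a b Ga Gb|a b Ga Gb|a Ga|a b Ga Gb|a _].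
- exact: rmorph1.
- by rewrite raddfB /= Ga Gb.
- by rewrite rmorphM /= Ga Gb.
- have [->|/Qdiv ua] := eqVneq a 0; first by rewrite invr0 raddf0.
  exact: fixGV.
- exact: good_comm Qg _ _ Ga Gb.
- exact: Qdiv.
Defined.

Local Notation M1 := (csf fix_subfield).

Lemma comm_y_fix y : (forall q, y * q = G' q * y) -> y != 0 ->
  forall v, v * y = y * v -> G v = v.
Proof.
move=> yq y0 v vy; have : G' v = v by apply: (mulIr (Qdiv y0)); rewrite -yq vy.
by move=> G'v; rewrite -{1}G'v aG'K.
Qed.

(** Being fixed by [G] means commuting with [y]. Applying [H] to v y = y v, the two terms with H y =
    - y cancel, so [H v] commutes with [y] too. *)
Lemma fixH v : G v = v -> G (H v) = H v.
Proof.
move=> Gv; have [y [y0 yq Hy]] := good_y Qg.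
have G'y : G' y = y by apply: (mulIr (Qdiv y0)); rewrite -yq.
have Gy : G y = y by rewrite -{1}G'y aG'K.
have vy : v * y = y * v by apply: good_comm Qg _ _ Gv Gy.
apply: (comm_y_fix yq y0); have := congr1 H vy.
rewrite !aHM Gy G'y Gv (fixG' Gv) Hy mulrN mulNr vy.
by rewrite [in RHS]addrC => /addIr.
Qed.

(** The same argument as for [H], but [E y] and [F y] are not multiples of [y]; the terms containing
    them cancel because [v] is central. *)
Lemma centralEF v : (forall q, v * q = q * v) -> G v = v ->
  G (E v) = E v /\ G (F v) = F v.
Proof.
move=> vc Gv; have [y [y0 yq Hy]] := good_y Qg.
have G'y : G' y = y by apply: (mulIr (Qdiv y0)); rewrite -yq.
have Gy : G y = y by rewrite -{1}G'y aG'K.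
split; apply: (comm_y_fix yq y0).
- have := congr1 E (vc y); rewrite !aEM Gy G'y Gv (fixG' Gv) (vc (E y)).
  by rewrite [in RHS]addrC => /addIr.
- have := congr1 F (vc y); rewrite !aFM (vc (F y)).
  by rewrite [in RHS]addrC => /addIr.
Qed.

Definition invp (p : {poly Q}) := forall i, uh_invariant s p`_i.
Definition fixp (p : {poly Q}) := forall i, G p`_i = p`_i.

Local Notation lift f := (map_poly (val : M1 -> Q) f).

(** To differentiate m = c g with profit, [g] must divide [m] only once. Hence [m] is taken of least
    size among the nonzero invariant multiples of [g]: if g^2 divided it, its derivative would be a
    smaller such multiple, nonzero in characteristic 0. *)
Lemma invariant_factor (p : {poly Q}) (g : {poly M1}) :
  invp p -> p != 0 -> irreducible_poly g -> g \is monic ->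
  (exists2 r : {poly M1}, True & p = lift (r * g)) -> invp (lift g).
Proof.
move=> ip p0 gi gm [r _ pE].
pose P n := `[< exists m : {poly M1}, [/\ size m = n, m != 0, g %| m & invp (lift m)] >].
have exP : exists n, P n.
  exists (size (r * g)); apply/asboolP; exists (r * g); split=> //.
  - by apply: contra_neq p0 => rg; rewrite pE rg rmorph0.
  - exact: dvdp_mulIr.
  - by rewrite -pE.
case: (ex_minnP exP) => n /asboolP[m [<- m0 gm' im]] minm {n}.
have [c mE] := dvdpP _ _ gm'; have gc : ~~ (g %| c).
  apply/negP => /dvdpP[c' cE].
  have sm : (1 < size m)%N by apply: leq_trans (dvdp_leq m0 gm'); case: gi.
  have d0 : m^`() != 0.
    apply/eqP => /(congr1 (fun q : {poly M1} => q`_(size m).-2)).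
    rewrite coef_deriv coef0; case: (size m) sm (lead_coefE m) => [//|[//|k]] _ /= <-.
    move=> /(congr1 val); rewrite raddfMn /= -scaler_nat => /eqP.
    rewrite scaler_eq0 pnatr_eq0 /= => /eqP l0.
    by move: m0; rewrite -lead_coef_eq0; apply/negP/negPn/eqP/val_inj.
  have : (size m <= size m^`())%N.
    apply: minm; apply/asboolP; exists m^`(); split=> //.
      rewrite mE cE !derivM; apply/dvdpP.
      by exists ((c'^`() * g + c' * g^`()) + c' * g^`()); rewrite [RHS]mulrDl [c' * g * _]mulrAC.
    move=> i; rewrite coef_map coef_deriv raddfMn /= -scaler_nat.
    by apply: invariantZ; have := im i.+1; rewrite coef_map.
  by rewrite leqNgt lt_size_deriv.
have fixv (a : M1) : G (val a) = val a by exact: (csfP (S := fix_subfield) a).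
have liftQ q : G q = q -> exists a : M1, val a = q by move=> Gq; exact: (csf_lift (S := fix_subfield) Gq).
have Tm (T : Q -> Q) : (forall v, uh_invariant s v -> T v = 0) ->
    forall k, T (val (c * g)`_k) = 0.
  by move=> Tv k; apply: Tv; rewrite -mE; have := im k; rewrite coef_map.
have der (T : {additive Q -> Q}) := @irreducible_factor_der M1 Q val T g c gi gm gc.
(* [H] has to come before [E] and [F]: once it kills the coefficients of [g] and [c] they are
   central, and only then do [centralEF] and the next two derivations apply. *)
have [||||Hg Hc] := der H (aH1 s).
- by move=> i; apply: liftQ; apply: fixH (fixv _).
- by move=> i; apply: liftQ; apply: fixH (fixv _).
- by move=> i j; rewrite /= aHM !(fixG' (fixv _)) !fixv.
- by apply: (Tm H) => v [].
have gZ i : forall q, val g`_i * q = q * val g`_i := good_central Qg (fixv g`_i) (Hg i).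
have cZ i : forall q, val c`_i * q = q * val c`_i := good_central Qg (fixv c`_i) (Hc i).
have [||||Eg _] := der E (aE1 s).
- by move=> i; apply: liftQ; have [] := centralEF (gZ i) (fixv _).
- by move=> i; apply: liftQ; have [] := centralEF (cZ i) (fixv _).
- by move=> i j; rewrite /= aEM !(fixG' (fixv _)) !fixv.
- by apply: (Tm E) => v [].
have [||||Fg _] := der F (aF1 s).
- by move=> i; apply: liftQ; have [] := centralEF (gZ i) (fixv _).
- by move=> i; apply: liftQ; have [] := centralEF (cZ i) (fixv _).
- by move=> i j; rewrite /= aFM.
- by apply: (Tm F) => v [].
by move=> i; rewrite coef_map; split; [exact: Eg|exact: Fg|exact: Hg].
Qed.

(** Irreducibility is stated up to a fixed scalar [b], because the factorizations obtained later
    from top differences are factorizations of a scalar multiple of [m]. *)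
Lemma invariant_irreducible_factor p :
  p \is monic -> (1 < size p)%N -> invp p ->
  exists m r : {poly Q}, [/\ m \is monic, (1 < size m)%N, invp m, p = r * m
    & forall c g b, fixp c -> fixp g -> G b = b -> b != 0 -> c * g = m * b%:P ->
        size c = 1%N \/ size g = 1%N].
Proof.
move=> pm p1 ip.
have [f sf fE] : exists2 f : {poly M1}, size f = size p & lift f = p.
  by apply: csf_lift_poly => i; apply/inv_fixG/ip.
have [|g [gi gm /dvdpP[r fr]]] := @irreducible_monic_factor M1 f; first by rewrite sf.
have p0 : p != 0 by rewrite -size_poly_gt0 ltnW.
have inj : injective (val : M1 -> Q) by exact: val_inj.
have slift (q : {poly M1}) : size (lift q) = size q.
  by rewrite size_map_inj_poly.
exists (lift g), (lift r); split.
- exact: monic_map.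
- by rewrite slift; case: gi.
- apply: (invariant_factor ip p0 gi gm); exists r => //.
  by rewrite -fE fr.
- by rewrite -fE fr rmorphM.
move=> c q b fc fq Gb b0 cq.
have [c1 sc c1E] := csf_lift_poly (S := fix_subfield) fc.
have [q1 sq q1E] := csf_lift_poly (S := fix_subfield) fq.
have [b1 bE] := csf_lift (S := fix_subfield) Gb.
have b10 : b1 != 0 by apply: contraNneq b0 => b10; rewrite -bE b10.
have {}cq : c1 * q1 = g * b1%:P.
  apply: (map_inj_poly inj) => //.
  have -> : map_poly val (c1 * q1) = c * q by rewrite -c1E -q1E; apply: rmorphM.
  rewrite cq; have -> : b%:P = map_poly (val : M1 -> Q) b1%:P.
    by rewrite map_polyC; congr (_ %:P).
  by symmetry; apply: rmorphM.
have g0 := irredp_neq0 gi; have [g1 gi'] := gi.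
have q10 : q1 != 0.
  apply: contraTneq isT => q10; move/eqP: cq.
  by rewrite q10 mulr0 eq_sym mulf_eq0 (negPf g0) polyC_eq0 (negPf b10).
have gq : q1 %| g.
  by rewrite -(dvdpZr _ _ b10) -mul_polyC mulrC -cq dvdp_mulIr.
rewrite -sc -sq; have [|sq1] := eqVneq (size q1) 1%N; first by right.
have /eqp_size qg := gi' q1 sq1 gq; left.
have := congr1 (fun q : {poly M1} => size q) cq.
have c10 : c1 != 0.
  apply: contraTneq isT => c10; move/eqP: cq.
  by rewrite c10 mul0r eq_sym mulf_eq0 (negPf g0) polyC_eq0 (negPf b10).
rewrite size_mul // mulrC mul_polyC size_scale // -qg.
move: (q10); rewrite -size_poly_gt0; case: (size q1) => // k _.
by rewrite addnS /= -[in RHS]add1n => /addIn.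
Qed.
End Good.
Arguments invp {K h Q} s p.
Arguments fixp {K h Q} s p.

(** * Adjoining an invariant root *)

(** The left ideal generated by [a] and [m] is principal: an element of least size, made monic, is a
    right divisor of every member. Irreducibility of [m] leaves only the generator 1. *)
Lemma left_bezout (Q : unitRingType) (m a : {poly Q}) : division_ring Q ->
  m \is monic -> a != 0 -> (size a < size m)%N ->
  (forall c g, m = c * g -> size c = 1%N \/ size g = 1%N) ->
  exists u v, u * a + v * m = 1.
Proof.
move=> Qdiv mm a0 am irr.
pose P n := `[< exists u v, u * a + v * m != 0 /\ size (u * a + v * m)%R = n >].
have exP : exists n, P n.
  by exists (size a); apply/asboolP; exists 1, 0; rewrite mul1r mul0r addr0.
case: (ex_minnP exP) => n /asboolP[u [v [g0 <-]]] ming {n}.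
pose l := (lead_coef (u * a + v * m))^-1.
have lu : lead_coef (u * a + v * m) \is a GRing.unit.
  by apply: Qdiv; rewrite lead_coef_eq0.
pose g := l%:P * (u * a + v * m).
have gE : g = (l%:P * u) * a + (l%:P * v) * m by rewrite /g mulrDr !mulrA.
have l0 : l%:P != 0 by rewrite polyC_eq0 invr_neq0 // lead_coef_eq0.
have gs : size g = size (u * a + v * m).
  rewrite /g dr_size_mul // size_polyC.
  by rewrite -[l == 0]polyC_eq0 l0.
have gm : g \is monic.
  rewrite monicE /g lead_coef_proper_mul ?lead_coefC ?mulVr //.
  by rewrite oner_neq0.
have gdvd u' v' : exists q, u' * a + v' * m = q * g.
  set w := u' * a + v' * m; have e := Pdiv.RingMonic.rdivp_eq gm w.
  set q := Pdiv.Ring.rdivp w g in e; set r := Pdiv.Ring.rmodp w g in e.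
  exists q; suff r0 : r = 0 by rewrite {1}e r0 addr0.
  apply/eqP/negP => /negP r0.
  have : (size r < size g)%N by rewrite Pdiv.Ring.ltn_rmodp monic_neq0.
  rewrite gs ltnNge => /negP; apply; apply: ming; apply/asboolP.
  exists (u' - q * (l%:P * u)), (v' - q * (l%:P * v)).
  suff -> : (u' - q * (l%:P * u)) * a + (v' - q * (l%:P * v)) * m = r by [].
  by rewrite !mulrBl addrACA -opprD -!(mulrA q) -mulrDr -gE -/w e addrAC subrr add0r.
have [q] := gdvd 0 1; rewrite mul0r mul1r add0r => mq.
have [q'] := gdvd 1 0; rewrite mul0r mul1r addr0 => aq.
suff g1 : size g = 1%N.
  exists (l%:P * u), (l%:P * v); rewrite -gE.
  by rewrite (size1_polyC (eq_leq g1)) in gm *; move: gm; rewrite monicE lead_coefC => /eqP ->.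
(* If [q] were constant, [g] would have the size of [m], although it divides the smaller [a]. *)
have [q1|//] := irr _ _ mq.
have q'0 : q' != 0 by apply: contra_neq a0 => q'0; rewrite aq q'0 mul0r.
have q0 : q != 0 by apply: contra_neq (monic_neq0 mm) => q0; rewrite mq q0 mul0r.
have g00 := monic_neq0 gm; move: am; rewrite aq mq !dr_size_mul // q1 add1n /=.
by rewrite -size_poly_gt0 in q'0; rewrite -(prednK q'0) addSn /= ltnNge leq_addl.
Qed.

Section GoodFactor.
Context {K : numFieldType} {h : K} {Q : unitAlgType K} {s : uh_action h Q}.
Local Notation G := (aG s).
Hypothesis Qg : good s.
Let Qdiv := good_div Qg.
Implicit Types (p c g m : {poly Q}).

(** The Ore condition comes from writing [b^-1 * c] as a right fraction [u / v]: then b u = c v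
    clears the earlier denominator [b] and the new one [c] at once. *)
Lemma common_denominator (qs : seq Q) : exists b,
  [/\ gnil G b, b != 0 & forall q, q \in qs -> gnil G (q * b)].
Proof.
elim: qs => [|q qs [b [nb b0 IH]]].
  exists 1; split=> //; [apply: gnil_fix; exact: rmorph1|exact: oner_neq0].
have [a [c [na nc c0 qE]]] := good_frac Qg q.
have [u [v [nu nv v0 bc]]] := good_frac Qg (b^-1 * c).
have buv : c * v = b * u.
  by rewrite -[c](mulVKr (Qdiv b0)) bc -mulrA divrK // Qdiv.
exists (b * u); split; first exact: gnilM.
  by rewrite -buv dr_mulf_neq0.
move=> q'; rewrite inE => /orP[/eqP ->|/IH nq']; last by rewrite mulrA; apply: gnilM.
by rewrite -buv mulrA qE divrK ?Qdiv //; apply: gnilM.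
Qed.

Lemma common_denominator_poly p : exists b,
  [/\ gnil G b, b != 0 & forall i, gnil G (p`_i * b)].
Proof.
have [b [nb b0 pb]] := common_denominator p; exists b; split=> // i.
have [ip|pi] := ltnP i (size p); first by apply/pb/mem_nth.
by rewrite nth_default // mul0r; apply: gnil_fix; rewrite raddf0.
Qed.

Let Gp : {rmorphism {poly Q} -> {poly Q}} := map_poly G.

Lemma coef_iter_gdiff n p i :
  (iter n (gdiff Gp) p)`_i = iter n (gdiff G) p`_i.
Proof.
by elim: n p => // n IH p; rewrite !iterSr IH /gdiff coefB coef_map.
Qed.

Lemma gnil_poly p : (forall i, gnil G p`_i) -> gnil Gp p.
Proof.
move=> /choice[N NE]; exists (\max_(i < size p) N i)%N; apply/polyP => i.
rewrite coef_iter_gdiff coef0; have [ip|pi] := ltnP i (size p); last first.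
  by rewrite nth_default // iter_gdiff0.
by apply: iter_gdiff_ge (NE i); apply: (leq_bigmax (Ordinal ip)).
Qed.

Lemma fixp_gdiff p : gdiff Gp p = 0 -> fixp s p.
Proof.
by move=> /gdiff_fix pE i; rewrite -[in RHS]pE coef_map.
Qed.

Lemma size_iter_gdiff n p : (size (iter n (gdiff Gp) p) <= size p)%N.
Proof.
by apply/leq_sizeP => i ip; rewrite coef_iter_gdiff nth_default // iter_gdiff0.
Qed.

Lemma iter_gdiff_fixpM n m (b : Q) : fixp s m ->
  iter n (gdiff Gp) (m * b%:P) = m * (iter n (gdiff G) b)%:P.
Proof.
move=> fm; elim: n => // n IH; rewrite !iterS IH /gdiff rmorphM /=.
rewrite map_polyC polyCB mulrBr; congr (_ * _ - _).
by apply/polyP => i; rewrite coef_map; apply: fm.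
Qed.

(* After clearing denominators, the top differences of a factorization of m
   over Q form a factorization of m over the field of G-fixed elements. *)
Lemma irreducible_over_Q m : fixp s m -> m != 0 ->
  (forall c g b, fixp s c -> fixp s g -> G b = b -> b != 0 ->
     c * g = m * b%:P -> size c = 1%N \/ size g = 1%N) ->
  forall c g, m = c * g -> size c = 1%N \/ size g = 1%N.
Proof.
move=> fm m0 irr c g mE.
have c0 : c != 0 by apply: contra_neq m0 => c0; rewrite mE c0 mul0r.
have g0 : g != 0 by apply: contra_neq m0 => g0; rewrite mE g0 mulr0.
have [b [nb b0 gb]] := common_denominator_poly g.
have [e [ne e0 ce]] := common_denominator_poly c.
(* The denominator [e] of [c] stands between the two factors and is compensated by [e^-1] in [g1],
   whose own denominators [r] then clears. In total [m] is multiplied by [b * r]. *)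
pose c1 := c * e%:P; pose g1 := (e^-1)%:P * (g * b%:P).
have [r [nr r0 gr]] := common_denominator_poly g1.
have polyC0 (z : Q) : z != 0 -> z%:P != 0 by rewrite polyC_eq0.
have nc1 : gnil Gp c1 by apply: gnil_poly => i; rewrite coefMC.
pose g2 := g1 * r%:P.
have ng2 : gnil Gp g2 by apply: gnil_poly => i; rewrite coefMC.
have br0 : b * r != 0 by rewrite dr_mulf_neq0.
have cg : c1 * g2 = m * (b * r)%:P.
  rewrite /c1 /g2 /g1 !mulrA -(mulrA c) -polyCM divrr ?Qdiv // mulr1 -mE.
  by rewrite -(mulrA m) -polyCM.
have e10 : e^-1 != 0 by apply: invr_neq0.
have c10 : c1 != 0 by rewrite dr_poly_mulf_neq0 // polyC0.
have g20 : g2 != 0 by rewrite !dr_poly_mulf_neq0 ?polyC0.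
have sc1 : size c1 = size c by rewrite dr_size_mul ?polyC0 // size_polyC e0 addn1.
have sg2 : size g2 = size g.
  rewrite dr_size_mul ?polyC0 ?dr_poly_mulf_neq0 ?polyC0 //.
  rewrite dr_size_mul ?polyC0 ?dr_poly_mulf_neq0 ?polyC0 //.
  by rewrite dr_size_mul ?polyC0 // !size_polyC e10 b0 r0 !addn1.
have [k [ck ck1]] := gnil_top nc1 c10; have [l [gl gl1]] := gnil_top ng2 g20.
have := iter_gdiffM ck1 gl1; rewrite cg iter_gdiff_fixpM //.
set t := iter _ (gdiff G) _ => tE.
have ft : gdiff G t = 0.
  have := iter_gdiffM0 ck1 gl1; rewrite cg iter_gdiff_fixpM // iterS -/t.
  move/eqP; apply: contraTeq => t0.
  by rewrite dr_poly_mulf_neq0 ?polyC0.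
set c2 := iter k _ _ in ck tE; set g3 := iter l _ _ in gl tE.
have bin0 : ('C(k + l, k)%:R : K) != 0.
  by rewrite pnatr_eq0 -lt0n bin_gt0 leq_addr.
(* The binomial coefficient from [iter_gdiffM], nonzero in characteristic 0, is absorbed into the
   left factor. *)
pose z : Q := 'C(k + l, k)%:R.
have z0 : z != 0.
  by rewrite /z -(scaler_nat _ (1 : Q)) scaler_eq0 negb_or bin0 oner_neq0.
have fz : G z = z by rewrite /z rmorph_nat.
have tE2 : (z%:P * c2) * g3 = m * t%:P.
  by rewrite tE -mulr_natl -mulrA polyC_natr.
have t0 : t != 0.
  apply: contraTneq isT => t0; move: tE2; rewrite t0 mulr0 => /eqP.
  by rewrite (negPf (dr_poly_mulf_neq0 Qdiv _ _)) // dr_poly_mulf_neq0 ?polyC0.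
have fzc : fixp s (z%:P * c2).
  move=> i; rewrite coefCM rmorphM /= fz; congr (_ * _).
  exact: (fixp_gdiff ck1).
have fg3 : fixp s g3 by exact: (fixp_gdiff gl1).
have := irr _ _ t fzc fg3 (gdiff_fix ft) t0 tE2.
have sz : size (z%:P * c2) = size c2 by rewrite dr_size_mul ?polyC0 // size_polyC z0.
have sm : size m = (size c + size g).-1 by rewrite mE dr_size_mul.
have st : (size c2 + size g3).-1 = size m.
  have := congr1 (fun p : {poly Q} => size p) tE2; rewrite /=.
  rewrite dr_size_mul ?dr_poly_mulf_neq0 ?polyC0 // sz => ->.
  by rewrite dr_size_mul ?polyC0 // size_polyC t0 addn1.
rewrite sz; move: st; rewrite sm.
(* Differences cannot increase sizes, and the sizes of the two top differences add up as those of
   [c] and [g] do; hence neither size has dropped. *)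
have := size_iter_gdiff k c1; have := size_iter_gdiff l g2.
rewrite -/c2 -/g3 sc1 sg2.
move: c0 g0 ck gl; rewrite -!size_poly_gt0.
case: (size c) => // nc; case: (size g) => // ng; case: (size c2) => // nc2.
case: (size g3) => // ng3 _ _ _ _; rewrite !addnS !ltnS !addSn /= => l1 l2 e12.
have e3 : nc2 = nc.
  apply/eqP; rewrite eqn_leq l2 -(leq_add2r ng3).
  by case: e12 => ->; rewrite leq_add2l.
have e4 : ng3 = ng by move: e12; rewrite e3 => -[] /addnI.
by rewrite e3 e4.
Qed.
End GoodFactor.

Section Commutant.
Context {K : fieldType} {Q : unitAlgType K} {n : nat} (Th : 'M[Q]_n.+1).

(** For a companion matrix this models Q[X]/(m). As a ring of matrices it inherits its ring laws,
    and an operator on [Q] acts on it entrywise. *)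
Definition cmt_pred : {pred 'M[Q]_n.+1} := [pred A | A * Th == Th * A].

Record cmt := Cmt { cmt_val : 'M[Q]_n.+1; _ : cmt_val \in cmt_pred }.

HB.instance Definition _ := [isSub for cmt_val].
HB.instance Definition _ := [Choice of cmt by <:].

Fact cmt_pred_subring : subring_closed cmt_pred.
Proof.
split=> [|A B|A B]; rewrite !inE; first by rewrite mul1r mulr1.
- by move=> /eqP AT /eqP BT; rewrite mulrBl mulrBr AT BT.
- by move=> /eqP AT /eqP BT; rewrite -mulrA BT mulrA AT mulrA.
Qed.
HB.instance Definition _ :=
  GRing.isSubringClosed.Build _ cmt_pred cmt_pred_subring.
HB.instance Definition _ := [SubChoice_isSubNzRing of cmt by <:].

Lemma cmtP (A : cmt) : val A * Th = Th * val A.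
Proof. by case: A => A /= /eqP. Qed.

Lemma mx_scale_mulr (c : K) (A B : 'M[Q]_n.+1) :
  map_mx ( *:%R c) (A * B) = A * map_mx ( *:%R c) B.
Proof.
apply/matrixP => i j; rewrite !mxE scaler_sumr; apply: eq_bigr => k _.
by rewrite mxE scalerAr.
Qed.

Lemma mx_scale_mull (c : K) (A B : 'M[Q]_n.+1) :
  map_mx ( *:%R c) (A * B) = map_mx ( *:%R c) A * B.
Proof.
apply/matrixP => i j; rewrite !mxE scaler_sumr; apply: eq_bigr => k _.
by rewrite mxE scalerAl.
Qed.

Fact cmt_scale_subproof (c : K) (A : cmt) : map_mx ( *:%R c) (val A) \in cmt_pred.
Proof. by rewrite inE -mx_scale_mull cmtP mx_scale_mulr. Qed.

Definition cmt_scale (c : K) (A : cmt) : cmt := Cmt (cmt_scale_subproof c A).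

Fact cmt_scaleA a b v : cmt_scale a (cmt_scale b v) = cmt_scale (a * b) v.
Proof. by apply/val_inj/matrixP => i j; rewrite !mxE scalerA. Qed.
Fact cmt_scale1 : left_id 1 cmt_scale.
Proof. by move=> A; apply/val_inj/matrixP => i j; rewrite !mxE scale1r. Qed.
Fact cmt_scaleDr : right_distributive cmt_scale +%R.
Proof. by move=> c A B; apply/val_inj/matrixP => i j; rewrite !mxE scalerDr. Qed.
Fact cmt_scaleDl v : {morph cmt_scale^~ v : a b / a + b}.
Proof. by move=> a b; apply/val_inj/matrixP => i j; rewrite !mxE scalerDl. Qed.
HB.instance Definition _ := GRing.Zmodule_isLmodule.Build K cmt
  cmt_scaleA cmt_scale1 cmt_scaleDr cmt_scaleDl.

Fact cmt_scaleAl (c : K) (A B : cmt) : c *: (A * B) = c *: A * B.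
Proof. by apply/val_inj; apply: mx_scale_mull. Qed.
HB.instance Definition _ := GRing.Lmodule_isLalgebra.Build K cmt cmt_scaleAl.

Fact cmt_scaleAr (c : K) (A B : cmt) : c *: (A * B) = A * (c *: B).
Proof. by apply/val_inj; apply: mx_scale_mulr. Qed.
HB.instance Definition _ := GRing.Lalgebra_isAlgebra.Build K cmt cmt_scaleAr.

Definition cmt_unit : pred cmt := fun A => `[< exists B, B * A = 1 /\ A * B = 1 >].
(** The default [A] of [xget] makes the inverse the identity on non-units, as the axioms of a
    [unitRingType] demand. *)
Definition cmt_inv (A : cmt) : cmt := xget A [set B | B * A = 1 /\ A * B = 1].

Fact cmt_invP A : A \in cmt_unit -> cmt_inv A * A = 1 /\ A * cmt_inv A = 1.
Proof. by case/asboolP => B BA; rewrite /cmt_inv; case: xgetP => // /(_ B). Qed.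
Fact cmt_mulVr : {in cmt_unit, left_inverse 1 cmt_inv *%R}.
Proof. by move=> A /cmt_invP[]. Qed.
Fact cmt_mulrV : {in cmt_unit, right_inverse 1 cmt_inv *%R}.
Proof. by move=> A /cmt_invP[]. Qed.
Fact cmt_unitP A B : B * A = 1 /\ A * B = 1 -> cmt_unit A.
Proof. by move=> AB; apply/asboolP; exists B. Qed.
Fact cmt_inv_out : {in [predC cmt_unit], cmt_inv =1 id}.
Proof.
move=> A; rewrite inE /= => uA; rewrite /cmt_inv; case: xgetP => // B _ AB.
by case/negP: uA; apply: cmt_unitP AB.
Qed.
HB.instance Definition _ := GRing.NzRing_hasMulInverse.Build cmt
  cmt_mulVr cmt_mulrV cmt_unitP cmt_inv_out.

Section Map.
Variables (T : {linear Q -> Q}).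
Hypothesis TTh : forall A, A * Th = Th * A -> map_mx T A * Th = Th * map_mx T A.

Fact cmt_map_subproof (A : cmt) : map_mx T (val A) \in cmt_pred.
Proof. by rewrite inE TTh // cmtP. Qed.
Definition cmt_map (A : cmt) : cmt := Cmt (cmt_map_subproof A).

Fact cmt_map_linear : linear cmt_map.
Proof. by move=> c A B; apply/val_inj/matrixP => i j; rewrite !mxE linearP. Qed.
HB.instance Definition _ := GRing.isLinear.Build K cmt cmt *:%R cmt_map cmt_map_linear.
End Map.

Section MapMorph.
Variables (T : {lrmorphism Q -> Q}).
Hypothesis TTh : forall A, A * Th = Th * A -> map_mx T A * Th = Th * map_mx T A.

Definition cmt_mapm : cmt -> cmt := cmt_map TTh.
HB.instance Definition _ := GRing.Linear.on cmt_mapm.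
Fact cmt_mapm_monoid : monoid_morphism cmt_mapm.
Proof.
split=> [|A B]; apply/val_inj; first by rewrite /= map_mx1.
by rewrite /= map_mxM.
Qed.
HB.instance Definition _ := GRing.isMonoidMorphism.Build cmt cmt cmt_mapm cmt_mapm_monoid.
End MapMorph.

Section Embedding.
Hypothesis Th_central : forall i j q, Th i j * q = q * Th i j.

Lemma scalar_mx_comm_central (A : 'M[Q]_n.+1) q : (forall i j, A i j * q = q * A i j) ->
  q%:M * A = A * q%:M.
Proof.
move=> Aq; rewrite -[_ * A]/(q%:M *m A) -[A * _]/(A *m q%:M) mul_scalar_mx.
apply/matrixP => i j; rewrite !mxE (bigD1 j) //= big1 ?addr0 => [|k kj].
  by rewrite mxE eqxx mulr1n Aq.
by rewrite mxE (negPf kj) mulr0n mulr0.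
Qed.

Fact cmt_const_subproof (q : Q) : q%:M \in cmt_pred.
Proof. by rewrite inE scalar_mx_comm_central. Qed.
Definition cmt_const (q : Q) : cmt := Cmt (cmt_const_subproof q).

Fact cmt_const_linear : linear cmt_const.
Proof.
move=> c a b; apply/val_inj/matrixP => i j; rewrite !mxE.
by case: eqP; rewrite ?mulr1n ?mulr0n ?scaler0 ?addr0.
Qed.
HB.instance Definition _ := GRing.isLinear.Build K Q cmt *:%R cmt_const cmt_const_linear.
Fact cmt_const_monoid : monoid_morphism cmt_const.
Proof.
by split=> [|a b]; apply/val_inj => //=; rewrite scalar_mxM.
Qed.
HB.instance Definition _ := GRing.isMonoidMorphism.Build Q cmt cmt_const cmt_const_monoid.
End Embedding.

Definition cmt_gen : cmt := @Cmt Th (introT eqP (erefl (Th * Th))).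
End Commutant.

Section CommutantAction.
Context {K : fieldType} {h : K} {Q : unitAlgType K} (s : uh_action h Q).
Context {n : nat} (Th : 'M[Q]_n.+1).
Local Notation E := (aE s).
Local Notation F := (aF s).
Local Notation H := (aH s).
Local Notation G := (aG s).
Local Notation G' := (aG' s).
Hypothesis Th_inv : forall i j, uh_invariant s (Th i j).
Hypothesis Th_fix : forall i j, G (Th i j) = Th i j.

Lemma map_mx_twisted (T S R : {linear Q -> Q}) :
  (forall a b, T (a * b) = T a * R b + S a * T b) ->
  forall A B : 'M[Q]_n.+1,
  map_mx T (A * B) = map_mx T A * map_mx R B + map_mx S A * map_mx T B.
Proof.
move=> TM A B; apply/matrixP => i j.
rewrite !mxE raddf_sum -big_split /=; apply: eq_bigr => k _.
by rewrite !mxE TM.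
Qed.

Let G'Th : map_mx G' Th = Th.
Proof. by apply/matrixP => i j; rewrite mxE -{1}Th_fix aGK. Qed.
Let GTh : map_mx G Th = Th.
Proof. by apply/matrixP => i j; rewrite mxE Th_fix. Qed.

(** Apply [T] to A Th = Th A: the terms containing [T Th] vanish, and [R] and [S] leave [Th]
    unchanged. *)
Fact twisted_comm (T S R : {linear Q -> Q}) :
  (forall a b, T (a * b) = T a * R b + S a * T b) ->
  (forall i j, T (Th i j) = 0) -> map_mx R Th = Th -> map_mx S Th = Th ->
  forall A, A * Th = Th * A -> map_mx T A * Th = Th * map_mx T A.
Proof.
move=> TM T0 RTh STh A ATh; have := congr1 (map_mx T) ATh.
rewrite !(map_mx_twisted TM) RTh STh.
have -> : map_mx T Th = 0 by apply/matrixP => i j; rewrite !mxE T0.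
by rewrite mulr0 addr0 mul0r add0r.
Qed.

Fact E_comm : forall A, A * Th = Th * A -> map_mx E A * Th = Th * map_mx E A.
Proof. by apply: (twisted_comm (aEM s)) => // i j; case: (Th_inv i j). Qed.
Fact H_comm : forall A, A * Th = Th * A -> map_mx H A * Th = Th * map_mx H A.
Proof. by apply: (twisted_comm (aHM s)) => // i j; case: (Th_inv i j). Qed.
Fact F_comm : forall A, A * Th = Th * A -> map_mx F A * Th = Th * map_mx F A.
Proof.
by apply: (@twisted_comm F idfun idfun (aFM s)); rewrite ?map_mx_id // => i j;
  case: (Th_inv i j).
Qed.
Fact G_comm : forall A, A * Th = Th * A -> map_mx G A * Th = Th * map_mx G A.
Proof.
move=> A ATh; rewrite -{1 2}GTh -[LHS](map_mxM G) -[RHS](map_mxM G).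
by rewrite -[X in map_mx _ X = _]/(A * Th) ATh.
Qed.
Fact G'_comm : forall A, A * Th = Th * A -> map_mx G' A * Th = Th * map_mx G' A.
Proof.
move=> A ATh; rewrite -{1 2}G'Th -[LHS](map_mxM G') -[RHS](map_mxM G').
by rewrite -[X in map_mx _ X = _]/(A * Th) ATh.
Qed.

Local Notation D := (cmt Th).

Definition cmt_action : uh_action h D.
Proof.
exists (cmt_map E_comm) (cmt_map F_comm) (cmt_map H_comm) (cmt_mapm G_comm) (cmt_mapm G'_comm).
- by move=> A; apply/val_inj/matrixP => i j; rewrite !mxE /= ?mxE /= aGK.
- by move=> A; apply/val_inj/matrixP => i j; rewrite !mxE /= ?mxE /= aG'K.
- by apply/val_inj/matrixP => i j; rewrite !mxE; case: eqP; rewrite ?aE1 ?raddf0.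
- by apply/val_inj/matrixP => i j; rewrite !mxE; case: eqP; rewrite ?aF1 ?raddf0.
- by apply/val_inj/matrixP => i j; rewrite !mxE; case: eqP; rewrite ?aH1 ?raddf0.
- by move=> A B; apply/val_inj; apply: (map_mx_twisted (aEM s)).
- move=> A B; apply/val_inj.
  have := @map_mx_twisted F idfun idfun (aFM s) (val A) (val B).
  have mid (C : 'M[Q]_n.+1) : map_mx (idfun : {linear Q -> Q}) C = C by apply: map_mx_id.
  by rewrite !mid; apply.
- by move=> A B; apply/val_inj; apply: (map_mx_twisted (aHM s)).
- by move=> A; apply/val_inj/matrixP => i j; rewrite !mxE /= ?mxE /= aGF.
- by move=> A; apply/val_inj/matrixP => i j; rewrite !mxE /= ?mxE /= aHE.
- by move=> A; apply/val_inj/matrixP => i j; rewrite !mxE /= ?mxE /= aHF.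
- by move=> A; apply/val_inj/matrixP => i j; rewrite !mxE /= ?mxE /= aEF.
Defined.

Lemma cmt_actionE (A : D) i j :
  [/\ val (aE cmt_action A) i j = E (val A i j),
      val (aF cmt_action A) i j = F (val A i j),
      val (aH cmt_action A) i j = H (val A i j),
      val (aG cmt_action A) i j = G (val A i j)
    & val (aG' cmt_action A) i j = G' (val A i j)].
Proof. by split; rewrite mxE. Qed.

End CommutantAction.

Section Companion.
Context {Q : unitRingType} (m : {poly Q}) (n : nat).
Hypothesis m_monic : m \is monic.
Hypothesis m_size : size m = n.+2.

(** Each row but the last is the next basis vector, so the first row of [Th ^+ k] is the k-th basis
    vector for k <= n. The first row of a polynomial in [Th] therefore lists its coefficients. Here
    [m] has degree [n.+1], the size of the matrix. *)
Definition companion : 'M[Q]_n.+1 := \matrix_(i, j)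
  if i == ord_max then - m`_j else (j == i.+1 :> nat)%:R.
Local Notation Th := companion.

Lemma companion_exp k (j : 'I_n.+1) : (k <= n)%N ->
  (Th ^+ k) ord0 j = (j == k :> nat)%:R.
Proof.
elim: k j => [|k IH] j kn; first by rewrite expr0 mxE -val_eqE /= eq_sym.
rewrite exprSr mxE (bigD1 (Ordinal (ltnW kn : (k < n.+1)%N))) //= big1 ?addr0.
  rewrite IH ?(ltnW kn) //= eqxx mul1r mxE -val_eqE /=.
  by rewrite (ltn_eqF kn).
by move=> i; rewrite -val_eqE /= IH ?(ltnW kn) // => /negPf ->; rewrite mul0r.
Qed.

Lemma companion_exp_max (j : 'I_n.+1) : (Th ^+ n.+1) ord0 j = - m`_j.
Proof.
rewrite exprSr mxE (bigD1 ord_max) //= big1 ?addr0.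
  by rewrite companion_exp //= eqxx mul1r mxE eqxx.
move=> i; rewrite -val_eqE /= companion_exp // => /negPf ->; exact: mul0r.
Qed.

(* The powers of Th move the first row to every other row. *)
Lemma commutant_row0 (A : 'M[Q]_n.+1) : A * Th = Th * A ->
  (forall j, A ord0 j = 0) -> A = 0.
Proof.
move=> ATh A0; apply/matrixP => i j; rewrite [RHS]mxE.
have := congr1 (fun B : 'M[Q]_n.+1 => B ord0 j) (commrX i ATh).
rewrite !mxE big1 => [|k _]; last by rewrite A0 mul0r.
rewrite (bigD1 i) //= companion_exp ?leq_ord // eqxx mul1r big1 ?addr0 // => k.
by rewrite -val_eqE companion_exp ?leq_ord // => /negPf ->; rewrite mul0r.
Qed.
End Companion.

Section CompanionExtension.
Context {K : numFieldType} {h : K} {Q : unitAlgType K} {s : uh_action h Q}.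
Hypothesis h_neq0 : h != 0.
Hypothesis Qg : good s.
Let Qdiv := good_div Qg.
Context (m : {poly Q}) (n : nat).
Hypothesis m_monic : m \is monic.
Hypothesis m_size : size m = n.+2.
Hypothesis m_inv : invp s m.
Hypothesis m_irr : forall c g, m = c * g -> size c = 1%N \/ size g = 1%N.
Local Notation Th := (companion m n).
Local Notation D := (cmt Th).

Fact Th_inv i j : uh_invariant s (Th i j).
Proof.
rewrite mxE; case: eqP => _.
  by rewrite -scaleN1r; apply/invariantZ/m_inv.
by case: eqP => _; rewrite ?mulr1n ?mulr0n; [apply: invariant1|apply: invariant0].
Qed.

Fact Th_fix i j : aG s (Th i j) = Th i j.
Proof. exact: (inv_fixG h_neq0 Qg (Th_inv i j)). Qed.

Fact Th_central i j q : Th i j * q = q * Th i j.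
Proof. exact: (inv_central h_neq0 Qg (Th_inv i j)). Qed.

Definition ext_action : uh_action h D := cmt_action Th_inv Th_fix.
Definition ext_const : {lrmorphism Q -> D} := cmt_const Th_central.
Definition ext_root : D := cmt_gen Th.
Local Notation t := ext_action.
Local Notation c := ext_const.
Local Notation z := ext_root.

Lemma ext_comm : commr_rmorph c z.
Proof. move=> q; apply/val_inj; symmetry; apply: scalar_mx_comm_central => i j; exact: Th_central. Qed.

Definition ext_eval : {rmorphism {poly Q} -> D} := horner_morph ext_comm.

Lemma ext_evalE p : ext_eval p = (map_poly c p).[z].
Proof. by []. Qed.

Lemma ext_constE q i j : val (c q) i j = q *+ (i == j).
Proof. by rewrite mxE. Qed.

Lemma ext_const_mul q (A : D) i j : val (c q * A) i j = q * val A i j.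
Proof.
have -> : val (c q * A) = q%:M *m val A by [].
by rewrite mul_scalar_mx mxE.
Qed.

Lemma ext_mul_const q (A : D) i j : val (A * c q) i j = val A i j * q.
Proof.
have -> : val (A * c q) = val A *m q%:M by [].
rewrite mxE (bigD1 j) //= big1 ?addr0 => [|k kj]; first by rewrite mxE eqxx mulr1n.
by rewrite mxE (negPf kj) mulr0n mulr0.
Qed.

Lemma val_ext_eval (p : {poly Q}) j : val (ext_eval p) ord0 j =
  \sum_(i < size p) p`_i * (Th ^+ i) ord0 j.
Proof.
rewrite ext_evalE (@horner_coef_wide _ (size p)) ?size_poly //.
rewrite raddf_sum summxE; apply: eq_bigr => i _ /=.
rewrite coef_map ext_const_mul; congr (_ * _).
by have -> : val (z ^+ i) = Th ^+ i by exact: rmorphXn.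
Qed.

Lemma ext_row0 (A : D) : (forall j, val A ord0 j = 0) -> A = 0.
Proof. by move=> A0; apply/val_inj; apply: commutant_row0 (cmtP A) A0. Qed.

Lemma ext_eval_small (p : {poly Q}) : (size p <= n.+1)%N -> forall j : 'I_n.+1,
  val (ext_eval p) ord0 j = p`_j.
Proof.
move=> pn j; rewrite val_ext_eval.
have E (i : 'I_(size p)) : p`_i * (Th ^+ i) ord0 j = p`_i * (j == i :> nat)%:R.
  by rewrite companion_exp // -ltnS (leq_trans (ltn_ord i)).
under eq_bigr => i _ do rewrite E.
have [jp|pj] := ltnP j (size p).
  rewrite (bigD1 (Ordinal jp)) //= eqxx mulr1 big1 ?addr0 // => i.
  by rewrite -val_eqE /= eq_sym => /negPf ->; rewrite mulr0.
rewrite nth_default // big1 // => i _.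
by rewrite gtn_eqF ?mulr0 // (leq_trans (ltn_ord i)).
Qed.

Lemma ext_eval_m : ext_eval m = 0.
Proof.
apply: ext_row0 => j; rewrite val_ext_eval m_size big_ord_recr /=.
have mn1 : m`_n.+1 = 1 by have := monicP m_monic; rewrite lead_coefE m_size.
rewrite companion_exp_max mn1 mul1r.
rewrite (bigD1 j) //= companion_exp ?leq_ord // eqxx mulr1 big1 ?addr0 ?subrr // => i.
by rewrite -val_eqE /= eq_sym companion_exp ?leq_ord // => /negPf ->; rewrite mulr0.
Qed.

(** An element of the commutant is determined by its first row, and the polynomial in [z] with that
    row as coefficients has the same first row. So [D] is [Q[z]], with coefficients of degree at
    most [n]. *)
Lemma ext_eval_row (A : D) : ext_eval (\poly_(i < n.+1) val A ord0 (inord i)) = A.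
Proof.
apply/eqP; rewrite -subr_eq0; apply/eqP/ext_row0 => j.
rewrite raddfB !mxE ext_eval_small ?size_poly // coef_poly ltn_ord.
by rewrite inord_val subrr.
Qed.

Lemma ext_generated (A : D) :
  alg_span [set B | (exists q, B = c q) \/ B = z] A.
Proof.
rewrite -[A]ext_eval_row ext_evalE horner_coef; apply: alg_span_sum => i _.
apply: alg_spanM; last by apply: alg_spanX; apply: alg_span_gen; right.
by apply: alg_span_gen; left; rewrite coef_map; eexists.
Qed.

(** [B] is a polynomial in [z] whose coefficients are its first row, and [z] commutes with all of
    [D]; centrality and commutativity can thus be tested entry by entry. *)
Lemma ext_comm_row (A B : D) :
  (forall j, A * c (val B ord0 j) = c (val B ord0 j) * A) -> A * B = B * A.
Proof.
move=> AB; rewrite -[B]ext_eval_row ext_evalE horner_coef mulr_sumr mulr_suml.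
apply: eq_bigr => i _; rewrite coef_map coef_poly.
case: ifP => _; last by rewrite /= raddf0 !(mul0r, mulr0).
rewrite mulrA AB -!mulrA; congr (_ * _); apply: commrX.
by apply/val_inj; apply: (cmtP A).
Qed.

Lemma ext_division : division_ring D.
Proof.
have left_inv (A : D) : A != 0 -> exists B, B * A = 1.
  move=> A0; set a := \poly_(i < n.+1) val A ord0 (inord i).
  have aE : ext_eval a = A := ext_eval_row A.
  have a0 : a != 0 by apply: contra_neq A0 => a0; rewrite -aE a0 rmorph0.
  have [|u [v uv]] := left_bezout Qdiv m_monic a0 _ m_irr.
    by rewrite m_size ltnS size_poly.
  exists (ext_eval u); have := congr1 ext_eval uv.
  by rewrite rmorphD !rmorphM ext_eval_m mulr0 addr0 rmorph1 aE.
(* A left inverse of the left inverse must be [A] itself, so the inverse is two-sided. *)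
move=> A A0; have [B BA] := left_inv A A0.
have B0 : B != 0.
  by apply: contra_eq_neq BA => ->; rewrite mul0r eq_sym oner_neq0.
have [C CB] := left_inv B B0.
have AC : A = C by rewrite -[A]mul1r -CB -mulrA BA mulr1.
by apply/unitrP; exists B; split; rewrite // AC.
Qed.

Lemma ext_extends : extends_action c s t.
Proof.
move=> q; split; apply/val_inj/matrixP => i j;
have [e1 e2 e3 e4 e5] := cmt_actionE Th_inv Th_fix (c q) i j;
rewrite ?e1 ?e2 ?e3 ?e4 ?e5 !ext_constE;
by case: eqP => _; rewrite ?mulr1n ?mulr0n ?raddf0.
Qed.

Lemma ext_root_inv : uh_invariant t z.
Proof.
split; apply/val_inj/matrixP => i j;
have [e1 e2 e3 _ _] := cmt_actionE Th_inv Th_fix z i j;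
rewrite ?e1 ?e2 ?e3 [RHS]mxE; by case: (Th_inv i j).
Qed.

Lemma ext_gnil (A : D) : (forall i j, gnil (aG s) (val A i j)) -> gnil (aG t) A.
Proof.
have itE k (B : D) i j : val (iter k (gdiff (aG t)) B) i j =
    iter k (gdiff (aG s)) (val B i j).
  elim: k B => // k IH B; rewrite !iterSr IH; congr iter.
  by have [_ _ _ e _] := cmt_actionE Th_inv Th_fix B i j; rewrite /gdiff mxE e mxE.
move=> nA; have nA' (ij : 'I_n.+1 * 'I_n.+1) : gnil (aG s) (val A ij.1 ij.2) by [].
have [N NE] := choice nA'; exists (\max_ij N ij)%N; apply/val_inj/matrixP => i j.
rewrite itE [RHS]mxE; apply: iter_gdiff_ge (NE (i, j)).
exact: (leq_bigmax (i, j)).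
Qed.

(** Every property is checked on matrix entries. A common denominator of the entries of [A], viewed
    as a constant, is a denominator of [A], and the constant [y] still moves past matrices by
    [G']. *)
Lemma ext_good : good t.
Proof.
have fixE (A : D) : aG t A = A -> forall i j, aG s (val A i j) = val A i j.
  move=> GA i j; have [_ _ _ e _] := cmt_actionE Th_inv Th_fix A i j.
  by rewrite -e -/t GA.
split.
- exact: ext_division.
- have [y [y0 yq Hy]] := good_y Qg; exists (c y); split.
  + exact: dr_rmorph_neq0.
  + move=> A; apply/val_inj/matrixP => i j; rewrite ext_const_mul ext_mul_const.
    by have [_ _ _ _ ->] := cmt_actionE Th_inv Th_fix A i j.
  + by have [_ _ -> _ _] := ext_extends y; rewrite Hy raddfN.
- move=> A GA HA B; apply: ext_comm_row => j; apply/val_inj/matrixP => i k.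
  rewrite ext_mul_const ext_const_mul; apply: (good_central Qg (fixE _ GA i k)).
  by have [_ _ <- _ _] := cmt_actionE Th_inv Th_fix A i k; rewrite -/t HA mxE.
- move=> A.
  have [b [nb b0 Ab]] := common_denominator Qg [seq val A i j | i <- enum 'I_n.+1, j <- enum 'I_n.+1].
  have cb : c b \is a GRing.unit by apply: rmorph_unit; apply: Qdiv.
  exists (A * c b), (c b); split; last by rewrite mulrK.
  + apply: ext_gnil => i j; rewrite ext_mul_const; apply: Ab.
    by apply/allpairsP; exists (i, j); rewrite !mem_enum.
  + apply: ext_gnil => i j; rewrite ext_constE; case: eqP => _ //.
    by apply: gnil_fix; apply: raddf0.
  + by apply: contraTneq cb => ->; rewrite unitr0.
- move=> A B GA GB; apply: ext_comm_row => j; apply/val_inj/matrixP => i k.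
  by rewrite ext_mul_const ext_const_mul; apply: (good_comm Qg); apply: fixE.
Qed.
End CompanionExtension.

Lemma adjoin_invariant_root {K : numFieldType} {h : K} {Q : unitAlgType K}
    (s : uh_action h Q) (p : {poly Q}) :
  h != 0 -> good s -> p \is monic -> (1 < size p)%N -> invp s p ->
  exists (D : unitAlgType K) (t : uh_action h D) (c : {lrmorphism Q -> D}) (z : D),
  [/\ good t, extends_action c s t, uh_invariant t z,
      forall A, alg_span [set B | (exists q, B = c q) \/ B = z] A
    & (map_poly c p).[z] = 0].
Proof.
move=> h0 Qg pm p1 ip.
have [m [r [mm m1 im prm irr]]] := invariant_irreducible_factor h0 Qg pm p1 ip.
have fm : fixp s m by move=> i; apply: (inv_fixG h0 Qg).
have mirr := irreducible_over_Q Qg fm (monic_neq0 mm) irr.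
have [n ms] : exists n, size m = n.+2 by case: (size m) m1 => [//|[//|n]] _; exists n.
exists (cmt (companion m n)), (ext_action h0 Qg n im), (ext_const h0 Qg n im), (ext_root m n).
split.
- exact: ext_good.
- exact: ext_extends.
- exact: ext_root_inv.
- exact: ext_generated.
- rewrite -(ext_evalE h0 Qg n im) prm rmorphM.
  have -> : ext_eval h0 Qg n im m = 0 by apply: ext_eval_m.
  by rewrite mulr0.
Qed.

Section Extends.
Context {K : fieldType} {h : K} {A B : algType K} {s : uh_action h A} {t : uh_action h B}.

Lemma extends_invariant (g : {lrmorphism A -> B}) v :
  extends_action g s t -> uh_invariant s v -> uh_invariant t (g v).
Proof.
move=> gst [Ev Fv Hv]; have [gE gF gH _ _] := gst v.
by split; rewrite ?gE ?gF ?gH ?Ev ?Fv ?Hv raddf0.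
Qed.
End Extends.

(** * Splitting an invariant polynomial by successive extensions *)

Section Tower.
Context {K : numFieldType} {h : K}.
Hypothesis h_neq0 : h != 0.

(** The coefficients of the quotient are recovered from the top downwards: each is a coefficient of
    the product plus the next higher one times [z]. *)
Lemma invp_divX {Q : unitAlgType K} {s : uh_action h Q} (q : {poly Q}) z :
  good s -> uh_invariant s z -> invp s (q * ('X - z%:P)) -> invp s q.
Proof.
move=> Qg iz iq; suff P k j : (size q <= j + k)%N -> uh_invariant s q`_j.
  by move=> j; apply: (P (size q)); rewrite leq_addl.
elim: k j => [|k IH] j qj.
  by rewrite nth_default ?(leq_trans qj) ?addn0 //; apply: invariant0.
have -> : q`_j = (q * ('X - z%:P))`_j.+1 + q`_j.+1 * z.
  by rewrite mulrBr coefB coefMX coefMC subrK.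
by apply: invariantD (iq _) _; apply: invariantM => //; apply: IH; rewrite addSnnS.
Qed.

Lemma split_invariant_poly n (Q : unitAlgType K) (s : uh_action h Q) (p : {poly Q}) :
  good s -> p \is monic -> size p = n.+1 -> invp s p ->
  exists (D : unitAlgType K) (t : uh_action h D) (c : {lrmorphism Q -> D}) (r : seq D),
  [/\ good t, extends_action c s t, forall z, z \in r -> uh_invariant t z,
      forall A, alg_span [set B | (exists q, B = c q) \/ B \in r] A
    & size r = n /\ map_poly c p = \prod_(z <- r) ('X - z%:P)].
Proof.
elim: n Q s p => [|n IH] Q s p Qg pm sp ip.
  exists Q, s, (idfun : {lrmorphism Q -> Q}), [::]; split=> //.
  - by move=> A; apply: alg_span_gen; left; exists A.
  - split=> //; rewrite big_nil map_poly_id //.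
    by have := size1_polyC (eq_leq sp) => pE; move: pm; rewrite pE monicE lead_coefC => /eqP ->.
have [|D1 [t1 [c1 [z [D1g ext1 iz gen1 /eqP/factor_theorem[q qE]]]]]] :=
  adjoin_invariant_root h_neq0 Qg pm _ ip; first by rewrite sp.
have p1m : map_poly c1 p \is monic by apply: monic_map.
have D1div := good_div D1g.
have q0 : q != 0.
  by apply: contra_eq_neq qE => ->; rewrite mul0r monic_neq0.
have qm : q \is monic.
  by move: p1m; rewrite qE !monicE lead_coef_Mmonic ?monicXsubC.
have sq : size q = n.+1.
  have : size (map_poly c1 p) = n.+2.
    by rewrite size_map_poly_id0 // (monicP pm) rmorph1 oner_neq0.
  by rewrite qE dr_size_mul ?monic_neq0 ?monicXsubC // size_XsubC addn2 /= => -[].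
have iq : invp t1 q.
  apply: (invp_divX D1g iz); rewrite -qE => i; rewrite coef_map.
  exact: extends_invariant ext1 (ip i).
have [D [t [c [r [Dg ext ir gen [sr qr]]]]]] := IH D1 t1 q D1g qm sq iq.
exists D, t, (c \o c1 : {lrmorphism Q -> D}), (rcons r (c z)); split=> //.
- move=> v; have [e1 e2 e3 e4 e5] := ext (c1 v); have [f1 f2 f3 f4 f5] := ext1 v.
  by split; rewrite /= ?e1 ?e2 ?e3 ?e4 ?e5 ?f1 ?f2 ?f3 ?f4 ?f5.
- move=> v; rewrite mem_rcons inE => /orP[/eqP ->|]; last exact: ir.
  exact: extends_invariant ext iz.
- move=> A; apply: (alg_span_trans (gen A)) => B [[b ->{B}]|Br]; last first.
    by apply: alg_span_gen; right; rewrite mem_rcons inE Br orbT.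
  apply: (alg_span_image _ (gen1 b)) => B [[v ->{B}]| ->{B}]; apply: alg_span_gen.
    by left; exists v.
  by right; rewrite mem_rcons mem_head.
- split; first by rewrite size_rcons sr.
  rewrite big_rcons -qr -[RHS]/(map_poly c q * ('X - (c z)%:P)).
  rewrite map_poly_comp qE rmorphM; congr (_ * _).
  by rewrite rmorphB /= map_polyX map_polyC.
Qed.
End Tower.

(** Let p = q X + p_0 have least size among the nonzero polynomials over [k] that vanish at [z].
    Then p_0 is nonzero, as otherwise [q] would be smaller, and z^-1 = - p_0^-1 q(z) lies in the
    ring [P]. *)
Lemma integral_closed_inv (E : fieldType) (k : comm_subfield (Q := E)) (P : E -> Prop) :
  (forall a b, P a -> P b -> P (a - b)) -> (forall a b, P a -> P b -> P (a * b)) ->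
  (forall a, csf_set k a -> P a) ->
  forall z, P z -> integralOver (val : csf k -> E) z -> P z^-1.
Proof.
move=> PB PM kP z Pz [p0 p0m p0z].
have PD a b : P a -> P b -> P (a + b).
  move=> Pa Pb; rewrite -[b]opprK; apply: (PB) => //; rewrite -[- b]sub0r; apply: (PB) => //.
  by apply: (kP); rewrite -(subrr 1); apply: csfB; apply: csf1.
have P1 : P 1 by apply/kP/csf1.
have PX a i : P a -> P (a ^+ i).
  by move=> Pa; elim: i => // i IH; rewrite exprS; apply: (PM).
have [->|z0] := eqVneq z 0; first by rewrite invr0 -(subrr 1); apply: (PB).
pose F := csf k; pose R n := `[< exists p : {poly F}, [/\ size p = n, p != 0
  & root (map_poly (val : F -> E) p) z] >].
have exR : exists n, R n by exists (size p0); apply/asboolP; exists p0; rewrite monic_neq0.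
case: (ex_minnP exR) => n /asboolP[p [<- pn0 pz]] minp {n}.
pose q := \poly_(i < (size p).-1) p`_i.+1.
have pq : p = q * 'X + (p`_0)%:P.
  apply/polyP => -[|i]; rewrite coefD coefMX coefC /= ?add0r ?addr0 //.
  rewrite coef_poly; case: ltnP => // ip; rewrite nth_default //.
  by rewrite -(prednK (_ : 0 < size p)%N) ?size_poly_gt0 // ltnS.
pose w := (map_poly (val : F -> E) q).[z].
have zw : w * z = - val p`_0.
  have mE : map_poly (val : F -> E) p = map_poly val q * 'X + (val p`_0)%:P.
    apply/polyP => i; rewrite coef_map {1}pq !coefD !coefMX !coefC.
    case: i => [|i]; rewrite /= ?add0r ?addr0 //.
    exact: esym (coef_map (val : {rmorphism F -> E}) q i).
  move/eqP: pz; rewrite mE hornerD hornerMX hornerC.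
  by move/eqP; rewrite addr_eq0 => /eqP.
have p00 : p`_0 != 0.
  apply/eqP => p00; have q0 : q != 0.
    by apply: contra_neq pn0 => q0; rewrite pq q0 p00 mul0r addr0.
  have : (size p <= size q)%N.
    apply: minp; apply/asboolP; exists q; split=> //; apply/eqP.
    by move/eqP: zw; rewrite p00 oppr0 mulf_eq0 (negPf z0) orbF => /eqP.
  rewrite leqNgt pq p00 addr0 size_mulX // ltnSn.
  by [].
have -> : z^-1 = - (val p`_0)^-1 * w.
  have vp0 : val p`_0 != 0 by apply: contra_neq p00 => e; apply/val_inj.
  apply: (mulIf z0); rewrite mulVf // -mulrA zw mulrNN mulVf //.
have fP (a : F) : P (val a) by apply/kP/csfP.
apply: (PM); first by rewrite -sub0r; apply: (PB); [exact: (fP 0)|exact: (fP (p`_0)^-1)].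
rewrite /w horner_coef; elim/big_ind: _ => // [|i _]; first exact: (fP 0).
by rewrite coef_map; apply: (PM); [apply: fP|apply: PX].
Qed.

(** * The commutative splitting field inside the extension *)

Section SpanField.
Context {K : numFieldType} {h : K} {D : unitAlgType K} {t : uh_action h D}.
Hypothesis h_neq0 : h != 0.
Hypothesis Dg : good t.
Variables (k : D -> Prop) (r : seq D).
Hypothesis kA : forall c : K, k (c *: 1).
Hypothesis kB : forall a b, k a -> k b -> k (a - b).
Hypothesis kM : forall a b, k a -> k b -> k (a * b).
Hypothesis kV : forall a, k a -> k a^-1.
Hypothesis kI : forall a, k a -> uh_invariant t a.
Hypothesis rI : forall a, a \in r -> uh_invariant t a.
Hypothesis rk : forall a, a \in r -> exists p : {poly D},
  [/\ p \is monic, forall i, k p`_i & p.[a] = 0].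

Let S : set D := [set z | k z \/ z \in r].
Local Notation E := (csf (fix_subfield Dg)).

Lemma span_invariant a : alg_span S a -> uh_invariant t a.
Proof.
elim=> {a} [a [/kI|/rI] //||c a _ IH|a b _ IHa _ IHb|a b _ IHa _ IHb].
- exact: invariant1.
- exact: invariantZ.
- exact: invariantD.
- exact: invariantM.
Qed.

(** The base field is placed inside the commutative field [E] of [G]-fixed elements, where the
    theory of integral elements applies. *)
Definition base_subfield : comm_subfield (Q := E).
Proof.
exists (fun e : E => k (val e)).
- by have := kA 1; rewrite scale1r.
- by move=> a b; apply: kB.
- by move=> a b; apply: kM.
- by move=> a; apply: kV.
- by move=> a b _ _; apply: mulrC.
- by move=> a _; rewrite unitfE.
Defined.

Lemma span_integral a : alg_span S a ->
  exists2 e : E, val e = a & integralOver (val : csf base_subfield -> E) e.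
Proof.
have kE b : k b -> exists2 e : E, val e = b & integralOver (val : csf base_subfield -> E) e.
  move=> kb; have [e eb] := csf_lift (S := fix_subfield Dg) (inv_fixG h_neq0 Dg (kI kb)).
  exists e => //; have [e' <-] : exists e' : csf base_subfield, val e' = e.
    by apply: csf_lift; rewrite /= eb.
  exact: integral_id.
elim=> {a} [a [/kE //|ra]||c a _ [e <- ie]|a b _ [e <- ie] _ [f <- jf]|a b _ [e <- ie] _ [f <- jf]].
- have [p [pm kp pa]] := rk ra.
  have [e ea] := csf_lift (S := fix_subfield Dg) (inv_fixG h_neq0 Dg (rI ra)).
  exists e => //.
  have [pE spE pEE] := csf_lift_poly (S := fix_subfield Dg)
    (fun i => inv_fixG h_neq0 Dg (kI (kp i))).
  have pEi i : val pE`_i = p`_i by rewrite -pEE coef_map.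
  have [|pF spF pFE] := @csf_lift_poly _ base_subfield pE.
    by move=> i; rewrite /= pEi.
  exists pF.
    have pFi i : val pF`_i = pE`_i by rewrite -pFE coef_map.
    rewrite monicE lead_coefE spF; apply/eqP/val_inj/val_inj.
    by rewrite pFi pEi spE -lead_coefE (monicP pm).
  rewrite pFE; apply/eqP/val_inj; rewrite -[RHS]/(0 : D) -pa -pEE -ea.
  exact: esym (horner_map (val : {rmorphism E -> D}) pE e).
- have [e e1 ie] := kE _ (kA 1); exists e => //.
  by rewrite e1 scale1r.
- have [f fE jf] := kE _ (kA c); exists (f * e); last exact: integral_mul.
  by rewrite -[LHS]/(val f * val e) fE -scalerAl mul1r.
- by exists (e + f); [|apply: integral_add].
- by exists (e * f); [|apply: integral_mul].
Qed.

(** This will be the field Sigma. Its elements are invariant, hence central in [D], and integral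
    over [k], which gives closure under inverses. *)
Definition span_subfield : comm_subfield (Q := D).
Proof.
exists (alg_span S).
- exact: alg_span1.
- exact: alg_spanB.
- exact: alg_spanM.
- move=> a Sa; have [e ea ie] := span_integral Sa.
  rewrite -ea -[X in alg_span S X]/(val e^-1).
  apply: (@integral_closed_inv E base_subfield (fun e : E => alg_span S (val e))) => //.
  + by move=> u v; apply: alg_spanB.
  + by move=> u v; apply: alg_spanM.
  + by move=> u ku; apply: alg_span_gen; left.
  + by rewrite ea.
- by move=> a b /span_invariant ia _; apply: (inv_central h_neq0 Dg ia).
- by move=> a _; apply: (good_div Dg).
Defined.
End SpanField.

(** * Homogenization of a split polynomial *)

Section Homogenization.
Context {R : comNzRingType}.
Local Notation Y := ('X%:P : {poly {poly R}}).

Definition homogenize n (p : {poly R}) : {poly {poly R}} :=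
  \sum_(k < n.+1) (p`_k)%:P%:P * 'X ^+ k * Y ^+ (n - k).

Lemma homogenize_mul n (q : {poly R}) z : (size q <= n.+1)%N ->
  homogenize n.+1 (('X - z%:P) * q) = ('X - z%:P%:P * Y) * homogenize n q.
Proof.
move=> qn; rewrite /homogenize [RHS]mulrBl !mulr_sumr.
have -> : \sum_(k < n.+2) ((('X - z%:P) * q)`_k)%:P%:P * 'X ^+ k * Y ^+ (n.+1 - k) =
   \sum_(k < n.+2) (('X * q)`_k)%:P%:P * 'X ^+ k * Y ^+ (n.+1 - k)
   - \sum_(k < n.+2) (z * q`_k)%:P%:P * 'X ^+ k * Y ^+ (n.+1 - k).
  rewrite -sumrB; apply: eq_bigr => k _.
  by rewrite mulrBl coefB coefCM !polyCB !mulrBl.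
congr (_ - _).
  rewrite big_ord_recl coefXM /= !polyC0 !mul0r add0r; apply: eq_bigr => k _.
  by rewrite coefXM /= subSS exprS mulrCA !mulrA.
rewrite big_ord_recr /= (nth_default _ qn) mulr0 !polyC0 !mul0r addr0.
apply: eq_bigr => k _; rewrite subSn ?leq_ord // exprS !polyCM !mulrA.
by rewrite [X in _ = X * _ * _]mulrAC [X in _ = X * _]mulrAC.
Qed.

Lemma homogenize_prod (r : seq R) :
  homogenize (size r) (\prod_(z <- r) ('X - z%:P)) =
  \prod_(z <- r) ('X - z%:P%:P * Y).
Proof.
elim: r => [|z r IH].
  by rewrite !big_nil /homogenize big_ord1 coefC /= !expr0 !mulr1 !polyC1.
by rewrite !big_cons /= homogenize_mul ?IH // size_prod_XsubC.
Qed.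
End Homogenization.

(** * Invariants of the quotient division ring *)

Section DoubletDivisionRing.
Context {K : numFieldType} {h : K} {Q : unitAlgType K} (s : uh_action h Q).
Hypothesis h_neq0 : h != 0.
Hypothesis Qdiv : division_ring Q.
Context {I : Type} (X Y : I -> Q) (o : I).
Hypothesis dXY : forall i, doublet s (X i) (Y i).
Hypothesis bXY : forall i j,
  braided s (X i) (Y i) (X j) /\ braided s (X i) (Y i) (Y j).
Let gens : set Q := [set a | exists i, a = X i \/ a = Y i].
Hypothesis frac : forall q, exists a b,
  [/\ alg_span gens a, alg_span gens b, b != 0 & q = a / b].
Hypothesis Yo : Y o != 0.
Local Notation G := (aG s).
Local Notation G' := (aG' s).
Local Notation H := (aH s).
Let uYo := Qdiv Yo.

(** Expanding [uhS (b * b^-1) = 0] by the twisted Leibniz rule determines [uhS b^-1], which is the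
    value the relation solved for p b^-1 asks for. *)
Lemma braidedV p q b : b \is a GRing.unit -> braided s p q b -> braided s p q b^-1.
Proof.
move=> ub [qb pb]; have uG : G b \is a GRing.unit by apply: rmorph_unit.
have uG' : G' b \is a GRing.unit by apply: rmorph_unit.
have GV : G b^-1 = (G b)^-1 by apply: rmorphV.
have G'V : G' b^-1 = (G' b)^-1 by apply: rmorphV.
have qV : q / b = G' b^-1 * q.
  by apply: (mulrI uG'); rewrite G'V mulVKr // mulrA -qb mulrK.
split=> //; apply: (mulrI uG); rewrite mulrDr GV mulVKr // !mulrA.
have -> : G b * p = p * b - uhS s b * q by rewrite pb addrK.
rewrite mulrBl mulrK //; congr (_ + _).
have : uhS s (b * b^-1) = 0 by rewrite divrr // uhS_1.
rewrite uhS_M => /eqP; rewrite addrC addr_eq0 => /eqP ->.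
by rewrite mulNr -!mulrA qV.
Qed.

Lemma gens_braided i q : braided s (X i) (Y i) q.
Proof.
have bg a : alg_span gens a -> braided s (X i) (Y i) a.
  by apply: braided_span => {}a [j [->|->]]; have [] := bXY i j.
have [a [b [Aa Ab b0 ->]]] := frac q.
by apply: braidedM; [apply: bg|apply: braidedV; [apply: Qdiv|apply: bg]].
Qed.

Lemma gens_central v : G v = v -> H v = 0 -> forall q, v * q = q * v.
Proof.
move=> Gv Hv; have cg a : alg_span gens a -> a * v = v * a.
  apply: alg_span_comm => {}a [j aj].
  by have [] := braided_comm (gens_braided j v) Gv Hv; case: aj => ->.
move=> q; have [a [b [Aa Ab b0 ->]]] := frac q.
have vb : GRing.comm v b^-1 by apply: commrV; rewrite /GRing.comm cg.
by rewrite mulrA -cg // -mulrA vb mulrA.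
Qed.

Lemma gens_fixY i : G (Y i) = Y i.
Proof. by have [_ [_ []]] := dXY i. Qed.

Lemma gdiff_X i : gdiff G (X i) = h *: Y i.
Proof. by have [_ [_ [GX _ _ _]]] := dXY i; rewrite /gdiff /= GX addrC addKr. Qed.

Lemma alg_span_gnil (S : set Q) : (forall a, S a -> gnil G a) ->
  forall a, alg_span S a -> gnil G a.
Proof.
move=> Sn a; elim=> {a} [a /Sn//||c a _ IH|a b _ IHa _ IHb|a b _ IHa _ IHb].
- by apply: gnil_fix; apply: rmorph1.
- rewrite -[a]mul1r scalerAl; apply: gnilM => //; apply: gnil_fix.
  by rewrite /= linearZ /= rmorph1.
- exact: gnilD.
- exact: gnilM.
Qed.

Lemma gens_gnil a : alg_span gens a -> gnil G a.
Proof.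
apply: alg_span_gnil => {}a [i [->|->]]; last by apply/gnil_fix/gens_fixY.
exists 2%N; rewrite !iterS /= gdiff_X /gdiff /= linearZ /= gens_fixY.
by rewrite subrr.
Qed.

(* The subalgebra generated by the gens is contained in C[z], where
   z = y^-1 x satisfies G(z) = z + h and C is a commutative algebra of G-fixed
   elements; taking top differences shows that its G-fixed elements are in C. *)
Let z := (Y o)^-1 * X o.
Let br i := X o * Y i - Y o * X i - h *: (Y o * Y i).
Let Cgens : set Q := [set a | [\/ exists i, a = Y i, a = (Y o)^-1 | exists i, a = br i]].
Let C := alg_span Cgens.

Let rels i j := proj1 (braided_doublets (X i) (Y i) (dXY j)) (bXY i j).
Let YY i j : Y i * Y j = Y j * Y i. Proof. by case: (rels i j). Qed.
Let XY i j : X i * Y j = Y j * X i + h *: (Y j * Y i). Proof. by case: (rels i j). Qed.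
Let GV : G (Y o)^-1 = (Y o)^-1.
Proof. by have -> : G (Y o)^-1 = (G (Y o))^-1 := rmorphV _ uYo; rewrite gens_fixY. Qed.

Let br_fix i : G (br i) = br i.
Proof.
have [_ [_ [Go _ _ _]]] := dXY o; have [_ [_ [Gi _ _ _]]] := dXY i.
rewrite /br !raddfB /= !rmorphM /= linearZ /= rmorphM /= Go Gi !gens_fixY.
by nc h.
Qed.

Let br_H i : H (br i) = 0.
Proof.
have [[_ _ Ho] [[_ _ HYo] [Go _ _ _]]] := dXY o.
have [[_ _ Hi] [[_ _ HYi] [Gi GYi G'i G'Yi]]] := dXY i.
rewrite /br !raddfB /= linearZ /= !aHM Ho HYo Hi HYi Go G'i G'Yi gens_fixY.
by nc h.
Qed.

Let br_central i q : br i * q = q * br i.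
Proof. exact: gens_central (br_fix i) (br_H i) q. Qed.

Let C_fix a : C a -> G a = a.
Proof.
elim=> {a} [a [[i ->]| ->|[i ->]]||c a _ IH|a b _ IHa _ IHb|a b _ IHa _ IHb].
- exact: gens_fixY.
- exact: GV.
- exact: br_fix.
- exact: rmorph1.
- by rewrite linearZ /= IH.
- by rewrite raddfD /= IHa IHb.
- by rewrite rmorphM /= IHa IHb.
Qed.

Let C_comm a b : C a -> C b -> a * b = b * a.
Proof.
apply: alg_span_comm2 => {}a {}b.
have YV i : Y i / Y o = (Y o)^-1 * Y i.
  by apply: (mulrI uYo); rewrite mulVKr // mulrA YY mulrK.
case=> [[i ->]| ->|[i ->]]; case=> [[j ->]| ->|[j ->]] //;
by rewrite ?br_central -?br_central.
Qed.

(** The commutator with [z] is a derivation of [C], multiplying Y_i by h and (Y_o)^-1 by -h.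
    Polynomials in [z] with coefficients in [C] therefore form a ring, an Ore extension of [C]. *)
Let C_der a : C a -> C (z * a - a * z).
Proof.
have YiV i : z * Y i - Y i * z = h *: Y i.
  have Vi : (Y o)^-1 * Y i = Y i * (Y o)^-1.
    by apply: (mulrI uYo); rewrite mulVKr // mulrA YY mulrK.
  have -> : z * Y i = (Y o)^-1 * Y i * X o + h *: ((Y o)^-1 * Y i * Y o).
    by rewrite /z -mulrA XY; nc h.
  by rewrite Vi divrK // /z mulrA addrC addKr.
elim=> {a} [a [[i ->]| ->|[i ->]]||c a _ IH|a b Ca IHa Cb IHb|a b Ca IHa Cb IHb].
- by rewrite YiV; apply: alg_spanZ; apply: alg_span_gen; apply: Or31; exists i.
- have -> : z / Y o - (Y o)^-1 * z = - (h *: (Y o)^-1).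
    have e : (Y o)^-1 * (z * Y o - Y o * z) / Y o = (Y o)^-1 * z - z / Y o.
      by rewrite mulrBr mulKr // mulrBl !mulrA mulrK.
    by rewrite -[LHS]opprB -e YiV -scalerAr mulVr // -scalerAl mul1r.
  by apply/alg_spanN/alg_spanZ/alg_span_gen; apply: Or32.
- by rewrite br_central subrr; apply: alg_span0.
- by rewrite mulr1 mul1r subrr; apply: alg_span0.
- by rewrite -scalerAl -scalerAr -scalerBr; apply: alg_spanZ.
- by rewrite mulrDl mulrDr opprD addrACA; apply: alg_spanD.
- have -> : z * (a * b) - a * b * z = (z * a - a * z) * b + a * (z * b - b * z).
    by nc h.
  by apply: alg_spanD; apply: alg_spanM.
Qed.

Let PZ q := exists p : {poly Q}, (forall i, C p`_i) /\ q = p.[z].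

Let PZD a b : PZ a -> PZ b -> PZ (a + b).
Proof.
move=> [p [Cp ->]] [q [Cq ->]]; exists (p + q); rewrite hornerD; split=> // i.
by rewrite coefD; apply: alg_spanD; [apply: Cp|apply: Cq].
Qed.

Let PZC a : C a -> PZ a.
Proof.
move=> Ca; exists a%:P; rewrite hornerC; split=> // i; rewrite coefC.
by case: eqP => // _; apply: alg_span0.
Qed.

Let PZz a : PZ a -> PZ (a * z).
Proof.
move=> [p [Cp ->]]; exists (p * 'X); rewrite hornerMX; split=> // i.
by rewrite coefMX; case: eqP => // _; apply: alg_span0.
Qed.

Let PZMC a b : PZ a -> C b -> PZ (a * b).
Proof.
move=> [p [Cp ->]]; elim/poly_ind: p b Cp => [|p c IH] b Cp Cb.
  by rewrite horner0 mul0r; apply/PZC/alg_span0.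
have Cp' i : C p`_i by have := Cp i.+1; rewrite coefD coefMX coefC addr0.
have Cc : C c by have := Cp 0%N; rewrite coefD coefMX coefC add0r.
rewrite hornerD hornerMX hornerC mulrDl; apply: PZD; last by apply/PZC/alg_spanM.
have -> : p.[z] * z * b = p.[z] * b * z + p.[z] * (z * b - b * z) by nc h.
by apply: PZD; [apply: PZz; apply: IH|apply: IH => //; apply: C_der].
Qed.

Let PZM a b : PZ a -> PZ b -> PZ (a * b).
Proof.
move=> Pa [p [Cp ->]]; elim/poly_ind: p Cp => [|p c IH] Cp.
  by rewrite horner0 mulr0; apply/PZC/alg_span0.
have Cp' i : C p`_i by have := Cp i.+1; rewrite coefD coefMX coefC addr0.
have Cc : C c by have := Cp 0%N; rewrite coefD coefMX coefC add0r.
rewrite hornerD hornerMX hornerC mulrDr mulrA; apply: PZD; last exact: PZMC.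
by apply: PZz; apply: IH.
Qed.

Let gens_PZ a : alg_span gens a -> PZ a.
Proof.
have PZY i : PZ (Y i) by apply: PZC; apply: alg_span_gen; apply: Or31; exists i.
have PZV : PZ (Y o)^-1 by apply: PZC; apply: alg_span_gen; apply: Or32.
have PZbr i : PZ (br i) by apply: PZC; apply: alg_span_gen; apply: Or33; exists i.
have CZ (c : K) : C c%:A by apply/alg_spanZ/alg_span1.
have PZZ c b : PZ b -> PZ (c *: b).
  by move=> Pb; rewrite -[b]mul1r scalerAl; apply: PZM => //; apply: PZC.
have PZN b : PZ b -> PZ (- b) by rewrite -scaleN1r; apply: PZZ.
have PZX : PZ (X o).
  have -> : X o = Y o * z by rewrite /z mulVKr.
  by apply: PZM => //; rewrite -[z]mul1r; apply/PZz/PZC/alg_span1.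
elim=> {a} [a [i [->|->]]||c a _ IH|a b _ IHa _ IHb|a b _ IHa _ IHb] //.
(* The definition of the central bracket [br i], solved for [X i]. *)
- have -> : X i = (Y o)^-1 * (X o * Y i - br i - h *: (Y o * Y i)).
    apply: (mulrI uYo); rewrite mulVKr // /br.
    by nc h.
  apply: PZM => //; apply: PZD; first by apply: PZD; [apply: PZM|apply: PZN].
  by apply/PZN/PZZ/PZM.
- by apply/PZC/alg_span1.
- exact: PZZ.
- exact: PZD.
- exact: PZM.
Qed.

(** As G(z) = z + h, [G - 1] acts on powers of [z] as the finite difference with step [h]. *)
Let zdiff n : iter n.+1 (gdiff G) (z ^+ n) = 0 /\
  iter n (gdiff G) (z ^+ n) = (n`!%:R * h ^+ n)%:A.
Proof.
have dz : gdiff G z = h%:A.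
  have [_ [_ [Go _ _ _]]] := dXY o.
  by rewrite /gdiff /= /z rmorphM /= GV Go mulrDr addrC addKr -scalerAr mulVr.
have d2z : iter 2 (gdiff G) z = 0.
  by rewrite !iterS /= dz /gdiff /= linearZ /= rmorph1 subrr.
elim: n => [|n [IH1 IH2]].
  by split; rewrite /= /gdiff expr0 rmorph1 ?subrr // mulr1 scale1r.
rewrite !exprSr; have e1 := iter_gdiffM0 IH1 d2z; have e2 := iter_gdiffM IH1 d2z.
rewrite addn1 in e1 e2; split=> //; rewrite e2 IH2 /= dz binSn.
rewrite -scalerAl mul1r scalerA -scaler_nat scalerA; congr (_ *: _).
by rewrite factS natrM !mulrA.
Qed.

Let Cdiff c a n : C c -> iter n (gdiff G) (c * a) = c * iter n (gdiff G) a.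
Proof.
move=> /C_fix Gc; elim: n => // n IH; rewrite !iterS IH /gdiff.
by rewrite rmorphM /= Gc mulrBr.
Qed.

Lemma gens_fix_C a : alg_span gens a -> G a = a -> C a.
Proof.
move=> /gens_PZ[p [Cp ->]]; elim: {p}(size p) {-2}p (leqnn (size p)) Cp => [|n IH] p.
  by rewrite size_poly_leq0 => /eqP -> _ _; rewrite horner0; apply: alg_span0.
move=> pn Cp Gp; case: n pn IH => [|n] pn IH.
  by rewrite (size1_polyC pn) hornerC; apply: Cp.
apply: IH => //; rewrite leq_eqVlt in pn; case/orP: pn => // /eqP pn.
have : iter n.+1 (gdiff G) p.[z] = 0.
  by rewrite iterSr (_ : gdiff G _ = 0) ?iter_gdiff0 // /gdiff /= Gp subrr.
rewrite horner_coef pn big_ord_recr iter_gdiffD.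
have -> : iter n.+1 (gdiff G) (\sum_(i < n.+1) p`_i * z ^+ i) = 0.
  elim/big_ind: _ => [|u v u0 v0|i _]; first exact: iter_gdiff0.
    by rewrite iter_gdiffD u0 v0 addr0.
  by rewrite Cdiff // (iter_gdiff_ge _ (zdiff i).1) ?mulr0.
rewrite add0r Cdiff // (zdiff n.+1).2 -scalerAr mulr1 => /eqP.
rewrite scaler_eq0 mulf_eq0 pnatr_eq0 eqn0Ngt fact_gt0 expf_eq0 (negPf h_neq0) andbF /=.
have : lead_coef p != 0 by rewrite lead_coef_eq0 -size_poly_eq0 pn.
by rewrite lead_coefE pn /= => /negPf ->.
Qed.

Lemma gens_good : good s.
Proof.
split.
- exact: Qdiv.
- exists (Y o); split=> //; last by have [_ [[]]] := dXY o.
  by move=> q; have [] := gens_braided o q.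
- exact: gens_central.
- move=> q; have [a [b [Aa Ab b0 ->]]] := frac q; exists a, b.
  by split=> //; apply: gens_gnil.
(* A fixed v = a/b is rewritten as (v c)/c with [c] the top difference of [b]. Both terms lie in the
   generated algebra and are fixed by [G], hence lie in the commutative [C]. *)
have fixfrac v : G v = v -> exists a b, [/\ C a, C b, b != 0 & v = a / b].
  move=> Gv; have [a [b [Aa Ab b0 vE]]] := frac v.
  have [n [c0 c1]] := gnil_top (gens_gnil Ab) b0; set c := iter n _ b in c0.
  have Gc : G c = c by apply: gdiff_fix.
  have UB a1 a2 : alg_span gens a1 -> alg_span gens a2 -> alg_span gens (a1 - a2).
    exact: alg_spanB.
  have UG a1 : alg_span gens a1 -> alg_span gens (G a1).
    apply: alg_span_image => u [i [->|->]].
      have [_ [_ [-> _ _ _]]] := dXY i; apply: alg_spanD; [|apply: alg_spanZ];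
        by apply: alg_span_gen; exists i; auto.
    by rewrite gens_fixY; apply: alg_span_gen; exists i; auto.
  have Uc k : alg_span gens (iter k (gdiff G) b).
    elim: k => // k IH; rewrite iterS; apply: UB => //; exact: UG.
  exists (v * c), c; split.
  - apply: gens_fix_C; last by rewrite rmorphM /= Gv Gc.
    apply: (frac_top (U := alg_span gens)) => //; first exact: alg_spanN.
      by left.
    by rewrite vE divrK // Qdiv.
  - exact: gens_fix_C (Uc n) Gc.
  - by [].
  - by rewrite mulrK // Qdiv.
move=> v w /fixfrac[a [b [Ca Cb b0 ->]]] /fixfrac[a' [b' [Ca' Cb' b0' ->]]].
have com e : C e -> GRing.comm e (a / b).
  move=> Ce; apply: commrM; first exact: C_comm.
  by apply: commrV; apply: C_comm.
apply: commrM; first by apply: commr_sym; apply: com.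
by apply: commrV; apply: commr_sym; apply: com.
Qed.
End DoubletDivisionRing.

(** * Nonvanishing of y_0 and (01) *)

Section Nonvanishing.
Context {d : Order.disp_t} {K : fieldType} (h : K) (I : orderType d) (i0 i1 : I).
Hypothesis h_neq0 : h != 0.
Hypothesis i01 : i0 != i1.
Local Notation M := 'M[K]_4.
Let e (i j : 'I_4) : M := delta_mx i j.
Let o (k : nat) : 'I_4 := inord k.

(* Operators on K[y, u]/(y^2, u^2), in the basis 1, u, y, yu: y_0 and x_1 act
   as multiplication by y and u, and x_0 as the derivation u |-> -h yu, y |-> 0;
   the other generators act as 0. *)
Let my := e (o 2) (o 0) + e (o 3) (o 1).
Let mu := e (o 1) (o 0) + e (o 3) (o 2).
Let md := - (h *: e (o 3) (o 1)).
Let ee (i j k l : nat) : (i < 4)%N -> (j < 4)%N -> (k < 4)%N -> (l < 4)%N ->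
  e (o i) (o j) * e (o k) (o l) = if j == k then e (o i) (o l) else 0.
Proof.
move=> i4 j4 k4 l4; rewrite -[LHS]/(e (o i) (o j) *m e (o k) (o l)) mul_delta_mx_cond.
by rewrite -val_eqE /= !inordK //; case: eqP.
Qed.

(** In the representation on the four-dimensional space, y_0 becomes multiplication by y and the
    bracket becomes minus multiplication by yu. *)
Lemma bracket_y_neq0 : bracket h i0 i1 != 0 /\ HI_y h i0 != 0.
Proof.
pose X i := if i == i0 then md else if i == i1 then mu else 0.
pose Y i := if i == i0 then my else 0.
have i10 : i1 == i0 = false by apply/negbTE; rewrite eq_sym.
have yy : my * my = 0.
  by rewrite /my mulrDl !mulrDr !ee //= !addr0.
have yu : my * mu = e (o 3) (o 0).
  by rewrite /my /mu mulrDl !mulrDr !ee //= !(addr0, add0r).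
have uy : mu * my = e (o 3) (o 0).
  by rewrite /my /mu mulrDl !mulrDr !ee //= !(addr0, add0r).
have dy : md * my = 0.
  by rewrite /md /my mulNr -scalerAl mulrDr !ee //= addr0 scaler0 oppr0.
have yd : my * md = 0.
  by rewrite /md /my mulrN -scalerAr mulrDl !ee //= addr0 scaler0 oppr0.
have du : md * mu = - (h *: e (o 3) (o 0)).
  by rewrite /md /mu mulNr -scalerAl mulrDr !ee //= addr0.
have ud : mu * md = 0.
  by rewrite /md /mu mulrN -scalerAr mulrDl !ee //= addr0 scaler0 oppr0.
have rels u v : HI_rel h X Y u v -> u = v.
  have Yne i : i != i0 -> Y i = 0 by rewrite /Y => /negPf ->.
  have XE i : [\/ i = i0, i = i1 | X i = 0 /\ Y i = 0].
    by rewrite /X /Y; case: eqP; [constructor 1|case: eqP; [constructor 2|constructor 3]].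
  have X0 : X i0 = md by rewrite /X eqxx.
  have X1 : X i1 = mu by rewrite /X i10 eqxx.
  have Y0 : Y i0 = my by rewrite /Y eqxx.
  have Y1 : Y i1 = 0 by rewrite /Y i10.
  have YY i j : Y i * Y j = 0.
    have [->|/Yne ->] := eqVneq i i0; last by rewrite mul0r.
    by have [->|/Yne ->] := eqVneq j i0; rewrite ?mulr0 // Y0 yy.
  have XY i j : X i * Y j = Y j * X i.
    have [->|/Yne ->] := eqVneq j i0; last by rewrite mulr0 mul0r.
    by case: (XE i) => [->|->|[-> _]]; rewrite ?X0 ?X1 ?Y0 ?dy ?yd ?uy ?yu // mulr0 mul0r.
  case=> [i|i j ij|i j ij|i j ij|i j ij].
  - by rewrite XY expr2 YY scaler0 addr0.
  - by rewrite XY YY scaler0 addr0.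
  - by rewrite -XY YY scaler0 subr0.
  - by rewrite !YY.
  - rewrite YY scaler0 addr0.
    by case: (XE i) ij => [->|->|[Xi Yi]]; case: (XE j) => [->|->|[Xj Yj]];
      rewrite ?ltxx // ?X0 ?X1 ?Y0 ?Y1 ?Xi ?Xj ?Yi ?Yj ?mulr0 ?mul0r ?du ?ud ?yu ?uy
        ?dy ?yd ?scaler0 ?subr0 ?addr0 ?oppr0 ?add0r ?addNr.
have [phi phiE] := HI_universal rels.
have e0 i j : e i j != 0.
  apply/eqP => /matrixP/(_ i j); rewrite !mxE !eqxx /= => /eqP; exact/negP/oner_neq0.
have [[x0 y0] [x1 y1]] := (phiE i0, phiE i1).
rewrite /X /Y !eqxx i10 in x0 y0 x1 y1.
have nz a : phi a != 0 -> a != 0 by apply: contra_neq => ->; rewrite rmorph0.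
split; apply: nz.
- rewrite /bracket morph_linear_form x0 y0 x1 y1 /linear_form_expr.
  by rewrite !mulr0 scaler0 sub0r subr0 yu oppr_eq0.
- rewrite y0; apply: contra_neq (e0 (o 3) (o 0)) => y_eq0.
  by rewrite -yu y_eq0 mul0r.
Qed.
End Nonvanishing.

(** * Iterated derivations and scalar parameters *)

Section Derivation.
Context {K : numFieldType} {A : algType K} (D : {linear A -> A}).
Hypothesis DM : forall a b, D (a * b) = D a * b + a * D b.

Lemma der1 : D 1 = 0.
Proof. by have := DM 1 1; rewrite !mul1r mulr1 => /eqP; rewrite -subr_eq0 opprD addNKr oppr_eq0 => /eqP. Qed.

(** [b] is the divided power D^n a / n!, the last one that can be nonzero. For a product of [n]
    factors, each killed by D^2, it is the product of their derivatives. *)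
Definition der_top n (a b : A) := iter n D a = n`!%:R *: b /\ iter n.+1 D a = 0.

Lemma der_top1 : der_top 0 1 1.
Proof. by split; rewrite /= ?scale1r ?der1. Qed.

Lemma der_topM n l l' a b : D l = l' -> D l' = 0 -> der_top n a b -> der_top n.+1 (l * a) (l' * b).
Proof.
move=> Dl Dl' [ab a0].
have iterM k c : iter k.+1 D (l * c) = l * iter k.+1 D c + (k.+1)%:R *: (l' * iter k D c).
  elim: k => [|k IH]; first by rewrite /= DM Dl addrC scale1r.
  rewrite iterS IH raddfD /= linearZ /= !DM Dl Dl' mul0r add0r.
  set u := D (iter k D c); rewrite [l' * u + _]addrC -addrA; congr (_ + _).
  by rewrite -{1}[l' * u]scale1r -scalerDl nat1r.
split; first by rewrite iterM a0 ab mulr0 add0r -scalerAr scalerA -natrM -factS.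
by rewrite iterM [iter n.+2 D a]iterS a0 raddf0 !mulr0 scaler0 addr0.
Qed.

Lemma der_topMr n a b c : D c = 0 -> der_top n a b -> der_top n (a * c) (b * c).
Proof.
move=> Dc [ab a0]; have iterM k u : iter k D (u * c) = iter k D u * c.
  by elim: k => // k IH; rewrite !iterS IH DM Dc mulr0 addr0.
by split; rewrite iterM ?ab ?a0 ?mul0r // scalerAl.
Qed.
End Derivation.

(** Subtracting 2^N times the value at t from the value at 2t removes the top coefficient and
    multiplies the j-th one by 2^j - 2^N, which is nonzero for j < N. *)
Lemma scalar_poly_zero {K : numFieldType} {V : lmodType K} N (v : nat -> V) :
  (forall t : K, \sum_(k < N) t ^+ k *: v k = 0) -> forall k, (k < N)%N -> v k = 0.
Proof.
elim: N v => // N IH v v0 k.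
have vk j : (j < N)%N -> v j = 0.
  move=> jN; have : (2 ^+ j - 2 ^+ N : K) *: v j = 0.
    apply: (IH (fun j => (2 ^+ j - 2 ^+ N : K) *: v j)) => // t.
    have := congr2 (fun a b => a - 2 ^+ N *: b) (v0 (2 * t)) (v0 t).
    rewrite scaler0 subr0 => e; rewrite -[RHS]e scaler_sumr -sumrB big_ord_recr /=.
    rewrite exprMn scalerA subrr addr0; apply: eq_bigr => i _.
    by rewrite exprMn !scalerA -scalerBl mulrBr mulrC [t ^+ i * _]mulrC.
  move=> /eqP; rewrite scaler_eq0 subr_eq0 => /orP[|/eqP //].
  have /eqP <- : (2%:R : K) == 2 by [].
  by rewrite -!natrX eqr_nat eqn_exp2l // => /eqP jE; rewrite jE ltnn in jN.
rewrite ltnS leq_eqVlt => /orP[/eqP ->|]; last exact: vk.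
have := v0 1; rewrite big_ord_recr /= big1 ?add0r ?expr1n ?scale1r // => i _.
by rewrite vk ?scaler0.
Qed.

Section DoubletForms.
Context {K : numFieldType} {h : K} {A : algType K} (s : uh_action h A).

Lemma bracket_invariant p q p' q' : doublet s p q -> doublet s p' q' ->
  uh_invariant s (linear_form_expr h p q p' q').
Proof.
move=> [[Ep Fp Hp] [[Eq Fq Hq] [Gp Gq G'p G'q]]].
move=> [[Ep' Fp' Hp'] [[Eq' Fq' Hq'] [Gp' Gq' G'p' G'q']]].
split; rewrite /linear_form_expr !raddfB /= ?linearZ /= ?aEM ?aFM ?aHM
  ?Ep ?Fp ?Hp ?Eq ?Fq ?Hq ?Gp ?Gq ?G'p ?G'q ?Ep' ?Fp' ?Hp' ?Eq' ?Fq' ?Hq' ?Gp' ?Gq' ?G'p' ?G'q'.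
- by nc h.
- by nc h.
- by nc h.
Qed.
End DoubletForms.

(** * Typical representation *)

Section GeneratorDefs.
Context {d : Order.disp_t} {K : numFieldType} {I : orderType d} {A : algType K} (x y : I -> A).

(** This and the next two definitions repeat [HJ], [homog] and [is_polarization] for generators of
    an arbitrary algebra. *)
Definition gspan (J : set I) : set A :=
  alg_span [set a | exists2 i, J i & a = x i \/ a = y i].

Inductive ghomog (k : I) : nat -> A -> Prop :=
| ghomog_x i : ghomog k (i == k) (x i)
| ghomog_y i : ghomog k (i == k) (y i)
| ghomog1 : ghomog k 0 1
| ghomog0 m : ghomog k m 0
| ghomogZ m c a : ghomog k m a -> ghomog k m (c *: a)
| ghomogD m a b : ghomog k m a -> ghomog k m b -> ghomog k m (a + b)
| ghomogM m n a b : ghomog k m a -> ghomog k n b -> ghomog k (m + n) (a * b).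

Definition gpolarization (k l : I) (D : A -> A) : Prop :=
  [/\ forall a b, D (a * b) = D a * b + a * D b,
      D (x k) = x l, D (y k) = y l
    & forall i, i != k -> D (x i) = 0 /\ D (y i) = 0].
End GeneratorDefs.

(* H_I is used only through these properties: on H_I itself, unification
   unfolds the quotient of the free algebra. *)
Record jordanian {d : Order.disp_t} {K : numFieldType} (h : K) (I : orderType d)
    (A : algType K) (s : uh_action h A) (x y : I -> A) : Prop := Jordanian {
  jd_doublet : forall i, doublet s (x i) (y i);
  jd_gen : forall a, gspan x y setT a;
  jd_yy : forall i j, y i * y j = y j * y i;
  jd_xy : forall i j, x i * y j = y j * x i + h *: (y i * y j);
  jd_xx : forall i j, x i * x j = x j * x i + h *: (y j * x i) - h *: (y i * x j);
  jd_univ : forall X Y : I -> A, (forall u v, HI_rel h X Y u v -> u = v) ->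
    exists phi : {lrmorphism A -> A}, forall i, phi (x i) = X i /\ phi (y i) = Y i
}.

Section Substitution.
Context {d : Order.disp_t} {K : numFieldType} {h : K} {I : orderType d}.
Context {A : algType K} {s : uh_action h A} {x y : I -> A}.
Hypothesis jA : jordanian s x y.
Local Notation E := (aE s).
Local Notation F := (aF s).
Local Notation H := (aH s).
Local Notation G := (aG s).
Local Notation G' := (aG' s).
Local Notation gspan := (gspan x y).
Local Notation ghomog := (ghomog x y).

Let jdd i : doublet s (x i) (y i).
Proof. exact: jd_doublet. Qed.

Lemma jd_gens_braided i j : braided s (x i) (y i) (x j) /\ braided s (x i) (y i) (y j).
Proof.
apply/(braided_doublets (x i) (y i) (jdd j)); split.
- exact: (jd_yy jA).
- by rewrite (jd_xy jA) (jd_yy jA i j).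
- by rewrite (jd_xy jA j i) addrK.
- by rewrite (jd_xx jA) (jd_xy jA j i); nc h.
Qed.

Lemma jd_ind (P : A -> Prop) : (forall i, P (x i)) -> (forall i, P (y i)) ->
  P 1 -> (forall c a, P a -> P (c *: a)) -> (forall a b, P a -> P b -> P (a + b)) ->
  (forall a b, P a -> P b -> P (a * b)) -> forall a, P a.
Proof.
move=> Px Py P1 PZ PD PM a.
by elim: (jd_gen jA a) => {a} [a [i _ [->|->]]||c a _ Pa|a b _ Pa _ Pb|a b _ Pa _ Pb];
  auto.
Qed.

Lemma jd_braided i a : braided s (x i) (y i) a.
Proof.
move: a; apply: jd_ind => [j|j||c a|a b|a b].
- by have [] := jd_gens_braided i j.
- by have [] := jd_gens_braided i j.
- exact: braided1.
- exact: braidedZ.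
- exact: braidedD.
- exact: braidedM.
Qed.

(** The generators braid past [p] and [q] like past any element; symmetry turns this into braiding
    of the given doublet past the generators. *)
Lemma jd_doublet_braided p q a : doublet s p q -> braided s p q a.
Proof.
move=> dpq; move: a; have bg j : braided s p q (x j) /\ braided s p q (y j).
  by apply: (braided_sym (jdd j) dpq); split; apply: jd_braided.
apply: jd_ind => [j|j||c a|a b|a b].
- by have [] := bg j.
- by have [] := bg j.
- exact: braided1.
- exact: braidedZ.
- exact: braidedD.
- exact: braidedM.
Qed.

(** Doublets automatically satisfy the relations of H_I, since any two of them braid. This serves to
    rename the index 0 as 1, to exchange both, and to replace (x_0, y_0) by a pencil of doublets. *)
Lemma jd_substitution (X Y : I -> A) : (forall i, doublet s (X i) (Y i)) ->
  exists phi : {lrmorphism A -> A},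
    (forall i, phi (x i) = X i /\ phi (y i) = Y i) /\ extends_action phi s s.
Proof.
move=> dXY; have rels := braided_rels dXY (fun i j =>
  conj (jd_doublet_braided (X j) (dXY i)) (jd_doublet_braided (Y j) (dXY i))).
have [phi phiE] := jd_univ jA rels; exists phi; split=> // a.
apply: (extends_span _ (jd_gen jA a)) => {}a [i _ ai].
have [[E1 F1 H1] [[E2 F2 H2] [G1 G2 G3 G4]]] := dXY i.
have [[e1 f1 h1] [[e2 f2 h2] [g1 g2 g3 g4]]] := jdd i.
have [px py] := phiE i; case: ai => ->.
  by rewrite px E1 F1 H1 G1 G3 e1 f1 h1 g1 g3 raddf0 raddfB raddfD /= linearZ /= px py.
by rewrite py E2 F2 H2 G2 G4 e2 f2 h2 g2 g4 raddf0 raddfN /= px py.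
Qed.

Lemma gspan_fix (phi : {lrmorphism A -> A}) (J : set I) a :
  (forall i, J i -> phi (x i) = x i /\ phi (y i) = y i) -> gspan J a -> phi a = a.
Proof.
move=> phiJ; elim=> {a} [a [i /phiJ[px py] [->|->]]||c a _ IH|a b _ IHa _ IHb|a b _ IHa _ IHb] //.
- exact: rmorph1.
- by rewrite linearZ /= IH.
- by rewrite raddfD /= IHa IHb.
- by rewrite rmorphM /= IHa IHb.
Qed.

Lemma gspan_x (J : set I) i : J i -> gspan J (x i).
Proof. by move=> Ji; apply: alg_span_gen; exists i; auto. Qed.
Lemma gspan_y (J : set I) i : J i -> gspan J (y i).
Proof. by move=> Ji; apply: alg_span_gen; exists i; auto. Qed.

Lemma gspan_action (J : set I) a : gspan J a ->
  [/\ gspan J (E a), gspan J (F a), gspan J (H a), gspan J (G a) & gspan J (G' a)].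
Proof.
elim=> {a} [a [i Ji ai]||c a _ [e1 e2 e3 e4 e5]
  |a b _ [e1 e2 e3 e4 e5] _ [f1 f2 f3 f4 f5]|a b Ja [e1 e2 e3 e4 e5] Jb [f1 f2 f3 f4 f5]].
- have [[E1 F1 H1] [[E2 F2 H2] [G1 G2 G3 G4]]] := jdd i.
  have Jx := gspan_x Ji; have Jy := gspan_y Ji.
  have J0 : gspan J 0 by apply: alg_span0.
  case: ai => ->; rewrite ?(E1, F1, H1, G1, G3, E2, F2, H2, G2, G4); split=> //.
  + by apply: alg_spanD => //; apply: alg_spanZ.
  + by apply: alg_spanB => //; apply: alg_spanZ.
  + exact: alg_spanN.
- rewrite aE1 aF1 aH1 !rmorph1; split; do ?[exact: alg_span0|exact: alg_span1].
- by rewrite !linearZ /=; split; apply: alg_spanZ.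
- by rewrite !raddfD /=; split; apply: alg_spanD.
- rewrite aEM aFM aHM !rmorphM /=; split; do ?[apply: alg_spanD]; exact: alg_spanM.
Qed.

Lemma gspan_S (J : set I) a : gspan J a -> gspan J (uhS s a).
Proof.
move=> /gspan_action[_ _ Ha Ga G'a].
by rewrite uhSE; apply: alg_spanB; apply: alg_spanZ => //; apply: alg_spanB.
Qed.

Lemma gspan_sub (J J' : set I) a : (forall i, J i -> J' i) -> gspan J a -> gspan J' a.
Proof.
move=> JJ' Ja; apply: (alg_span_trans Ja) => b [i Ji bi].
by apply: alg_span_gen; exists i => //; apply: JJ'.
Qed.

Lemma gspan_mul_xy (J : set I) i a : gspan J a ->
  exists b c, [/\ gspan J b, gspan J c,
    a * x i = x i * b - y i * c & a * y i = y i * G a].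
Proof.
move=> Ja; have [_ _ _ JG JG'] := gspan_action Ja.
have ay b : b * y i = y i * G b.
  by have [-> _] := jd_braided i (G b); rewrite aGK.
(* Braiding x_i past [G' a] gives x_i G'(a) = a x_i + S(G' a) y_i; the last term is then moved to
   the right of y_i by [G]. *)
exists (G' a), (G (uhS s (G' a))); split=> //.
  by have [] := gspan_action (gspan_S JG').
have [_ ->] := jd_braided i (G' a).
by rewrite aG'K ay addrK.
Qed.

Section Polarization.
Context (k l : I) (D : {linear A -> A}).
Hypothesis Dpol : gpolarization x y k l D.
Let DM a b : D (a * b) = D a * b + a * D b. Proof. by case: Dpol. Qed.

Lemma pol1 : D 1 = 0. Proof. exact: der1 DM. Qed.

Lemma pol_gspan (J : set I) a : ~ J k -> gspan J a -> D a = 0.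
Proof.
move=> Jk; elim=> {a} [a [i Ji ai]||c a _ IH|a b _ IHa _ IHb|a b _ IHa _ IHb].
- have ik : i != k by apply: contra_notN Jk => /eqP <-.
  by case: Dpol => _ _ _ /(_ i ik)[Dx Dy]; case: ai => ->.
- exact: pol1.
- by rewrite linearZ /= IH scaler0.
- by rewrite raddfD /= IHa IHb addr0.
- by rewrite DM IHa IHb mul0r mulr0 addr0.
Qed.

(** In degree 0 the truncated predecessor is again 0; the first clause then says that [D a]
    vanishes. *)
Lemma ghomog_pol m a : l != k -> ghomog k m a -> (m = 0%N -> D a = 0) /\ ghomog k m.-1 (D a).
Proof.
move=> lk; have [_ Dx Dy D0] := Dpol.
have lk0 (b : A) : ghomog k (l == k) b -> ghomog k 0 b by rewrite (negPf lk).
elim=> {m a} [i|i||m|m c a _ [IH0 IH]|m a b _ [IHa0 IHa] _ [IHb0 IHb]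
   |m n a b Ha [IHa0 IHa] Hb [IHb0 IHb]].
- have [->|ik] := eqVneq i k; first by rewrite Dx; split=> //; apply/lk0/ghomog_x.
  by have [-> _] := D0 i ik; split=> // ; apply: ghomog0.
- have [->|ik] := eqVneq i k; first by rewrite Dy; split=> //; apply/lk0/ghomog_y.
  by have [_ ->] := D0 i ik; split=> // ; apply: ghomog0.
- by rewrite pol1; split=> //; apply: ghomog0.
- by rewrite raddf0; split=> //; apply: ghomog0.
- rewrite linearZ /=; split; last exact: ghomogZ.
  by move=> /IH0 ->; rewrite scaler0.
- rewrite raddfD /=; split; last exact: ghomogD.
  by move=> m0; rewrite IHa0 // IHb0 // addr0.
- rewrite DM; split.
    by move/eqP; rewrite addn_eq0 => /andP[/eqP/IHa0 -> /eqP/IHb0 ->]; rewrite mul0r mulr0 addr0.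
  apply: ghomogD.
    case: m Ha IHa0 IHa => [|m] Ha IHa0 IHa; first by rewrite IHa0 // mul0r; apply: ghomog0.
    by rewrite addSn /=; apply: ghomogM.
  case: n Hb IHb0 IHb => [|n] Hb IHb0 IHb; first by rewrite IHb0 // mulr0; apply: ghomog0.
  by rewrite addnS /=; apply: ghomogM.
Qed.

Lemma pol_action a : [/\ D (E a) = E (D a), D (F a) = F (D a), D (H a) = H (D a),
  D (G a) = G (D a) & D (G' a) = G' (D a)].
Proof.
move: a; have [_ Dx Dy D0] := Dpol.
have gen i : doublet s (D (x i)) (D (y i)).
  have [->|ik] := eqVneq i k; first by rewrite Dx Dy; apply: jdd.
  have [-> ->] := D0 i ik; by rewrite /doublet !raddf0 ?addr0.
apply: jd_ind => [i|i||c a [e1 e2 e3 e4 e5]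
  |a b [e1 e2 e3 e4 e5] [f1 f2 f3 f4 f5]|a b [e1 e2 e3 e4 e5] [f1 f2 f3 f4 f5]].
- have [[-> -> ->] [_ [-> _ -> _]]] := gen i.
  have [[-> -> ->] [_ [-> _ -> _]]] := jdd i.
  by rewrite raddf0 raddfB raddfD /= linearZ.
- have [_ [[-> -> ->] [_ -> _ ->]]] := gen i.
  have [_ [[-> -> ->] [_ -> _ ->]]] := jdd i.
  by rewrite raddf0 raddfN.
- by rewrite aE1 aF1 aH1 !rmorph1 pol1 !raddf0.
- by rewrite !linearZ /= e1 e2 e3 e4 e5.
- by rewrite !raddfD /= e1 e2 e3 e4 e5 f1 f2 f3 f4 f5.
- rewrite !aEM !aFM !aHM !rmorphM /= !raddfD /= !DM !raddfD /= !aEM !aFM !aHM !rmorphM /=.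
  rewrite e1 e2 e3 e4 e5 f1 f2 f3 f4 f5; split; nc h.
Qed.

Lemma pol_invariant a : uh_invariant s a -> uh_invariant s (D a).
Proof.
by move=> [Ea Fa Ha]; have [e f g _ _] := pol_action a; split;
  rewrite -?e -?f -?g ?Ea ?Fa ?Ha raddf0.
Qed.
End Polarization.

(** Euler's identity. It makes the degree of a nonzero homogeneous element unique, so that
    [polarize] divides by the intended number. *)
Lemma euler_ghomog k (D : {linear A -> A}) : gpolarization x y k k D ->
  forall m a, ghomog k m a -> D a = m%:R *: a.
Proof.
move=> Dpol; have [DM Dx Dy D0] := Dpol.
move=> m a; elim=> {m a} [i|i||m|m c a _ IH|m a b _ IHa _ IHb|m n a b _ IHa _ IHb].
- have [->|/D0[-> _]] := eqVneq i k; first by rewrite Dx scale1r.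
  by rewrite scale0r.
- have [->|/D0[_ ->]] := eqVneq i k; first by rewrite Dy scale1r.
  by rewrite scale0r.
- by rewrite (pol1 Dpol) scale0r.
- by rewrite raddf0 scaler0.
- by rewrite linearZ /= IH !scalerA mulrC.
- by rewrite raddfD /= IHa IHb scalerDr.
- by rewrite DM IHa IHb -scalerAl -scalerAr -scalerDl natrD.
Qed.

Lemma ghomog_unique k (D : {linear A -> A}) m m' a : gpolarization x y k k D -> a != 0 ->
  ghomog k m a -> ghomog k m' a -> m = m'.
Proof.
move=> Dpol a0 am am'; have := euler_ghomog Dpol am'; rewrite (euler_ghomog Dpol am) => /eqP.
by rewrite -subr_eq0 -scalerBl scaler_eq0 (negPf a0) orbF subr_eq0 eqr_nat => /eqP.
Qed.

(** Each polarization lowers the degree by one, so the normalizing factors multiply to a falling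
    factorial. *)
Lemma iter_pol k l (P D : A -> A) (DL : {linear A -> A}) m a j : l != k ->
  D =1 DL -> gpolarization x y k l DL ->
  (forall m a, ghomog k m a -> P a = m%:R^-1 *: D a) -> ghomog k m a -> (j <= m)%N ->
  iter j P a = (m ^_ j)%:R^-1 *: iter j D a /\ ghomog k (m - j) (iter j D a).
Proof.
move=> lk DE Dpol PE am; elim: j => [|j IH] jm.
  by rewrite ffactn0 invr1 scale1r subn0.
have [IHa IHh] := IH (ltnW jm); rewrite !iterS IHa.
have [_ hD] := ghomog_pol Dpol lk IHh.
rewrite (PE _ _ (ghomogZ _ IHh)) !DE linearZ /= scalerA ffactnSr natrM invfM mulrC.
by split=> //; rewrite subnS.
Qed.
End Substitution.

(** * Substituting central elements in a homogenized polynomial *)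

Section HomogeneousSubstitution.
Context {A : nzRingType} (X Y : A).
Hypothesis Xc : forall a, X * a = a * X.
Hypothesis Yc : forall a, Y * a = a * Y.

Definition hom_eval m (p : {poly A}) : A := \sum_(k < m.+1) X ^+ (m - k) * Y ^+ k * p`_k.

Lemma hom_evalD m p q : hom_eval m (p + q) = hom_eval m p + hom_eval m q.
Proof.
by rewrite -big_split; apply: eq_bigr => k _; rewrite coefD mulrDr.
Qed.

Lemma hom_eval_mul m (p : {poly A}) a b : (size p <= m.+1)%N ->
  hom_eval m.+1 ((a%:P - b%:P * 'X) * p) = (X * a - Y * b) * hom_eval m p.
Proof.
move=> pm; rewrite /hom_eval mulrBl [RHS]mulrBl !mulr_sumr.
have XYc k l c : X ^+ k * Y ^+ l * c = c * (X ^+ k * Y ^+ l).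
  have cX : GRing.comm c X by rewrite /GRing.comm Xc.
  have cY : GRing.comm c Y by rewrite /GRing.comm Yc.
  by apply: esym; apply: commrM; apply: commrX.
have -> : \sum_(k < m.+2) X ^+ (m.+1 - k) * Y ^+ k * (a%:P * p - b%:P * 'X * p)`_k =
   \sum_(k < m.+2) X ^+ (m.+1 - k) * Y ^+ k * (a * p`_k)
   - \sum_(k < m.+2) X ^+ (m.+1 - k) * Y ^+ k * (b * (p * 'X)`_k).
  rewrite -sumrB; apply: eq_bigr => k _.
  by rewrite coefB coefCM -[b%:P * 'X * p]mulrA coefCM -commr_polyX mulrBr.
congr (_ - _).
  rewrite big_ord_recr /= (nth_default _ pm) !mulr0 addr0; apply: eq_bigr => k _.
  by rewrite subSn ?leq_ord // exprS -!mulrA; congr (_ * _); rewrite !mulrA XYc !mulrA.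
rewrite big_ord_recl /= coefMX /= !mulr0 add0r; apply: eq_bigr => k _.
rewrite coefMX /= subSS exprS.
have -> : X ^+ (m - k) * (Y * Y ^+ k) = Y * (X ^+ (m - k) * Y ^+ k).
  by rewrite mulrA -Yc !mulrA.
by rewrite -!mulrA; congr (_ * _); rewrite !mulrA XYc !mulrA.
Qed.

(** Keeps the degree bound together with the value, so that both are followed at once through sums
    and products by linear factors. *)
Definition hom_subst m (p : {poly A}) (q : A) := (size p <= m.+1)%N /\ hom_eval m p = q.

Lemma hom_subst0 c : hom_subst 0 c%:P c.
Proof.
by split; [exact: size_polyC_leq1|rewrite /hom_eval big_ord1 coefC /= !mul1r].
Qed.

Lemma hom_substM m p q a b : hom_subst m p q ->
  hom_subst m.+1 ((a%:P - b%:P * 'X) * p) ((X * a - Y * b) * q).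
Proof.
move=> [sp <-]; split; last exact: hom_eval_mul.
have s2 : (size (a%:P - b%:P * 'X)%R <= 2)%N.
  by apply/leq_sizeP => -[|[|j]] // _; rewrite coefB coefCM coefC coefX /= mulr0 subr0.
apply: leq_trans (size_polyMleq _ _) _.
by rewrite -subn1 leq_subLR; apply: leq_add s2 sp.
Qed.

Lemma hom_substXM m p q a b k : hom_subst m p q ->
  hom_subst (k + m) ((a%:P - b%:P * 'X) ^+ k * p) ((X * a - Y * b) ^+ k * q).
Proof.
by move=> mp; elim: k => [|k IH]; rewrite ?expr0 ?mul1r // !exprS -!mulrA; apply: hom_substM.
Qed.

Lemma hom_subst_sum m (J : finType) (p : J -> {poly A}) (q : J -> A) :
  (forall i, hom_subst m (p i) (q i)) -> hom_subst m (\sum_i p i) (\sum_i q i).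
Proof.
move=> pq; split.
  apply: leq_trans (size_sum _ _ _) _; apply/bigmax_leqP => i _; by case: (pq i).
have hs : hom_eval m (\sum_i p i) = \sum_i hom_eval m (p i).
  apply: (big_morph (hom_eval m)) => [u v|]; first exact: hom_evalD.
  by rewrite /hom_eval big1 // => k _; rewrite coef0 mulr0.
by rewrite hs; apply: eq_bigr => i _; case: (pq i).
Qed.
End HomogeneousSubstitution.

Section TypicalRepresentation.
Context {d : Order.disp_t} {K : numFieldType} {h : K} {I : orderType d}.
Context {A : algType K} {s : uh_action h A} {x y : I -> A}.
Hypothesis jA : jordanian s x y.
Local Notation E := (aE s).
Local Notation F := (aF s).
Local Notation H := (aH s).
Local Notation G := (aG s).
Local Notation G' := (aG' s).
Local Notation gspan := (gspan x y).
Local Notation ghomog := (ghomog x y).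
Local Notation lform := (linear_form_expr h).
Hypothesis dom : forall a b : A, a * b = 0 -> a = 0 \/ b = 0.
Hypothesis inv_fix : forall v, uh_invariant s v -> G v = v.
Context (i0 i1 : I).
Hypothesis i01 : i0 != i1.
Local Notation x0 := (x i0).
Local Notation y0 := (y i0).
Local Notation x1 := (x i1).
Local Notation y1 := (y i1).
Local Notation eta := (lform x0 y0 x1 y1).
Hypothesis eta_neq0 : eta != 0.
Hypothesis y0_neq0 : y0 != 0.
Local Notation J := [set~ i0]%classic.

Let jdd i : doublet s (x i) (y i). Proof. exact: jd_doublet. Qed.

Lemma jd_inv_central v : uh_invariant s v -> forall a, v * a = a * v.
Proof.
move=> iv a; have [Hv Gv] : H v = 0 /\ G v = v by split; [case: iv|apply: inv_fix].
have cv i := braided_comm (jd_braided jA i v) Gv Hv.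
apply: esym; apply: (alg_span_comm _ (jd_gen jA a)) => {}a [i _ ai].
by have [] := cv i; case: ai => ->.
Qed.

Let J1 : J i1. Proof. by move=> e; move: i01; rewrite e eqxx. Qed.

Lemma subst01 : exists phi : {lrmorphism A -> A},
  [/\ extends_action phi s s, phi x0 = x1, phi y0 = y1 & forall a, gspan J a -> phi a = a].
Proof.
have [i|phi [phiE ext]] := jd_substitution jA (X := fun i => if i == i0 then x1 else x i)
  (Y := fun i => if i == i0 then y1 else y i).
  by case: ifP => _; apply: jdd.
have [px py] := phiE i0; rewrite eqxx in px py; exists phi; split=> // a.
apply: gspan_fix => i /eqP/negPf Ji; by have := phiE i; rewrite Ji.
Qed.

(** Renaming 0 as 1 gives a second equation with the same coefficients. Eliminating [c] from the
    two, with (01) = y_1 x_0 - y_0 x_1, leaves eta b = 0. *)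
Lemma linear_form_coef b c : gspan J b -> gspan J c -> x0 * b + y0 * c = 0 -> b = 0 /\ c = 0.
Proof.
move=> Jb Jc e0; have [phi [_ px py fixJ]] := subst01.
have e1 : x1 * b + y1 * c = 0.
  by have := congr1 phi e0; rewrite rmorph0 rmorphD !rmorphM /= px py !fixJ.
have : eta * b = 0.
  have -> : eta * b = y1 * (x0 * b + y0 * c) - y0 * (x1 * b + y1 * c).
    by rewrite /linear_form_expr (jd_xy jA) !mulrDr !mulrA (jd_yy jA i1 i0); nc h.
  by rewrite e0 e1 !mulr0 subrr.
move/dom => [/eqP|b0]; first by rewrite (negPf eta_neq0).
split=> //; move: e0; rewrite b0 mulr0 add0r => /dom[/eqP|//].
by rewrite (negPf y0_neq0).
Qed.

Lemma doublet_subZ (t : K) p q p' q' : doublet s p q -> doublet s p' q' ->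
  doublet s (p - t *: p') (q - t *: q').
Proof.
move=> [[E1 F1 H1] [[E2 F2 H2] [G1 G2 G3 G4]]] [[E3 F3 H3] [[E4 F4 H4] [G5 G6 G7 G8]]].
have lin (T : {linear A -> A}) a b : T (a - t *: b) = T a - t *: T b by rewrite linearB linearZ.
rewrite /doublet !lin /= E1 F1 H1 E2 F2 H2 G1 G2 G3 G4 E3 F3 H3 E4 F4 H4 G5 G6 G7 G8.
rewrite !scaler0 subr0; split; [|split] => //; split=> //.
- by rewrite [t *: (_ + _)]scalerDr opprD addrACA.
- by rewrite [t *: (_ - _)]scalerDr opprD addrACA.
Qed.

(** Invariance of the form, compared at x_0 and y_0, is the doublet property of the pair. [G] is
    treated before [E] and [H], whose Leibniz rules involve [G' g] and [G' c]. *)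
Lemma linear_form_doublet g c : gspan J g -> gspan J c -> uh_invariant s (lform x0 y0 g c) ->
  doublet s g c.
Proof.
move=> Jg Jc ixi; have Gxi := inv_fix ixi; case: ixi => Exi Fxi Hxi.
have [Eg Fg Hg Gg G'g] := gspan_action jA Jg; have [Ec Fc Hc Gc G'c] := gspan_action jA Jc.
have [[E1 F1 H1] [[E2 F2 H2] [G1 G2 _ _]]] := jdd i0.
have JB a b : gspan J a -> gspan J b -> gspan J (a - b) by apply: alg_spanB.
have JD a b : gspan J a -> gspan J b -> gspan J (a + b) by apply: alg_spanD.
have JZ t a : gspan J a -> gspan J (t *: a) by apply: alg_spanZ.
have JN a : gspan J a -> gspan J (- a) by apply: alg_spanN.
move: Exi Fxi Hxi Gxi; rewrite /linear_form_expr.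
rewrite !raddfB /= !linearZ /= !aEM !aFM !aHM !rmorphM /= E1 F1 H1 E2 F2 H2 G1 G2.
move=> Exi Fxi Hxi Gxi.
have [Gc0 Gg0] : G c - c = 0 /\ - (G g) + g + h *: c = 0.
  apply: linear_form_coef; [by apply: (JB)|by do ![apply: (JD)|apply: (JN)|apply: (JZ)]|].
  rewrite -[RHS](subrr (x0 * c - y0 * g + h *: - (y0 * c))) -{1}Gxi. nc h.
have GcE : G c = c by apply/eqP; rewrite -subr_eq0 Gc0.
have GgE : G g = g + h *: c.
  by apply: (addrI (- G g)); rewrite addNr addrA Gg0.
have G'cE : G' c = c by rewrite -{1}GcE aGK.
have G'gE : G' g = g - h *: c.
  have -> : g = G g - h *: G c by rewrite GgE GcE addrK.
  by rewrite raddfB /= linearZ /= !aGK GgE GcE addrK.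
rewrite G'cE G'gE in Exi Fxi Hxi.
have [Fc0 Fg0] : F c = 0 /\ c - F g - h *: F c = 0.
  apply: linear_form_coef => //; first by do ![apply: (JB)|apply: (JZ)].
  by rewrite -[RHS]Fxi; nc h.
have FgE : F g = c by apply/esym/eqP; rewrite -subr_eq0 -[X in _ == X]Fg0 Fc0 scaler0 subr0.
have [Hc0 Hg0] : c + H c = 0 /\ g - H g = 0.
  apply: linear_form_coef; [by apply: (JD)|by apply: (JB)|].
  by rewrite -[RHS]Hxi; nc h.
have [Ec0 Eg0] : E c - g = 0 /\ - E g = 0.
  apply: linear_form_coef; [by apply: (JB)|by apply: (JN)|].
  by rewrite -[RHS]Exi; nc h.
split; [split|split; split] => //.
- by apply/eqP; rewrite -oppr_eq0 Eg0.
- by apply/esym/eqP; rewrite -subr_eq0 Hg0.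
- by apply/eqP; rewrite -subr_eq0 Ec0.
- by apply/eqP; rewrite -addr_eq0 addrC Hc0.
Qed.

(** Each term of [D a] contains exactly one letter of index 0, which [gspan_mul_xy] moves to the
    front. *)
Lemma pol_linear (D : {linear A -> A}) a : gpolarization x y i1 i0 D -> gspan J a ->
  exists b c, [/\ gspan J b, gspan J c & D a = x0 * b + y0 * c].
Proof.
move=> Dpol; have [DM Dx Dy D0] := Dpol.
have z : exists b c, [/\ gspan J b, gspan J c & 0 = x0 * b + y0 * c].
  by exists 0, 0; rewrite !mulr0 addr0; split=> //; apply: alg_span0.
elim=> {a} [a [i Ji ai]||t a _ [b [c [Jb Jc Da]]]|a b _ [b1 [c1 [Jb1 Jc1 Da]]] _ [b2 [c2 [Jb2 Jc2 Db]]]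
  |a b Ja [b1 [c1 [Jb1 Jc1 Da]]] Jb [b2 [c2 [Jb2 Jc2 Db]]]].
- have [ii1|/D0[Dxi Dyi]] := eqVneq i i1; last by case: ai => ->; rewrite ?Dxi ?Dyi.
  case: ai => ->; rewrite ii1 ?Dx ?Dy.
    by exists 1, 0; rewrite mulr1 mulr0 addr0; split=> //; [apply: alg_span1|apply: alg_span0].
  by exists 0, 1; rewrite mulr1 mulr0 add0r; split=> //; [apply: alg_span0|apply: alg_span1].
- by rewrite (pol1 Dpol).
- exists (t *: b), (t *: c); split; try exact: alg_spanZ.
  by rewrite linearZ /= Da scalerDr !scalerAr.
- exists (b1 + b2), (c1 + c2); split; try exact: alg_spanD.
  by rewrite raddfD /= Da Db !mulrDr addrACA.
- have [b' [c' [Jb' Jc' ax ay]]] := gspan_mul_xy jA i0 Ja.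
  have [_ _ _ JG _] := gspan_action jA Ja.
  exists (b1 * b + b' * b2), (c1 * b - c' * b2 + G a * c2); split.
  + by apply: alg_spanD; apply: alg_spanM.
  + by apply: alg_spanD; [apply: alg_spanB|]; apply: alg_spanM.
  + have -> : D (a * b) = (x0 * b1 + y0 * c1) * b + (a * x0 * b2 + a * y0 * c2).
      by rewrite DM Da Db mulrDr !mulrA.
    by rewrite ax ay; nc h.
Qed.

(** Sending 1 to 0 by [D] and renaming 0 back as 1 amounts to Euler's derivation [D']. Applied to
    [f1] this shows that [xi] becomes [f1] when 0 is renamed as 1. *)
Lemma pol_subst (phi : {lrmorphism A -> A}) (D D' : {linear A -> A}) :
  gpolarization x y i1 i0 D -> gpolarization x y i1 i1 D' ->
  phi x0 = x1 -> phi y0 = y1 -> (forall a, gspan J a -> phi a = a) ->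
  forall a, gspan J a -> phi (D a) = D' a.
Proof.
move=> Dpol Dpol' px py fixJ; have [DM Dx Dy D0] := Dpol; have [DM' Dx' Dy' D0'] := Dpol'.
move=> a; elim=> {a} [a [i Ji ai]||t a _ IH|a b _ IHa _ IHb|a b Ja IHa Jb IHb].
- have [ii1|ii1] := eqVneq i i1; last first.
    have [[e1 e2] [e3 e4]] := (D0 i ii1, D0' i ii1).
    by case: ai => ->; rewrite ?e1 ?e2 ?e3 ?e4 raddf0.
  by case: ai => ->; rewrite ii1 ?Dx ?Dy ?Dx' ?Dy'.
- by rewrite (pol1 Dpol) (pol1 Dpol') raddf0.
- by rewrite !linearZ /= IH.
- by rewrite !raddfD /= IHa IHb.
- by rewrite DM DM' raddfD /= !rmorphM /= IHa IHb !fixJ.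
Qed.

Context (n : nat) (a : 'I_n.+1 -> A) (f : A).
Hypothesis n_gt0 : (0 < n)%N.
Local Notation J01 := (~` [set i0; i1])%classic.
Hypothesis a_J : forall i, gspan J01 (a i).
Hypothesis f_neq0 : f != 0.
Hypothesis f_inv : uh_invariant s f.
Hypothesis fE : f = \sum_(i < n.+1) x0 ^+ (n - i) * y0 ^+ i * a i.

Let f1 := \sum_(i < n.+1) x1 ^+ (n - i) * y1 ^+ i * a i.

Let i10 : i1 != i0. Proof. by rewrite eq_sym. Qed.

Let J01_J i : J01 i -> J i. Proof. by move=> Ji e; apply: Ji; left. Qed.

Lemma ghomog_gspan (J' : set I) k b : ~ J' k -> gspan J' b -> ghomog k 0 b.
Proof.
move=> Jk; elim=> {b} [b [i Ji bi]||t b _ IH|b c _ IHb _ IHc|b c _ IHb _ IHc].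
- have ik : (i == k) = 0%N :> nat.
    by case: eqP => // ik; case: Jk; rewrite -ik.
  by case: bi => ->; rewrite -ik; [apply: ghomog_x|apply: ghomog_y].
- exact: ghomog1.
- exact: ghomogZ.
- exact: ghomogD.
- exact: (ghomogM (m := 0) (n := 0)).
Qed.

Lemma ghomog_form k (b : 'I_n.+1 -> A) : (forall i, ghomog k 0 (b i)) ->
  ghomog k n (\sum_(i < n.+1) x k ^+ (n - i) * y k ^+ i * b i).
Proof.
move=> hb; elim/big_ind: _ => [|u v|i _]; [exact: ghomog0|exact: ghomogD|].
have hx m : ghomog k m (x k ^+ m).
  elim: m => [|m IH]; first exact: ghomog1.
  by rewrite exprS -add1n; apply: ghomogM => //; have := ghomog_x x y k k; rewrite eqxx.
have hy m : ghomog k m (y k ^+ m).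
  elim: m => [|m IH]; first exact: ghomog1.
  by rewrite exprS -add1n; apply: ghomogM => //; have := ghomog_y x y k k; rewrite eqxx.
have := ghomogM (ghomogM (hx (n - i)%N) (hy i)) (hb i).
by rewrite addn0 subnK // -ltnS.
Qed.

Lemma iter_pol_form (D : {linear A -> A}) : gpolarization x y i0 i1 D ->
  iter n D f = n`!%:R *: f1.
Proof.
move=> Dpol; have [DM Dx Dy D0] := Dpol; have [Dx1 Dy1] := D0 i1 i10.
have top m b c p p' : D p = p' -> D p' = 0 -> forall k,
    der_top D m b c -> der_top D (k + m) (p ^+ k * b) (p' ^+ k * c).
  move=> Dp Dp'; elim=> [|k IH] t; first by rewrite !expr0 !mul1r.
  by rewrite addSn !exprS -!mulrA; apply: der_topM => //; apply: IH.
have term (i : 'I_n.+1) : iter n D (x0 ^+ (n - i) * y0 ^+ i * a i) =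
    n`!%:R *: (x1 ^+ (n - i) * y1 ^+ i * a i).
  have Da : D (a i) = 0 by apply: (pol_gspan Dpol _ (a_J i)) => Ji; apply: Ji; left.
  have := der_topMr DM Da (top _ _ _ _ _ Dx Dx1 (n - i)%N
    (top _ _ _ _ _ Dy Dy1 i (der_top1 DM))).
  by rewrite !mulr1 addn0 subnK -1?ltnS // => -[].
have iterD u v m : iter m D (u + v) = iter m D u + iter m D v.
  by elim: m => // m IH; rewrite !iterS IH raddfD.
have iter0 m : iter m D 0 = 0 by elim: m => // m IH; rewrite iterS IH raddf0.
rewrite fE (big_morph (iter n D) (fun u v => iterD u v n) (iter0 n)) scaler_sumr.
by apply: eq_bigr => i _; apply: term.
Qed.

Lemma iter_polarization_form (P : A -> A) (D : {linear A -> A}) :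
  gpolarization x y i0 i1 D -> (forall m b, ghomog i0 m b -> P b = m%:R^-1 *: D b) ->
  iter n P f = f1.
Proof.
move=> Dpol PE; have hf : ghomog i0 n f.
  by rewrite fE; apply: ghomog_form => i; apply: ghomog_gspan (a_J i) => Ji; apply: Ji; left.
have [-> _] := iter_pol i10 (fun=> erefl) Dpol PE hf (leqnn n).
rewrite iter_pol_form // ffactnn scalerA mulVf ?scale1r //.
by rewrite pnatr_eq0 -lt0n fact_gt0.
Qed.

(** The two indices are exchanged, instead of 0 being renamed as 1. Since the coefficients avoid
    both, the exchange applied twice returns [f], whence its image [f1] is nonzero. *)
Lemma pol_form_swap : f1 != 0 /\ uh_invariant s f1.
Proof.
have [i|psi [psiE ext]] := jd_substitution jA
  (X := fun i => if i == i0 then x1 else if i == i1 then x0 else x i)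
  (Y := fun i => if i == i0 then y1 else if i == i1 then y0 else y i).
  by case: ifP => _; [|case: ifP => _]; apply: jdd.
have [[px0 py0] [px1 py1]] := (psiE i0, psiE i1).
rewrite !eqxx (negPf i10) in px0 py0 px1 py1.
have fix_a i : psi (a i) = a i.
  apply: gspan_fix (a_J i) => k Jk; have [-> ->] := psiE k.
  case: eqP => [kE|_]; first by case: Jk; left.
  by case: eqP => [kE|_]; first by case: Jk; right.
have f1E : f1 = psi f.
  rewrite fE rmorph_sum; apply: eq_bigr => i _.
  by rewrite !rmorphM !rmorphXn /= px0 py0 fix_a.
have psiK : psi (psi f) = f.
  rewrite -f1E rmorph_sum [RHS]fE; apply: eq_bigr => i _.
  by rewrite !rmorphM !rmorphXn /= px1 py1 fix_a.
rewrite f1E; split; last exact: extends_invariant ext f_inv.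
by apply: contra_neq f_neq0 => psif0; rewrite -psiK psif0 rmorph0.
Qed.

Context (D10 D11 : {linear A -> A}).
Hypothesis D10_pol : gpolarization x y i1 i0 D10.
Hypothesis D11_pol : gpolarization x y i1 i1 D11.

Let xi := n%:R^-1 *: D10 f1.

Lemma form_swap_HJ : gspan J f1.
Proof.
apply: alg_span_sum => i _; apply: alg_spanM; last exact: gspan_sub J01_J (a_J i).
by apply: alg_spanM; apply: alg_spanX; [apply: (gspan_x J1)|apply: (gspan_y J1)].
Qed.

Lemma ghomog_form_swap : ghomog i1 n f1.
Proof. by apply: ghomog_form => i; apply: ghomog_gspan (a_J i) => Ji; apply: Ji; right. Qed.

Lemma xi_invariant : uh_invariant s xi.
Proof. by apply: invariantZ; apply: (pol_invariant jA D10_pol); case: pol_form_swap. Qed.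

Lemma gspan_poly (p q : {poly A}) : (forall k, gspan J p`_k) -> (forall k, gspan J q`_k) ->
  forall k, gspan J (p * q)`_k.
Proof.
move=> Jp Jq k; rewrite coefM; apply: alg_span_sum => i _.
by apply: alg_spanM; [apply: Jp|apply: Jq].
Qed.

Lemma typical_representation : exists g c,
  [/\ gspan J g, gspan J c, xi = lform x0 y0 g c
    & exists u : 'I_n.+1 -> A,
      [/\ forall i, gspan J (u i) /\ uh_invariant s (u i), u ord0 = f1
        & f1 ^+ n * f = \sum_(i < n.+1) xi ^+ (n - i) * eta ^+ i * u i]].
Proof.
have [f1_neq0 f1_inv] := pol_form_swap.
have [b [b' [Jb Jb' D10f1]]] := pol_linear D10_pol form_swap_HJ.
(* A form x A + y B is written with Y = A and X = - B - h A; here A and B are the coefficients of D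
   f1 divided by [n]. *)
pose c := n%:R^-1 *: b; pose g := - (n%:R^-1 *: b') - h *: c.
have Jc : gspan J c by apply: alg_spanZ.
have Jg : gspan J g.
  by apply: alg_spanB; [apply/alg_spanN/alg_spanZ|apply: alg_spanZ].
have xiE : xi = lform x0 y0 g c.
  rewrite /xi D10f1 scalerDr !scalerAr -/c /g; move: (_ *: b') => v.
  by rewrite /linear_form_expr; nc h.
clearbody g c; have dgc : doublet s g c by apply: linear_form_doublet; rewrite -?xiE //; apply: xi_invariant.
have f1E : f1 = lform x1 y1 g c.
  have [phi [_ px py fixJ]] := subst01.
  have := pol_subst D10_pol D11_pol px py fixJ form_swap_HJ.
  rewrite (euler_ghomog D11_pol ghomog_form_swap) => e.
  have n0 : (n%:R : K) != 0 by rewrite pnatr_eq0 -lt0n.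
  have : phi xi = f1 by rewrite /xi linearZ /= e scalerA mulVf // scale1r.
  move=> <-; rewrite xiE /linear_form_expr !raddfB /= linearZ /= !rmorphM /= px py.
  by rewrite !fixJ.
have eta_inv : uh_invariant s eta by apply: bracket_invariant; apply: jdd.
have xic := jd_inv_central xi_invariant; have etac := jd_inv_central eta_inv.
have f1c := jd_inv_central f1_inv.
have [yc xc yg xg] := proj1 (braided_doublets x1 y1 dgc)
  (conj (jd_braided jA i1 g) (jd_braided jA i1 c)).
have f1x : f1 * x0 = xi * x1 - eta * g.
  rewrite f1c f1E xiE /linear_form_expr !mulrBl !mulrBr -?scalerAl -?scalerAr -!mulrA.
  by rewrite xc yg yc xg; nc h.
have f1y : f1 * y0 = xi * y1 - eta * c.
  rewrite f1c f1E xiE /linear_form_expr !mulrBl !mulrBr -?scalerAl -?scalerAr -!mulrA.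
  by rewrite xc yg yc; nc h.
(* For a scalar t, U(t) is the image of f under the equivariant substitution
   x0 -> x1 - t g, y0 -> y1 - t c; hence it is invariant, and so are the
   coefficients of U.  Homogenized, U has the value f1^n f at (xi, eta). *)
pose U : {poly A} := \sum_(i < n.+1) (x1%:P - g%:P * 'X) ^+ (n - i) *
  ((y1%:P - c%:P * 'X) ^+ i * (a i)%:P).
have Usub X Y : (forall v, X * v = v * X) -> (forall v, Y * v = v * Y) ->
    hom_subst X Y n U
      (\sum_(i < n.+1) (X * x1 - Y * g) ^+ (n - i) * ((X * y1 - Y * c) ^+ i * a i)).
  move=> Xc Yc; apply: hom_subst_sum => i.
  have := hom_substXM Xc Yc x1 g (n - i) (hom_substXM Xc Yc y1 c i (hom_subst0 X Y (a i))).
  by rewrite addn0 subnK // -ltnS.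
have c1 (v : A) : 1 * v = v * 1 by rewrite mul1r mulr1.
have cZ (t : K) (v : A) : t%:A * v = v * t%:A by rewrite mulr_algl mulr_algr.
have Uinv (t : K) : uh_invariant s (\sum_(k < n.+1) t ^+ k *: U`_k).
  have [_ e] := Usub 1 t%:A c1 (cZ t); rewrite /hom_eval in e.
  have -> : \sum_(k < n.+1) t ^+ k *: U`_k =
      \sum_(k < n.+1) 1 ^+ (n - k) * t%:A ^+ k * U`_k.
    by apply: eq_bigr => k _; rewrite expr1n mul1r exprZn expr1n -scalerAl mul1r.
  rewrite e.
  have [i|phi [phiE ext]] := jd_substitution jA
    (X := fun i => if i == i0 then x1 - t *: g else x i)
    (Y := fun i => if i == i0 then y1 - t *: c else y i).
    case: ifP => _; last exact: jdd.
    exact: doublet_subZ.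
  have [px py] := phiE i0; rewrite eqxx in px py.
  have -> : \sum_(i < n.+1) (1 * x1 - t%:A * g) ^+ (n - i) * ((1 * y1 - t%:A * c) ^+ i * a i) = phi f.
    rewrite fE rmorph_sum; apply: eq_bigr => i _.
    rewrite !rmorphM !rmorphXn /= px py !mul1r -!scalerAl !mul1r -mulrA.
    congr (_ * (_ * _)); apply: esym; apply: gspan_fix (a_J i) => k Jk.
    by have := phiE k; case: eqP => // kE; case: Jk; left.
  exact: extends_invariant ext f_inv.
exists g, c; split=> //; exists (fun i => U`_i); split.
- move=> i; split.
    have JC v : gspan J v -> forall k, gspan J v%:P`_k.
      by move=> Jv k; rewrite coefC; case: eqP => _ //; apply: alg_span0.
    have Jlin v w : gspan J v -> gspan J w -> forall k, gspan J (v%:P - w%:P * 'X)`_k.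
      move=> Jv Jw k; rewrite coefB coefMX; apply: alg_spanB; first exact: JC.
      by case: eqP => _; [apply: alg_span0|apply: JC].
    have JX (p : {poly A}) m : (forall k, gspan J p`_k) -> forall k, gspan J (p ^+ m)`_k.
      move=> Jp; elim: m => [|m IH]; first by apply: (JC 1); apply: alg_span1.
      by rewrite exprS; apply: gspan_poly.
    rewrite coef_sum; apply: alg_span_sum => k _.
    apply: gspan_poly; first by apply/JX/Jlin => //; apply: gspan_x.
    apply: gspan_poly; first by apply/JX/Jlin => //; apply: gspan_y.
    by apply: JC; apply: gspan_sub J01_J (a_J k).
  (* The sum is invariant for every scalar [t], and a polynomial in [t] that vanishes identically
     has zero coefficients. *)
  have T0 (T : {linear A -> A}) : (forall v, uh_invariant s v -> T v = 0) -> T U`_i = 0.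
    move=> Tv; apply: (scalar_poly_zero (v := fun k => T U`_k)) (ltn_ord i) => t.
    rewrite -[RHS](Tv _ (Uinv t)) raddf_sum; apply: eq_bigr => k _.
    exact: esym (linearZ_LR T _ _).
  by split; [apply: (T0 E)|apply: (T0 F)|apply: (T0 H)] => v [].
(* Evaluating at (1, 0) isolates the constant coefficient of [U], where x_1 and y_1 are substituted
   in [f]. *)
- have c0 (v : A) : 0 * v = v * 0 by rewrite mul0r mulr0.
  have [_] := Usub 1 0 c1 c0; rewrite /hom_eval big_ord_recl big1 ?addr0.
    by rewrite expr1n expr0 !mul1r => ->; apply: eq_bigr => i _; rewrite !mul0r !subr0 mulrA.
  by move=> k _; rewrite exprS mul0r mulr0 mul0r.
- have [_] := Usub xi eta xic etac; rewrite /hom_eval => ->.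
  rewrite fE mulr_sumr; apply: eq_bigr => i _; rewrite -f1x -f1y.
  have fX v k : (f1 * v) ^+ k = f1 ^+ k * v ^+ k by apply: exprMn_comm; apply: f1c.
  rewrite !fX; have -> : f1 ^+ n = f1 ^+ (n - i) * f1 ^+ i by rewrite -exprD subnK ?leq_ord.
  have fXc k v : f1 ^+ k * v = v * f1 ^+ k.
    by apply/commr_sym/commrX; rewrite /GRing.comm f1c.
  by rewrite -!mulrA; congr (_ * _); rewrite !mulrA fXc.
Qed.

(** [f1] and [xi] enter through equations, so that the iterated polarizations can be put in their
    place. *)
Lemma typical_representation_data (g1 g' : A) : g1 = f1 -> g' = n%:R^-1 *: D10 g1 ->
  [/\ g1 != 0, uh_invariant s g1, gspan J g1, uh_invariant s g' & exists g c,
  [/\ gspan J g, gspan J c, g' = lform x0 y0 g c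
    & exists u : 'I_n.+1 -> A,
      [/\ forall i, gspan J (u i) /\ uh_invariant s (u i), u ord0 = g1
        & g1 ^+ n * f = \sum_(i < n.+1) g' ^+ (n - i) * eta ^+ i * u i]]].
Proof.
move=> -> ->; have [f1_neq0 f1_inv] := pol_form_swap.
by split=> //; [apply: form_swap_HJ|apply: xi_invariant|apply: typical_representation].
Qed.
End TypicalRepresentation.

(** * Splitting and factorization *)

Lemma prod_XsubC_root (R : nzRingType) (r : seq R) a : (forall b, a * b = b * a) ->
  a \in r -> (\prod_(z <- r) ('X - z%:P)).[a] = 0.
Proof.
move=> ac; elim: r => // z r IH; rewrite inE big_cons => ar.
rewrite hornerM_comm; last exact: ac.
have [->|az] := eqVneq a z; first by rewrite hornerXsubC subrr mul0r.
by rewrite IH ?mulr0 //; move: ar; rewrite (negPf az).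
Qed.

Lemma prod_commuting0 (R : nzRingType) (J : eqType) (r : seq J) (L : J -> R) i :
  i \in r -> L i = 0 -> \prod_(k <- r) L k = 0.
Proof.
move=> ir Li; elim: r ir => // k r IH; rewrite inE big_cons => /orP[/eqP <-|/IH ->].
  by rewrite Li mul0r.
by rewrite mulr0.
Qed.

Lemma map_prod_XsubC (R S : nzRingType) (f : {rmorphism R -> S}) (r : seq R) :
  map_poly f (\prod_(z <- r) ('X - z%:P)) = \prod_(z <- map f r) ('X - z%:P).
Proof.
elim: r => [|z r IH]; first by rewrite !big_nil rmorph1.
by rewrite !big_cons rmorphM rmorphB /= map_polyX map_polyC; congr (_ * _).
Qed.

Section SplittingData.
Context {K : numFieldType} {h : K} {Q : unitAlgType K} {s : uh_action h Q}.
Hypothesis h_neq0 : h != 0.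
Hypothesis Qg : good s.
Variable k : Q -> Prop.
Hypothesis kA : forall c : K, k (c *: 1).
Hypothesis kB : forall a b, k a -> k b -> k (a - b).
Hypothesis kM : forall a b, k a -> k b -> k (a * b).
Hypothesis kV : forall a, k a -> k a^-1.
Hypothesis kI : forall a, k a -> uh_invariant s a.
Context (n : nat) (c : 'I_n.+1 -> Q).
Hypothesis ck : forall i, k (c i).
Hypothesis c0 : c ord0 != 0.

Lemma splitting_data : exists (D : unitAlgType K) (t : uh_action h D)
    (g : {lrmorphism Q -> D}) (S : fieldType) (emb : {rmorphism S -> D})
    (cc : 'I_n.+1 -> S) (sig : 'I_n -> S),
  [/\ good t, extends_action g s t, forall i, uh_invariant t (emb (sig i)),
      forall q, k q -> exists c, emb c = g q & forall i, emb (cc i) = g (c i)] /\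
  [/\ \sum_(i < n.+1) 'X ^+ (n - i) * 'X%:P ^+ i * (cc i)%:P%:P
      = (cc ord0)%:P%:P
        * \prod_(i < n) ('X - (sig i)%:P%:P * 'X%:P) :> {poly {poly S}},
      forall c, alg_span
        [set z | (exists2 q, k q & z = g q) \/ exists i, z = emb (sig i)]%classic (emb c)
    & forall z, alg_span
        [set z | (exists q, z = g q) \/ exists i, z = emb (sig i)]%classic z].
Proof.
(* The form dehomogenized at eta = 1 and made monic: [c i] belongs to xi^(n-i), so the coefficients
   appear in reverse order. *)
pose p := \poly_(j < n.+1) ((c ord0)^-1 * c (inord (n - j))).
have pE (j : 'I_n.+1) : p`_(n - j) = (c ord0)^-1 * c j.
  by rewrite coef_poly ltnS leq_subr subKn ?leq_ord // inord_val.
have pn : p`_n = 1.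
  by have := pE ord0; rewrite subn0 mulVr // (good_div Qg).
have sp : size p = n.+1.
  have e0 : inord 0 = ord0 :> 'I_n.+1 by apply/val_inj; rewrite /= inordK.
  by rewrite size_poly_eq //= subnn e0 mulVr ?oner_neq0 // (good_div Qg).
have pm : p \is monic by rewrite monicE lead_coefE sp pn.
have kp i : k p`_i.
  rewrite coef_poly; case: ifP => _; first exact/kM/ck/kV/ck.
  by rewrite -(scale0r 1).
have [D [t [g [r [Dg ext ir gen [sr pr]]]]]] :=
  split_invariant_poly h_neq0 Qg pm sp (fun i => kI (kp i)).
pose kD z := exists2 q, k q & z = g q.
have kDA (a : K) : kD (a *: 1) by exists (a *: 1); rewrite // linearZ /= rmorph1.
have kDB a b : kD a -> kD b -> kD (a - b).
  by move=> [q kq ->] [q' kq' ->]; exists (q - q'); rewrite ?rmorphB //; apply: (kB).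
have kDM a b : kD a -> kD b -> kD (a * b).
  by move=> [q kq ->] [q' kq' ->]; exists (q * q'); rewrite ?rmorphM //; apply: (kM).
have kDV a : kD a -> kD a^-1.
  move=> [q kq ->]; exists q^-1; first exact: (kV).
  have [->|q0] := eqVneq q 0; first by rewrite rmorph0 !invr0 rmorph0.
  by rewrite rmorphV // (good_div Qg).
have kDI a : kD a -> uh_invariant t a.
  by move=> [q kq ->]; apply: extends_invariant ext (kI kq).
have rk a : a \in r -> exists P : {poly D}, [/\ P \is monic, forall i, kD P`_i & P.[a] = 0].
  move=> ar; exists (map_poly g p); split; first exact: monic_map.
    by move=> i; rewrite coef_map; exists p`_i.
  by rewrite pr prod_XsubC_root // => b; apply: (inv_central h_neq0 Dg (ir _ ar)).
pose Sf := span_subfield h_neq0 Dg kDA kDB kDM kDV kDI ir rk.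
pose emb : {rmorphism csf Sf -> D} := (val : csf Sf -> D).
have [rS rSE] : exists rS : seq (csf Sf), map emb rS = r.
  have : forall z, z \in r -> csf_set Sf z by move=> z zr; apply: alg_span_gen; right.
  elim: (r) => [|z r' IH] Sr; first by exists [::].
  have [|rS rSE] := IH; first by move=> w wr; apply: Sr; rewrite inE wr orbT.
  have [|e ez] := @csf_lift _ Sf z; first by apply: Sr; rewrite mem_head.
  by exists (e :: rS); rewrite /= rSE -ez.
have srS : size rS = n by rewrite -sr -rSE size_map.
have lift q : k q -> exists c, emb c = g q.
  by move=> kq; apply: csf_lift; apply: alg_span_gen; left; exists q.
have [cc ccE] := choice (fun i => lift _ (ck i)).
pose pS : {poly csf Sf} := \prod_(z <- rS) ('X - z%:P).
have pSE j : emb pS`_j = g p`_j.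
  have -> : emb pS`_j = (map_poly emb pS)`_j by rewrite (coef_map emb).
  rewrite -[RHS](coef_map g) pr -rSE; congr (_`_ _).
  by rewrite -(map_prod_XsubC emb).
have ccS (i : 'I_n.+1) : cc i = cc ord0 * pS`_(n - i).
  apply/val_inj; rewrite -[LHS]/(emb (cc i)) -[RHS]/(emb (cc ord0) * emb pS`_(n - i)).
  by rewrite pSE pE !ccE -rmorphM mulVKr // (good_div Qg).
exists D, t, g, (csf Sf), emb, cc, (fun i => nth 0 rS i).
have memr (i : 'I_n) : emb (nth 0 rS i) \in r by rewrite -rSE map_f // mem_nth ?srS.
have rmem z : z \in r -> exists i : 'I_n, z = emb (nth 0 rS i).
  rewrite -rSE => /mapP[e eS ->]; have ie : (index e rS < n)%N by rewrite -srS index_mem.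
  by exists (Ordinal ie); rewrite nth_index.
split; split=> //.
- by move=> i; apply: (ir).
- have -> : \prod_(i < n) ('X - (nth 0 rS i)%:P%:P * 'X%:P) =
    homogenize n pS :> {poly {poly csf Sf}}.
    have := homogenize_prod rS; rewrite srS -/pS => ->.
    by rewrite (big_nth 0) srS big_mkord.
  rewrite /homogenize (reindex_inj rev_ord_inj) mulr_sumr; apply: eq_bigr => i _ /=.
  rewrite subSS ccS subKn ?leq_ord // !polyCM.
  by rewrite mulrC -!mulrA; congr (_ * (_ * _)); rewrite mulrC.
- move=> e; apply: (alg_span_trans (csfP e)) => z [[q kq ->]|/rmem[i ->]].
    by apply: alg_span_gen; left; exists q.
  by apply: alg_span_gen; right; exists i.
- move=> z; apply: (alg_span_trans (gen z)) => w [[q ->]|/rmem[i ->]].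
    by apply: alg_span_gen; left; exists q.
  by apply: alg_span_gen; right; exists i.
Qed.
End SplittingData.

Lemma polarization_degree {d : Order.disp_t} {K : numFieldType} {I : orderType d}
    {A : algType K} {x y : I -> A} k l (D Dk : {linear A -> A}) m a :
  gpolarization x y k k Dk -> gpolarization x y k l D -> ghomog x y k m a ->
  (xget 0%N [set m | ghomog x y k m a]%classic)%:R^-1 *: D a = m%:R^-1 *: D a.
Proof.
(* Zero has every degree, so [xget] may pick any of them, but then both sides vanish. *)
move=> Dkp Dp hm; have [->|a0] := eqVneq a 0; first by rewrite raddf0 !scaler0.
congr (_%:R^-1 *: _); case: xgetP => [m' _ hm'|/(_ m)//].
exact: (ghomog_unique Dkp a0 hm' hm).
Qed.

(** * Fractions and invariant fractions *)

Section Fractions.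
Context {d : Order.disp_t} {K : numFieldType} {h : K} {I : orderType d}.
Context {A : algType K} {sA : uh_action h A} {x y : I -> A}.
Hypothesis h_neq0 : h != 0.
Hypothesis jA : jordanian sA x y.
Context {Q : unitAlgType K} {iota : {lrmorphism A -> Q}} {sQ : uh_action h Q}.
Hypothesis Qdiv : division_ring Q.
Hypothesis iota_inj : injective iota.
Hypothesis frac : forall q, exists a b, b != 0 /\ q = iota a / iota b.
Hypothesis ext : extends_action iota sA sQ.
Context (i0 : I).
Hypothesis y0_neq0 : y i0 != 0.
Implicit Types (a b : A).

Lemma iota_neq0 a : a != 0 -> iota a != 0.
Proof. by move=> a0; rewrite -(rmorph0 iota) (inj_eq iota_inj). Qed.

Lemma rmorph_solve m a b c : a != 0 -> a ^+ m * c = b -> iota c = iota a ^- m * iota b.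
Proof.
by move=> a0 <-; rewrite rmorphM rmorphXn /= mulKr //; apply/unitrX/Qdiv/iota_neq0.
Qed.

Lemma fractions_domain a b : a * b = 0 -> a = 0 \/ b = 0.
Proof.
have [->|a0] := eqVneq a 0; first by left.
have [->|b0] := eqVneq b 0; first by right.
move=> ab; have /eqP[] := dr_mulf_neq0 Qdiv (iota_neq0 a0) (iota_neq0 b0).
by rewrite -rmorphM ab rmorph0.
Qed.

Lemma extends_doublet p q : doublet sA p q -> doublet sQ (iota p) (iota q).
Proof.
move=> [[E1 F1 H1] [[E2 F2 H2] [G1 G2 G3 G4]]].
have [e1 f1 h1 g1 g1'] := ext p; have [e2 f2 h2 g2 g2'] := ext q.
rewrite /doublet e1 f1 h1 g1 g1' e2 f2 h2 g2 g2' E1 F1 H1 E2 F2 H2 G1 G2 G3 G4.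
by rewrite raddf0 raddfN raddfD raddfB /= linearZ.
Qed.

Lemma extends_braided p q a : braided sA p q a -> braided sQ (iota p) (iota q) (iota a).
Proof.
have [_ _ Ha Ga G'a] := ext a; move=> [qa pa]; split.
  by rewrite G'a -!rmorphM qa.
rewrite uhSE Ha Ga G'a -rmorphM pa uhSE rmorphD !rmorphM /=; congr (_ + _ * _).
by rewrite raddfB /= !linearZ /= raddfB.
Qed.

Lemma fractions_good : good sQ.
Proof.
apply: (@gens_good _ h Q sQ h_neq0 Qdiv I (iota \o x) (iota \o y) i0).
- by move=> i; apply: extends_doublet (jd_doublet jA i).
- by move=> i j; split; apply/extends_braided/(jd_braided jA).
- move=> q; have [a [b [b0 ->]]] := frac q; exists (iota a), (iota b).
  have im c : alg_span [set q | exists i, q = (iota \o x) i \/ q = (iota \o y) i]%classic (iota c).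
    apply: alg_span_image (jd_gen jA c) => e [i _ [->|->]]; apply: alg_span_gen;
      exists i; auto.
  by split=> //; apply: iota_neq0.
- exact: iota_neq0.
Qed.

Lemma subring_inv_fix v : uh_invariant sA v -> aG sA v = v.
Proof.
move=> /(extends_invariant ext)/(inv_fixG h_neq0 fractions_good) e.
by apply: iota_inj; have [_ _ _ <- _] := ext v.
Qed.

Variable P : set A.
Hypothesis P1 : P 1.
Hypothesis PB : forall a b, P a -> P b -> P (a - b).
Hypothesis PM : forall a b, P a -> P b -> P (a * b).
Hypothesis PZ : forall c a, P a -> P (c *: a).

(** [QJinv] with an arbitrary algebra [P] of numerators and denominators in place of [HJ J]. *)
Definition invariant_fraction q :=
  (exists a b, [/\ P a, P b, b != 0 & q = iota a / iota b]) /\ uh_invariant sQ q.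

Lemma fraction_in a : P a -> exists b c, [/\ P b, P c, c != 0 & iota a = iota b / iota c].
Proof.
by move=> Pa; exists a, 1; rewrite rmorph1 divr1 oner_neq0.
Qed.

Lemma invariant_fraction_in a : P a -> uh_invariant sA a -> invariant_fraction (iota a).
Proof.
by move=> Pa ia; split; [apply: fraction_in|apply: extends_invariant ext ia].
Qed.

Lemma invariant_fractionA (c : K) : invariant_fraction (c *: 1).
Proof.
have -> : c *: 1 = iota (c *: 1) by rewrite linearZ /= rmorph1.
by apply: invariant_fraction_in; [apply/PZ/P1|apply/invariantZ/invariant1].
Qed.

(* An invariant fraction v = a/b is central, so v b = a can be multiplied on
   the right by other denominators. *)
Lemma invariant_fraction_den v w : invariant_fraction v -> invariant_fraction w ->
  exists a b c e, [/\ P a, P b, P c & P e] /\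
    [/\ b != 0, e != 0, v * iota b = iota a & w * iota e = iota c].
Proof.
move=> [[a [b [Pa Pb b0 ->]]] _] [[c [e [Pc Pe e0 ->]]] _]; exists a, b, c, e.
by split=> //; split=> //; rewrite divrK // Qdiv // iota_neq0.
Qed.

Let central v := inv_central h_neq0 fractions_good (v := v).

Let fracE v a b : P a -> P b -> b != 0 -> uh_invariant sQ v -> v * iota b = iota a ->
  invariant_fraction v.
Proof.
move=> Pa Pb b0 iv vb; split=> //; exists a, b; split=> //.
by rewrite -vb mulrK // Qdiv // iota_neq0.
Qed.

Let mulf_neq0 a b : a != 0 -> b != 0 -> a * b != 0.
Proof. by move=> a0 b0; apply/eqP => /fractions_domain[] /eqP; apply/negP. Qed.

Lemma invariant_fractionB v w : invariant_fraction v -> invariant_fraction w ->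
  invariant_fraction (v - w).
Proof.
move=> fv fw; have [a [b [c [e [[Pa Pb Pc Pe] [b0 e0 vb we]]]]]] := invariant_fraction_den fv fw.
apply: (@fracE _ (a * e - b * c) (b * e)); [by apply: (PB); apply: (PM)|exact: (PM)|exact: mulf_neq0| |].
  by apply: invariantB; [case: fv|case: fw].
have [_ /central wc] := fw.
by rewrite rmorphB !rmorphM /= mulrBl mulrA vb mulrA wc -mulrA we.
Qed.

Lemma invariant_fractionM v w : invariant_fraction v -> invariant_fraction w ->
  invariant_fraction (v * w).
Proof.
move=> fv fw; have [a [b [c [e [[Pa Pb Pc Pe] [b0 e0 vb we]]]]]] := invariant_fraction_den fv fw.
apply: (@fracE _ (a * c) (b * e)); [exact: (PM)|exact: (PM)|exact: mulf_neq0| |].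
  by apply: invariantM; [case: fv|case: fw].
have [_ /central wc] := fw.
by rewrite !rmorphM /= -mulrA [w * _]mulrA wc -mulrA we mulrA vb.
Qed.

Lemma invariant_fractionV v : invariant_fraction v -> invariant_fraction v^-1.
Proof.
have [->|v0] := eqVneq v 0; first by rewrite invr0.
move=> fv; have [a [b [_ [_ [[Pa Pb _ _] [b0 _ vb _]]]]]] := invariant_fraction_den fv fv.
apply: (@fracE _ b a) => //.
- apply: contra_neq v0 => a0; move: vb; rewrite a0 rmorph0 => /(congr1 (fun q => q / iota b)).
  by rewrite mulrK ?mul0r // Qdiv // iota_neq0.
- by apply: invariantV fractions_good _ _; case: fv.
- by rewrite -vb mulKr // Qdiv.
Qed.
End Fractions.

(** * Evaluating the splitting *)

Section Factorization.
Context {K : numFieldType} {h : K} {Q D : unitAlgType K} {g : {lrmorphism Q -> D}}.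
Context {S : fieldType} {emb : {rmorphism S -> D}} (n : nat) (cc : 'I_n.+1 -> S) (sig : 'I_n -> S).
Context (X Y : D).
Hypothesis XY : X * Y = Y * X.
Hypothesis Xe : forall c, X * emb c = emb c * X.
Hypothesis Ye : forall c, Y * emb c = emb c * Y.

(** The coefficients commute with [Y], and polynomials in [Y] with [X]; so both successive
    evaluations are ring morphisms although [D] is noncommutative. *)
Lemma splitting_eval :
  \sum_(i < n.+1) 'X ^+ (n - i) * 'X%:P ^+ i * (cc i)%:P%:P
    = (cc ord0)%:P%:P * \prod_(i < n) ('X - (sig i)%:P%:P * 'X%:P) :> {poly {poly S}} ->
  \sum_(i < n.+1) X ^+ (n - i) * Y ^+ i * emb (cc i)
    = emb (cc ord0) * \prod_(i < n) (X - emb (sig i) * Y).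
Proof.
have cY : commr_rmorph emb Y by [].
pose phi : {rmorphism {poly S} -> D} := horner_morph cY.
have phiC c : phi c%:P = emb c by apply: horner_morphC.
have phiX : phi 'X = Y by apply: horner_morphX.
have cX : commr_rmorph phi X.
  move=> p; rewrite /GRing.comm; elim/poly_ind: p => [|p c IH].
    by rewrite !rmorph0 mulr0 mul0r.
  rewrite rmorphD rmorphM /= phiC phiX mulrDr mulrDl Xe; congr (_ + _).
  by rewrite mulrA IH -mulrA XY mulrA.
pose psi : {rmorphism {poly {poly S}} -> D} := horner_morph cX.
have psiC p : psi p%:P = phi p by apply: horner_morphC.
have psiX : psi 'X = X by apply: horner_morphX.
move/(congr1 psi); rewrite rmorph_sum rmorphM rmorph_prod /= psiC phiC => e.
have -> : \sum_(i < n.+1) X ^+ (n - i) * Y ^+ i * emb (cc i) =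
  \sum_(i < n.+1) psi ('X ^+ (n - i) * 'X%:P ^+ i * (cc i)%:P%:P).
  apply: eq_bigr => i _; rewrite !rmorphM !rmorphXn /=.
  by rewrite psiX !psiC phiX phiC.
rewrite e; congr (_ * _); apply: eq_bigr => i _.
by rewrite rmorphB rmorphM /= psiX !psiC phiX phiC.
Qed.
End Factorization.

(** The linear form is additive in its last pair, and a scalar commuting with x_0 and y_0 comes out.
    This explains X_i = gamma - sigma_i x_1 and Y_i = delta - sigma_i y_1. *)
Lemma linear_form_shift {K : fieldType} {h : K} {D : algType K} (s0 x0 y0 x1 y1 c e : D) :
  (forall a, a \in [:: x0; y0] -> s0 * a = a * s0) ->
  linear_form_expr h x0 y0 (c - s0 * x1) (e - s0 * y1) =
  linear_form_expr h x0 y0 c e - s0 * linear_form_expr h x0 y0 x1 y1.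
Proof.
move=> sc; have sx : s0 * x0 = x0 * s0 by apply: sc; rewrite !inE eqxx.
have sy : s0 * y0 = y0 * s0 by apply: sc; rewrite !inE eqxx orbT.
rewrite /linear_form_expr !mulrBr -!scalerAr !mulrA sx sy.
by nc h.
Qed.

Section LinearFactorization.
Context {K : numFieldType} {h : K} {A : algType K} {sA : uh_action h A}.
Hypothesis h_neq0 : h != 0.
Context {Q : unitAlgType K} {iota : {lrmorphism A -> Q}} {sQ : uh_action h Q}.
Hypothesis Qg : good sQ.
Hypothesis iota_inj : injective iota.
Hypothesis ext : extends_action iota sA sQ.
Context (x0 y0 x1 y1 gamma delta f f1 : A) (n : nat) (u : 'I_n.+1 -> A).
Local Notation lform := (linear_form_expr h).
Local Notation xi := (lform x0 y0 gamma delta).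
Local Notation eta := (lform x0 y0 x1 y1).
Hypothesis xi_inv : uh_invariant sA xi.
Hypothesis eta_inv : uh_invariant sA eta.
Hypothesis f1_inv : uh_invariant sA f1.
Hypothesis f1_neq0 : f1 != 0.
Hypothesis f_neq0 : f != 0.
Hypothesis n_gt0 : (0 < n)%N.
Hypothesis u0 : u ord0 = f1.
Hypothesis fE : iota f = iota f1 ^- n * iota (\sum_(i < n.+1) xi ^+ (n - i) * eta ^+ i * u i).
Context {D : unitAlgType K} {g : {lrmorphism Q -> D}} {t : uh_action h D}.
Context {S : fieldType} {emb : {rmorphism S -> D}} (cc : 'I_n.+1 -> S) (sig : 'I_n -> S).
Hypothesis gext : extends_action g sQ t.
Hypothesis sig_inv : forall i, uh_invariant t (emb (sig i)).
Hypothesis sig_comm : forall i q, emb (sig i) * g q = g q * emb (sig i).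
Hypothesis ccE : forall i, emb (cc i) = g (iota f1 ^- n * iota (u i)).
Hypothesis split_eq :
  \sum_(i < n.+1) 'X ^+ (n - i) * 'X%:P ^+ i * (cc i)%:P%:P
    = (cc ord0)%:P%:P * \prod_(i < n) ('X - (sig i)%:P%:P * 'X%:P) :> {poly {poly S}}.
Variable k : set Q.
Hypothesis kI : forall q, k q -> uh_invariant sQ q.
Hypothesis genS : forall c, alg_span
  [set z | (exists2 q, k q & z = g q) \/ exists i, z = emb (sig i)]%classic (emb c).

Local Notation j := (g \o iota).
Let L (i : 'I_n) :=
  lform (j x0) (j y0) (j gamma - emb (sig i) * j x1) (j delta - emb (sig i) * j y1).

Let Qdiv := good_div Qg.
Let central (v : A) : uh_invariant sA v -> forall q, iota v * q = q * iota v.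
Proof. by move=> iv; apply: inv_central h_neq0 Qg _ (extends_invariant ext iv). Qed.

Let lformE i : L i = j xi - emb (sig i) * j eta.
Proof.
rewrite /L linear_form_shift; last by move=> a; rewrite !inE => /orP[] /eqP ->; apply: sig_comm.
by rewrite /= !morph_linear_form.
Qed.

Let jcomm v c : uh_invariant sA v -> j v * emb c = emb c * j v.
Proof.
move=> iv; apply: esym; apply: alg_span_comm (genS c) => z [[q _ ->]|[i ->]].
  by rewrite -[j v]/(g (iota v)) -!rmorphM central.
exact: sig_comm.
Qed.

Lemma linear_factors_invariant i : uh_invariant t (L i).
Proof.
have jinv v : uh_invariant sA v -> uh_invariant t (j v).
  by move=> iv; apply/(extends_invariant gext)/(extends_invariant ext).
by rewrite lformE; apply: invariantB; [apply: jinv|apply: invariantM => //; apply: jinv].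
Qed.

Lemma linear_factorization : g (iota f) = g (iota f1 ^- n.-1) * \prod_(i < n) L i.
Proof.
have xe : j xi * j eta = j eta * j xi by rewrite /= -!(rmorphM g) central.
have e := splitting_eval xe (fun c => jcomm c xi_inv) (fun c => jcomm c eta_inv) split_eq.
have f1u : iota f1 \is a GRing.unit.
  by apply: Qdiv; rewrite -(rmorph0 iota) (inj_eq iota_inj).
(* The leading coefficient is f1^-n u_0 with u_0 = f1, whence the exponent 1 - n. *)
have -> : g (iota f1 ^- n.-1) = emb (cc ord0).
  rewrite ccE u0; congr (g _); case: (n) n_gt0 => // m _ /=.
  by rewrite exprS invrM ?unitrX // divrK.
under eq_bigr do rewrite lformE.
rewrite -e fE rmorph_sum mulr_sumr rmorph_sum; apply: eq_bigr => i _ /=.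
rewrite ccE !rmorphM !rmorphXn /=.
have cX k' v w : (forall q, iota v * q = q * iota v) -> g (iota v) ^+ k' * g w = g w * g (iota v) ^+ k'.
  by move=> vc; apply/esym/commrX; rewrite /GRing.comm -!(rmorphM g) vc.
have c1 := cX (n - i)%N xi (iota f1 ^- n) (central xi_inv).
have c2 := cX i eta (iota f1 ^- n) (central eta_inv).
by rewrite !mulrA -[_ * _ * g _^-1]mulrA c2 !mulrA c1.
Qed.

Lemma linear_factors_neq0 i : L i != 0.
Proof.
apply: contra_neq f_neq0 => Li0; apply: iota_inj; rewrite rmorph0.
have gf0 : g (iota f) = 0.
  by rewrite linear_factorization (prod_commuting0 (mem_index_enum i) Li0) mulr0.
by apply: contra_eq gf0 => /(dr_rmorph_neq0 Qdiv g).
Qed.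

Lemma linear_factors_comm i i' : L i * L i' = L i' * L i.
Proof.
have jc v w : uh_invariant sA v -> j v * j w = j w * j v.
  by move=> iv; rewrite /= -!(rmorphM g) central.
have Lc v : uh_invariant sA v -> GRing.comm (L i) (j v).
  move=> iv; rewrite lformE; apply/commr_sym/commrB; first exact: jc.
  by apply: commrM; [apply: jcomm|apply: jc].
rewrite [L i']lformE; apply: commrB; first exact: Lc.
apply: commrM; last exact: Lc.
apply: commr_sym; rewrite lformE; apply: commrB; first exact: sig_comm.
by apply: commrM; [rewrite /GRing.comm -!rmorphM mulrC|apply: sig_comm].
Qed.
End LinearFactorization.

Local Open Scope classical_set_scope.

(** * Application to H_I *)

Section Presented.
Context {d : Order.disp_t} {K : numFieldType} {h : K} {I : orderType d}.

Lemma HI_jordanian (s : uh_action h (HI h I)) : HI_action s ->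
  jordanian s (HI_x h) (HI_y h).
Proof.
move=> sH; split.
- exact: sH.
- exact: HI_generated.
- exact: HI_yy.
- exact: HI_xy.
- exact: HI_xx.
- by move=> X Y; apply: HI_universal.
Qed.

Lemma homogE (k : I) m (a : HI h I) : homog k m a <-> ghomog (HI_x h) (HI_y h) k m a.
Proof.
split; elim=> *; do ?[exact: homog_x|exact: homog_y|exact: homog1|exact: homog0
  |exact: homogZ|exact: homogD|exact: homogM|exact: ghomog_x|exact: ghomog_y|exact: ghomog1
  |exact: ghomog0|exact: ghomogZ|exact: ghomogD|exact: ghomogM].
Qed.

Lemma polarizeE (k l : I) (D Dk : {linear HI h I -> HI h I}) m a :
  is_polarization k k Dk -> is_polarization k l D -> ghomog (HI_x h) (HI_y h) k m a ->
  polarize k D a = m%:R^-1 *: D a.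
Proof.
move=> Dk_pol D_pol hm; rewrite -(polarization_degree Dk_pol D_pol hm) /polarize.
congr ((xget _ _)%:R^-1 *: _); apply/funext => m'; apply/propext.
exact: homogE.
Qed.

Lemma iter_polarize (i0 i1 : I) (D00 D01 : {linear HI h I -> HI h I}) n A f :
  i0 != i1 -> is_polarization i0 i0 D00 -> is_polarization i0 i1 D01 ->
  (forall i, HJ (~` [set i0; i1]) (A i)) ->
  f = \sum_(i < n.+1) HI_x h i0 ^+ (n - i) * HI_y h i0 ^+ i * A i ->
  iter n (polarize i0 D01) f = \sum_(i < n.+1) HI_x h i1 ^+ (n - i) * HI_y h i1 ^+ i * A i.
Proof.
move=> i01 pol00 pol01 AJ fE.
apply: (iter_polarization_form i01 AJ fE pol01) => m a.
exact: polarizeE pol00 pol01.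
Qed.
End Presented.

Section Final.
Context {d : Order.disp_t} {K : numFieldType} {h : K} {I : orderType d}.
Hypothesis h_neq0 : h != 0.
Context {sH : uh_action h (HI h I)} {Q : unitAlgType K} {iota : {lrmorphism HI h I -> Q}}
  {sQ : uh_action h Q}.
Hypothesis sH_std : HI_action sH.
Hypothesis Q_quot : is_right_quotient iota.
Hypothesis sQ_ext : extends_action iota sH sQ.

Section Inhabited.
Context (i0 : I) (n : nat) (f1 : HI h I) (u : 'I_n.+1 -> HI h I).
Hypothesis y0_neq0 : HI_y h i0 != 0.
Hypothesis f1_neq0 : f1 != 0.
Hypothesis f1_J : HJ [set~ i0] f1.
Hypothesis f1_inv : uh_invariant sH f1.
Hypothesis u_J : forall i, HJ [set~ i0] (u i).
Hypothesis u_inv : forall i, uh_invariant sH (u i).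
Hypothesis u0 : u ord0 = f1.

Let jA := HI_jordanian sH_std.
Let Qdiv : division_ring Q. Proof. by case: Q_quot. Qed.
Let iota_inj : injective iota. Proof. by case: Q_quot. Qed.
Let frac : forall q, exists a b, b != 0 /\ q = iota a / iota b. Proof. by case: Q_quot. Qed.
Let Qg : good sQ := fractions_good h_neq0 jA Qdiv iota_inj frac sQ_ext y0_neq0.
Let k : set Q := QJinv iota sQ [set~ i0].
Let HJ1 := @alg_span1 _ _ [set a : HI h I | exists2 i, [set~ i0] i & a = HI_x h i \/ a = HI_y h i].

Lemma QJinvM a b : k a -> k b -> k (a * b).
Proof.
by apply: (invariant_fractionM h_neq0 jA Qdiv iota_inj frac sQ_ext y0_neq0 _ (v := a) (w := b)) => *;
  apply: alg_spanM.
Qed.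

Lemma QJinvV a : k a -> k a^-1.
Proof. exact: (invariant_fractionV h_neq0 jA Qdiv iota_inj frac sQ_ext y0_neq0 (v := a)). Qed.

Lemma QJinvB a b : k a -> k b -> k (a - b).
Proof.
by apply: (invariant_fractionB h_neq0 jA Qdiv iota_inj frac sQ_ext y0_neq0 _ _ (v := a) (w := b)) => *;
  [apply: alg_spanB|apply: alg_spanM].
Qed.

Lemma QJinvA (c : K) : k (c *: 1).
Proof.
apply: (invariant_fractionA sQ_ext HJ1) => c' a Ja; exact: alg_spanZ.
Qed.

Lemma QJinv_in a : HJ [set~ i0] a -> uh_invariant sH a -> k (iota a).
Proof. exact: (invariant_fraction_in sQ_ext HJ1). Qed.

Lemma QJinvX a m : k a -> k (a ^+ m).
Proof.
move=> ka; elim: m => [|m IH]; last by rewrite exprS; apply: QJinvM.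
by rewrite expr0 -[1]scale1r; apply: QJinvA.
Qed.

Lemma QJinv_coef m i : k (iota f1 ^- m * iota (u i)).
Proof.
by apply: QJinvM; [apply/QJinvV/QJinvX/QJinv_in|apply: QJinv_in].
Qed.

Lemma inhabited_splitting : inhabited (splitting iota sQ i0 f1 u).
Proof.
have iota0 : iota f1 != 0 by apply: iota_neq0 f1_neq0.
have c0 : iota f1 ^- n * iota (u ord0) != 0.
  rewrite u0; apply: (dr_mulf_neq0 Qdiv) => //.
  have : iota f1 ^- n \is a GRing.unit by rewrite unitrV; apply/unitrX/Qdiv.
  by apply: contraTneq => ->; rewrite unitr0.
have kI q : k q -> uh_invariant sQ q by case.
have [D [t [g [S [emb [cc [sig [[Dg ext si base coef] [sp genS genD]]]]]]]]] :=
  splitting_data h_neq0 Qg QJinvA QJinvB QJinvM QJinvV kI (QJinv_coef n) c0.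
constructor; apply: (@Splitting _ _ _ _ Q iota sQ i0 n f1 u D g t S emb cc sig) => //.
- exact: good_div Dg.
- by move=> i; apply: inv_fixG h_neq0 Dg _ (si i).
- by move=> i q; apply: inv_central h_neq0 Dg _ (si i) _.
Qed.

Section Decomposition.
Context (i1 : I) (gamma delta f : HI h I).
Hypothesis i01 : i0 != i1.
Hypothesis n_gt0 : (0 < n)%N.
Hypothesis f_neq0 : f != 0.
Hypothesis gamma_J : HJ [set~ i0] gamma.
Hypothesis delta_J : HJ [set~ i0] delta.
Local Notation xi := (linear_form_expr h (HI_x h i0) (HI_y h i0) gamma delta).
Local Notation eta := (bracket h i0 i1).
Hypothesis xi_inv : uh_invariant sH xi.
Hypothesis fE : iota f = iota f1 ^- n * iota (\sum_(i < n.+1) xi ^+ (n - i) * eta ^+ i * u i).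
Context (T : splitting iota sQ i0 f1 u).
Let j := fun a : HI h I => spj T (iota a).
Let sigma := fun i : 'I_n => sp_emb T (sp_sig T i).
Let X := fun i => j gamma - sigma i * j (HI_x h i1).
Let Y := fun i => j delta - sigma i * j (HI_y h i1).
Let L := fun i => linear_form_expr h (j (HI_x h i0)) (j (HI_y h i0)) (X i) (Y i).

Let eta_inv : uh_invariant sH eta := bracket_invariant (sH_std i0) (sH_std i1).

Lemma QJ_sigma_sub (a b : HI h I) i : HJ [set~ i0] a -> HJ [set~ i0] b ->
  QJ_sigma T [set~ i0] (j a - sigma i * j b).
Proof.
have jJ v : HJ [set~ i0] v -> QJ_sigma T [set~ i0] (j v).
  by move=> Jv; apply: alg_span_gen; left; exists (iota v) => //; apply: (fraction_in HJ1).
move=> Ja Jb; apply: alg_spanB; first exact: jJ.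
by apply: alg_spanM; [apply: alg_span_gen; right; exists i|apply: jJ].
Qed.

Lemma splitting_decomposition :
  [/\ f1 != 0 /\ QJinv iota sQ [set~ i0] (iota f1 ^- n.-1),
      forall i, QJ_sigma T [set~ i0] (X i) /\ QJ_sigma T [set~ i0] (Y i),
      forall i, L i != 0 /\ uh_invariant (sp_act T) (L i),
      forall i i', L i * L i' = L i' * L i
    & j f = spj T (iota f1 ^- n.-1) * \prod_(i < n) L i].
Proof.
have i1J : [set~ i0] i1 by move=> e; move: i01; rewrite e eqxx.
have x1J : HJ [set~ i0] (HI_x h i1) by apply: alg_span_gen; exists i1; [exact: i1J|left].
have y1J : HJ [set~ i0] (HI_y h i1) by apply: alg_span_gen; exists i1; [exact: i1J|right].
have kI q : k q -> uh_invariant sQ q by case.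
split.
- by split; [exact: f1_neq0|apply/QJinvV/QJinvX/QJinv_in].
- by move=> i; split; apply: QJ_sigma_sub.
- move=> i; split.
    exact: (linear_factors_neq0 h_neq0 Qg iota_inj sQ_ext xi_inv eta_inv f1_neq0 f_neq0
      n_gt0 u0 fE (@sp_comm _ _ _ _ _ _ _ _ _ _ _ T) (@sp_coef _ _ _ _ _ _ _ _ _ _ _ T)
      (sp_split T) (@sp_genS _ _ _ _ _ _ _ _ _ _ _ T) i).
  exact: (linear_factors_invariant sQ_ext xi_inv eta_inv (@sp_ext _ _ _ _ _ _ _ _ _ _ _ T)
    (@sp_inv _ _ _ _ _ _ _ _ _ _ _ T) (@sp_comm _ _ _ _ _ _ _ _ _ _ _ T) i).
- exact: (linear_factors_comm h_neq0 Qg sQ_ext xi_inv eta_inv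
    (@sp_comm _ _ _ _ _ _ _ _ _ _ _ T) (@sp_genS _ _ _ _ _ _ _ _ _ _ _ T)).
- exact: (linear_factorization h_neq0 Qg iota_inj sQ_ext xi_inv eta_inv f1_neq0
      n_gt0 u0 fE (@sp_comm _ _ _ _ _ _ _ _ _ _ _ T) (@sp_coef _ _ _ _ _ _ _ _ _ _ _ T)
      (sp_split T) (@sp_genS _ _ _ _ _ _ _ _ _ _ _ T)).
Qed.
End Decomposition.
End Inhabited.
End Final.

Theorem theorem14 (R : realType) (h : R[i]) (h_neq0 : h != 0)
    (d : Order.disp_t) (I : orderType d) (i0 i1 : I) (i01 : i0 != i1)
    (sH : uh_action h (HI h I)) (sH_std : HI_action sH)
    (Q : unitAlgType R[i]) (iota : {lrmorphism HI h I -> Q})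
    (Q_quot : is_right_quotient iota)
    (sQ : uh_action h Q) (sQ_ext : extends_action iota sH sQ)
    (Delta : I -> I -> {linear HI h I -> HI h I})
    (Delta_pol : forall k l, is_polarization k l (Delta k l))
    (n : nat) (n_gt0 : (0 < n)%N) (A : 'I_n.+1 -> HI h I) (f : HI h I)
    (f_form : is_nform sH i0 A f)
    (A_J : forall i, HJ (~` [set i0; i1]) (A i)) :
  let f1 := iter n (polarize i0 (Delta i0 i1)) f in
  let xi := polarize i1 (Delta i1 i0) f1 in
  let eta := bracket h i0 i1 in
  exists gamma delta : HI h I,
    [/\ HJ [set~ i0] gamma, HJ [set~ i0] delta
      & xi = linear_form_expr h (HI_x h i0) (HI_y h i0) gamma delta] /\
  exists u : 'I_n.+1 -> HI h I,
    is_typical_repr iota sH i0 f f1 xi eta u /\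
    inhabited (splitting iota sQ i0 f1 u) /\
    forall T : splitting iota sQ i0 f1 u,
      let j := fun a : HI h I => spj T (iota a) in
      let sigma := fun i : 'I_n => sp_emb T (sp_sig T i) in
      let X := fun i => j gamma - sigma i * j (HI_x h i1) in
      let Y := fun i => j delta - sigma i * j (HI_y h i1) in
      let L := fun i =>
        linear_form_expr h (j (HI_x h i0)) (j (HI_y h i0)) (X i) (Y i) in
      let C := iota f1 ^- n.-1 in
      [/\ f1 != 0 /\ QJinv iota sQ [set~ i0] C,
          forall i, QJ_sigma T [set~ i0] (X i) /\ QJ_sigma T [set~ i0] (Y i),
          forall i, L i != 0 /\ uh_invariant (sp_act T) (L i),
          forall i k, L i * L k = L k * L i
        & j f = spj T C * \prod_(i < n) L i].
Proof.
move=> f1 xi eta; have [eta_neq0 y0_neq0] := bracket_y_neq0 h i01.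
have jA := HI_jordanian sH_std; have [Qdiv iota_inj frac] := Q_quot.
have Qg := fractions_good h_neq0 jA Qdiv iota_inj frac sQ_ext y0_neq0.
(* H_I is a domain because it embeds in the division ring [Q]. *)
have dom := @fractions_domain _ _ Q iota Qdiv iota_inj.
have inv_fix := @subring_inv_fix _ _ h I _ sH _ _ h_neq0 jA Q iota sQ Qdiv iota_inj frac sQ_ext i0 y0_neq0.
have [f_neq0 f_inv _ fE] := f_form.
have f1E := iter_polarize i01 (Delta_pol i0 i0) (Delta_pol i0 i1) A_J fE.
have hf1 : ghomog (HI_x h) (HI_y h) i1 n f1.
  exact: (eq_ind_r (ghomog (HI_x h) (HI_y h) i1 n) (ghomog_form_swap A_J) f1E).
have xiE := polarizeE (Delta_pol i1 i1) (Delta_pol i1 i0) hf1.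
have [f1_neq0 f1_inv f1_J xi_inv [g [c [Jg Jc xiL [u [uP u0 e]]]]]] :=
  typical_representation_data jA dom inv_fix i01
  eta_neq0 y0_neq0 n_gt0 A_J f_neq0 f_inv fE (Delta_pol i1 i0) (Delta_pol i1 i1) f1E xiE.
have fQ := rmorph_solve Qdiv iota_inj f1_neq0 e.
exists g, c; split; first exact: And3 Jg Jc xiL.
exists u; split; last split.
- exact: And3 uP u0 fQ.
- have uJ i := proj1 (uP i); have u_inv i := proj2 (uP i).
  exact: (inhabited_splitting h_neq0 sH_std Q_quot sQ_ext y0_neq0 f1_neq0 f1_J f1_inv uJ u_inv u0).
rewrite xiL in fQ xi_inv; move=> T; cbv zeta.
exact: (splitting_decomposition h_neq0 sH_std Q_quot sQ_ext y0_neq0 f1_neq0 f1_J f1_inv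
  u0 i01 n_gt0 f_neq0 Jg Jc xi_inv fQ T).
Qed.
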